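(* Let $\mathbb{K}$ be an algebraically closed field of characteristic zero, let $Y$ be a flexible irreducible affine variety over $\mathbb{K}$, and let $f\in\mathbb{K}[Y]$ be a non-constant regular function. Then the suspension $\operatorname{Susp}(Y,f)$ is a smooth flexible affine factorial variety if and only if $Y$ is factorial and smooth, $f$ is a prime element of $\mathbb{K}[Y]$, and $\{f=0\}$ is a smooth subvariety of $Y$.
   Context: The suspension $\operatorname{Susp}(Y,f)$ is the hypersurface in $\mathbb{A}^2\times Y$ (with $\mathbb{A}^2=\operatorname{Spec}\mathbb{K}[u,v]$) given by $uv=f$. A $\mathbb{G}_a$-subgroup of $\operatorname{Aut}(X)$ is the image of a regular action of the additive group $\mathbb{G}_a$ on $X$. A smooth point $x$ of $X$ is flexible if $T_xX$ is spanned by the tangent vectors at $x$ to the orbits through $x$ of $\mathbb{G}_a$-subgroups; $X$ is flexible if every smooth point is flexible. A variety is factorial if its coordinate ring (for affine varieties) is a unique factorization domain. *)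

(* Defs.v *)
(* with multinomials (mpoly).  Affine varieties over an
   algebraically closed field K are modelled classically: as Zariski-closed
   subsets of K^n, with coordinate ring K[X] = K[x_1..x_n] / I(X), whose
   elements are represented by polynomials modulo "agree on X". *)
From HB Require Import structures.
From mathcomp Require Import all_boot all_order all_algebra.
From mathcomp Require Import mpoly.
Set Implicit Arguments. Unset Strict Implicit. Unset Printing Implicit Defensive.
Import Order.TTheory GRing.Theory.
Local Open Scope ring_scope.

Section AffVar.
Variable K : closedFieldType.

Definition point (n : nat) := 'I_n -> K.

Definition zclosed n (X : point n -> Prop) : Prop :=
  exists S : {mpoly K[n]} -> Prop,
    forall x, X x <-> (forall p, S p -> p.@[x] = 0).

Definition affine_variety n (X : point n -> Prop) := zclosed X.

Definition subsetP n (Z X : point n -> Prop) := forall x, Z x -> X x.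

Definition irreducible_var n (X : point n -> Prop) : Prop :=
  zclosed X /\ (exists x, X x) /\
  forall Z1 Z2 : point n -> Prop, zclosed Z1 -> zclosed Z2 ->
    (forall x, X x -> Z1 x \/ Z2 x) ->
    subsetP X Z1 \/ subsetP X Z2.

Definition eqX n (X : point n -> Prop) (p q : {mpoly K[n]}) :=
  forall x, X x -> p.@[x] = q.@[x].

Definition unitX n (X : point n -> Prop) p :=
  exists q : {mpoly K[n]}, eqX X (p * q) 1.
Definition dvdX n (X : point n -> Prop) (p q : {mpoly K[n]}) :=
  exists r : {mpoly K[n]}, eqX X q (p * r).
Definition assocX n (X : point n -> Prop) (p q : {mpoly K[n]}) :=
  exists u, unitX X u /\ eqX X p (u * q).

Definition domainX n (X : point n -> Prop) :=
  ~ eqX X 1 0 /\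
  forall a b : {mpoly K[n]}, eqX X (a * b) 0 -> eqX X a 0 \/ eqX X b 0.

Definition irreducibleX n (X : point n -> Prop) (p : {mpoly K[n]}) :=
  ~ eqX X p 0 /\ ~ unitX X p /\
  forall a b, eqX X p (a * b) -> unitX X a \/ unitX X b.

Definition primeX n (X : point n -> Prop) (p : {mpoly K[n]}) :=
  ~ eqX X p 0 /\ ~ unitX X p /\
  forall a b, dvdX X p (a * b) -> dvdX X p a \/ dvdX X p b.

Definition factorial_var n (X : point n -> Prop) :=
  domainX X /\
  (forall p : {mpoly K[n]}, ~ eqX X p 0 -> ~ unitX X p ->
     exists s : seq {mpoly K[n]},
       (forall q, q \in s -> irreducibleX X q) /\ eqX X p (\prod_(q <- s) q)) /\
  (forall s t : seq {mpoly K[n]},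
     (forall q, q \in s -> irreducibleX X q) ->
     (forall q, q \in t -> irreducibleX X q) ->
     eqX X (\prod_(q <- s) q) (\prod_(q <- t) q) ->
     exists t', perm_eq t t' /\ size s = size t' /\
       forall i, (i < size s)%N -> assocX X (nth 0 s i) (nth 0 t' i)).

(* T_x X = K-derivations K[X] -> K at x (i.e. (m_x/m_x^2)^* ) *)
Definition tangent n (X : point n -> Prop) (x : point n)
    (D : {mpoly K[n]} -> K) :=
  (forall p q, eqX X p q -> D p = D q) /\
  (forall (a : K) p q, D (a *: p + q) = a * D p + D q) /\
  (forall p q, D (p * q) = p.@[x] * D q + q.@[x] * D p).

Definition in_span n (V : ({mpoly K[n]} -> K) -> Prop) (D : {mpoly K[n]} -> K) :=
  exists (m : nat) (c : 'I_m -> K) (E : 'I_m -> {mpoly K[n]} -> K),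
    (forall i, V (E i)) /\ forall p, D p = \sum_(i < m) c i * E i p.

Definition tangent_dim n (X : point n -> Prop) (x : point n) (d : nat) :=
  exists E : 'I_d -> {mpoly K[n]} -> K,
    (forall i, tangent X x (E i)) /\
    (forall c : 'I_d -> K, (forall p, \sum_(i < d) c i * E i p = 0) ->
        forall i, c i = 0) /\
    (forall D, tangent X x D -> in_span (fun E' => exists i, E' = E i) D).

Definition chain_at n (X : point n -> Prop) (x : point n) (d : nat)
    (Z : nat -> point n -> Prop) :=
  (forall i, (i <= d)%N -> irreducible_var (Z i) /\ subsetP (Z i) X) /\
  Z 0%N x /\
  (forall i, (i < d)%N -> subsetP (Z i) (Z i.+1) /\
      exists y, Z i.+1 y /\ ~ Z i y).

Definition local_dim n (X : point n -> Prop) (x : point n) (d : nat) :=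
  (exists Z, chain_at X x d Z) /\
  (forall d' Z, chain_at X x d' Z -> (d' <= d)%N).

Definition smooth_point n (X : point n -> Prop) (x : point n) :=
  exists d, local_dim X x d /\ tangent_dim X x d.

Definition smooth n (X : point n -> Prop) := forall x, X x -> smooth_point X x.

Definition ext n (t : K) (x : point n) : point n.+1 :=
  fun i => match unlift ord0 i with Some j => x j | None => t end.

Definition act n (Phi : n.-tuple {mpoly K[n.+1]}) (t : K) (x : point n)
  : point n := fun i => (tnth Phi i).@[ext t x].

Definition Ga_action n (X : point n -> Prop) (Phi : n.-tuple {mpoly K[n.+1]}) :=
  (forall t x, X x -> X (act Phi t x)) /\
  (forall x, X x -> forall i, act Phi 0 x i = x i) /\
  (forall s t x, X x -> forall i, act Phi (s + t) x i = act Phi s (act Phi t x) i).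

Definition orbit_tangent n (Phi : n.-tuple {mpoly K[n.+1]}) (x : point n)
  : {mpoly K[n]} -> K :=
  fun p => ((p \mPo Phi)^`M(ord0)).@[ext 0 x].

Definition orbit_tangents n (X : point n -> Prop) (x : point n)
    (D : {mpoly K[n]} -> K) :=
  exists Phi, Ga_action X Phi /\ forall p, D p = orbit_tangent Phi x p.

Definition flexible_point n (X : point n -> Prop) (x : point n) :=
  forall D, tangent X x D -> in_span (orbit_tangents X x) D.

Definition flexible n (X : point n -> Prop) :=
  forall x, X x -> smooth_point X x -> flexible_point X x.

(* Susp(Y,f) = { (u, v, y) in A^2 x Y | u v = f(y) }, coordinates
   u = z_0, v = z_1, y = (z_2, ..., z_(n+1)) *)
Definition susp_y n (z : point n.+2) : point n :=
  fun i => z (lift ord0 (lift ord0 i)).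

Definition Susp n (Y : point n -> Prop) (f : {mpoly K[n]}) : point n.+2 -> Prop :=
  fun z => Y (susp_y z) /\ z ord0 * z (lift ord0 ord0) = f.@[susp_y z].

Definition zero_locus n (Y : point n -> Prop) (f : {mpoly K[n]}) : point n -> Prop :=
  fun y => Y y /\ f.@[y] = 0.

End AffVar.

(* Main.v *)
(* Factoriality.  Let A = K[Y] and B = A[u,v]/(uv - f), so that B[1/u] =
   A[u,1/u] and B/(u) = (A/f)[v].  If f is prime in A, then so is u in B, and a
   prime factorization in A[u] (Gauss) of u^N b can be read in B and freed of
   its factors u, as in Nagata's criterion.  Conversely, a prime factorization
   in B of a constant a consists, up to powers of u, of monomials r u^m with r
   in A, because these are the only divisors of a u^N in A[u]; and u, being
   irreducible, is then prime, which makes f prime.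

   Geometry.  The tangent space of the suspension at (u, v, y) consists of the
   (a, b, w) with w tangent to Y at y and v a + u b = df(w).  Given that Y is
   smooth, the suspension is therefore smooth exactly when df is nonzero on the
   tangent spaces of Y along f = 0, that is when f = 0 is smooth.  A
   G_a-action Phi on Y lifts to (u, v, y) |-> (u, v + t q(t u, y), Phi(t u, y))
   where f(Phi(s, y)) = f(y) + s q(s, y).  Together with the actions obtained by
   exchanging u and v, these lifts span the tangent spaces at points where df
   is nonzero and (u, v) is not (0, 0); flexibility is then transported to the
   other points along orbits.

   Dimensions.  At a flexible point x with tangent space of dimension d,
   composing d actions gives a polynomial map from affine d-space to X, sending
   0 to x and immersive there.  The closures of the images of coordinate
   subspaces form a chain of length d through x, by the Jacobian criterion for
   algebraic independence, while a dominant map from affine d-space bounds the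
   length of every chain by d.  Projecting such maps for the suspension to Y gives
   the chains that make Y smooth.  Chains in f = 0 come likewise from the
   hypersurface of affine space cut out by the prime factor of the pullback of
   f that vanishes at 0. *)
Require Import Defs.
From HB Require Import structures.
From mathcomp Require Import all_boot all_order all_algebra.
From mathcomp Require Import mpoly ring zify.
From Stdlib Require Import Classical ClassicalEpsilon FunctionalExtensionality.
Set Implicit Arguments. Unset Strict Implicit. Unset Printing Implicit Defensive.
Import Order.TTheory GRing.Theory.
Local Open Scope ring_scope.

(** * Divisibility and prime factorizations in integral domains *)

Section Divisibility.
Variable R : idomainType.
Implicit Types (a b c p q u : R) (s t : seq R).

(** Smoothness compares tangent dimensions with lengths of chains of irreducible closed sets, so
    each smoothness claim needs one long chain and a bound on all chains. Both come from polynomial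
    maps defined on affine space: an immersive one yields a chain, a dominant one a bound. At a
    smooth point, an immersive map with as many parameters as the dimension is also dominant, since
    otherwise the variety itself could be put on top of its chain. Flexibility provides such maps.
    Two consequences are used throughout: the tangent dimension is the same at all points of a
    smooth flexible variety, and a nonconstant [f] pulls back to a nonconstant polynomial, which has
    a root and, in characteristic zero, a nonzero derivative somewhere. The root shows that [f] is
    not a unit and yields a dominant map to the suspension; the derivative yields the points from
    which flexibility is transported. From the suspension back to [Y], constancy of the tangent
    dimension forces [df] to be nonzero along [f = 0]: otherwise the dimension would be [d + 2] at
    [(0, 0, y)] instead of [d + 1]. *)

Definition rdvd a b := exists c, b = c * a.
Definition rprime p :=
  [/\ p != 0, p \isn't a GRing.unit
    & forall a b, rdvd p (a * b) -> rdvd p a \/ rdvd p b].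
Definition rirreducible p :=
  [/\ p != 0, p \isn't a GRing.unit
    & forall a b, p = a * b -> a \is a GRing.unit \/ b \is a GRing.unit].
Definition rprimes s := forall q, q \in s -> rprime q.
Definition rirreducibles s := forall q, q \in s -> rirreducible q.

(** Existence of factorizations into primes stands in for factoriality: it is multiplicative in [p]
    and passes easily to polynomial rings and localizations. The explicit unit lets units be
    factored by the empty product. *)
Definition prime_factored p :=
  exists u s, [/\ u \is a GRing.unit, rprimes s & p = u * \prod_(q <- s) q].
Definition prime_factorization := forall p, p != 0 -> prime_factored p.

Definition unique_factorization :=
  (forall p, p != 0 -> p \isn't a GRing.unit ->
     exists2 s, rirreducibles s & p = \prod_(q <- s) q) /\
  (forall s t, rirreducibles s -> rirreducibles t ->
     \prod_(q <- s) q = \prod_(q <- t) q ->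
     exists t', [/\ perm_eq t t', size s = size t' &
       forall i, (i < size s)%N ->
         exists2 u, u \is a GRing.unit & s`_i = u * t'`_i]).

Lemma rdvd_refl a : rdvd a a. Proof. by exists 1; rewrite mul1r. Qed.

Lemma rdvd1 a : rdvd 1 a. Proof. by exists a; rewrite mulr1. Qed.

Lemma rdvd_mull a b c : rdvd a b -> rdvd a (c * b).
Proof. by move=> [x ->]; exists (c * x); rewrite mulrA. Qed.

Lemma rdvd_mulr a b c : rdvd a b -> rdvd a (b * c).
Proof. by rewrite mulrC; apply: rdvd_mull. Qed.

Lemma rdvd_add a b c : rdvd a b -> rdvd a c -> rdvd a (b + c).
Proof. by move=> [x ->] [y ->]; exists (x + y); rewrite mulrDl. Qed.

Lemma rdvd_sub a b c : rdvd a b -> rdvd a c -> rdvd a (b - c).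
Proof. by move=> [x ->] [y ->]; exists (x - y); rewrite mulrBl. Qed.

Lemma rdvd_unit a u : u \is a GRing.unit -> rdvd a u -> a \is a GRing.unit.
Proof. by move=> Uu [c E]; move: Uu; rewrite E unitrM => /andP[]. Qed.

Lemma unitr_mul_eq1 a b : a * b = 1 -> a \is a GRing.unit.
Proof. by move=> E; apply/unitrP; exists b; rewrite mulrC E. Qed.

Lemma rprime_irreducible p : rprime p -> rirreducible p.
Proof.
case=> p0 pU pP; split=> // a b E.
have [|[c Ea]|[c Eb]] := pP a b; first by rewrite -E; apply: rdvd_refl.
- right; apply: (@unitr_mul_eq1 _ c).
  by apply: (mulfI p0); rewrite mulr1 [in RHS]E Ea; ring.
- left; apply: (@unitr_mul_eq1 _ c).
  by apply: (mulfI p0); rewrite mulr1 [in RHS]E Eb; ring.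
Qed.

Lemma rirreducible_unitM u p : u \is a GRing.unit -> rirreducible p ->
  rirreducible (u * p).
Proof.
move=> Uu [p0 pU pP]; split.
- by rewrite mulf_neq0 //; apply: contraTneq Uu => ->; rewrite unitr0.
- by rewrite unitrM Uu.
move=> a b E; have [||] := pP (u^-1 * a) b.
- by rewrite -mulrA -E mulKr.
- by rewrite unitrM => /andP[_ ?]; left.
by right.
Qed.

Lemma rdvd_irreducible p q : p \isn't a GRing.unit -> rirreducible q ->
  rdvd p q -> exists2 u, u \is a GRing.unit & q = u * p.
Proof. by move=> pU [q0 qU qP] [c E]; exists c => //; case: (qP c p E) => // H; rewrite H in pU. Qed.

Lemma rprime_prod p s : rprime p -> rdvd p (\prod_(q <- s) q) ->
  exists2 q, q \in s & rdvd p q.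
Proof.
move=> [p0 pU pP]; elim: s => [|a s IH]; first by rewrite big_nil => /rdvd_unit; rewrite unitr1 (negbTE pU) => /(_ isT).
rewrite big_cons => /pP[?|/IH[q qs ?]]; first by exists a; rewrite // mem_head.
by exists q; rewrite // inE qs orbT.
Qed.

Lemma rprime_dvd_unitM p u a : rprime p -> u \is a GRing.unit -> rdvd p (u * a) -> rdvd p a.
Proof. by move=> pP Uu [c E]; exists (u^-1 * c); rewrite -mulrA -E mulKr. Qed.

Lemma rprime_dvd_factored p u s : rprime p -> u \is a GRing.unit ->
  rirreducibles s -> rdvd p (u * \prod_(q <- s) q) ->
  exists w q, [/\ w \is a GRing.unit, q \in s, q = w * p &
    u * \prod_(r <- s) r = p * ((u * w) * \prod_(r <- rem q s) r)].
Proof.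
move=> pP Uu sP /(rprime_dvd_unitM pP Uu) /(rprime_prod pP)[q qs pq].
have [w Uw E] := rdvd_irreducible (let: And3 _ H _ := pP in H) (sP q qs) pq.
exists w, q; split=> //; rewrite (perm_big _ (perm_to_rem qs)) big_cons /=.
by move: (\prod_(r <- rem q s) r) => Z; rewrite E; ring.
Qed.

Lemma prime_factoredM a b : prime_factored a -> prime_factored b ->
  prime_factored (a * b).
Proof.
move=> [u [s [Uu sP ->]]] [v [t [Uv tP ->]]]; exists (u * v), (s ++ t).
split; first by rewrite unitrM Uu.
- by move=> q; rewrite mem_cat => /orP[/sP|/tP].
by rewrite big_cat /=; ring.
Qed.

Lemma prime_factored_unit u : u \is a GRing.unit -> prime_factored u.
Proof. by move=> Uu; exists u, [::]; split=> //; rewrite big_nil mulr1. Qed.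

Lemma prime_factored_prime p : rprime p -> prime_factored p.
Proof.
by move=> pP; exists 1, [:: p]; split; rewrite ?unitr1 // ?big_seq1 ?mul1r // => q; rewrite inE => /eqP->.
Qed.

Lemma prime_factored_prod s : (forall q, q \in s -> prime_factored q) ->
  prime_factored (\prod_(q <- s) q).
Proof.
elim: s => [|a s IH] sP; first by rewrite big_nil; apply/prime_factored_unit/unitr1.
by rewrite big_cons; apply: prime_factoredM; [apply/sP/mem_head | apply: IH => q qs; apply: sP; rewrite inE qs orbT].
Qed.

(** Any prime factor of an irreducible element is associate to it. *)
Lemma factorization_irreducible_prime p :
  prime_factorization -> rirreducible p -> rprime p.
Proof.
move=> F pI; have [p0 pU pP] := pI; have [u [s [Uu sP E]]] := F p p0.
case: s sP E => [|q s] sP; first by rewrite big_nil mulr1 => E; rewrite E Uu in pU.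
have [q0 qU qP] := sP q (mem_head _ _).
rewrite big_cons => E; have Ev : p = (u * \prod_(j <- s) j) * q by rewrite E; ring.
have [|//] := pP _ _ Ev; last by move=> H; rewrite H in qU.
move=> Uv; split=> // a b [c Ec].
have [||] := qP a b; first by exists (c * (u * \prod_(j <- s) j)); rewrite Ec {1}Ev; ring.
- by move=> [d ->]; left; exists (d * (u * \prod_(j <- s) j)^-1); rewrite Ev -mulrA mulKr.
by move=> [d ->]; right; exists (d * (u * \prod_(j <- s) j)^-1); rewrite Ev -mulrA mulKr.
Qed.

(** If [c p = a b], factor [a], [b] and [c] into irreducibles; uniqueness makes [p] associate to one
    of the factors of [a] or of [b]. *)
Lemma unique_factorization_prime p : unique_factorization ->
  rirreducible p -> rprime p.
Proof.
move=> [ex un] pI; have [p0 pU _] := pI; split=> // a b [c E].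
have ex' x : x != 0 -> exists u s, [/\ u \is a GRing.unit, rirreducibles s & x = u * \prod_(q <- s) q].
  move=> x0; case: (boolP (x \is a GRing.unit)) => [Ux|xU].
    by exists x, [::]; split; rewrite ?big_nil ?mulr1.
  by have [s sP Es] := ex x x0 xU; exists 1, s; split; rewrite ?unitr1 ?mul1r.
case: (eqVneq a 0) => [->|a0]; first by left; exists 0; rewrite mul0r.
case: (eqVneq b 0) => [->|b0]; first by right; exists 0; rewrite mul0r.
have c0 : c != 0 by apply: contraNneq (mulf_neq0 a0 b0) => H; rewrite E H mul0r.
have [u [s [Uu sP Ea]]] := ex' a a0; have [v [t [Uv tP Eb]]] := ex' b b0.
have [w [r [Uw rP Ec]]] := ex' c c0.
have stP : rirreducibles (s ++ t) by move=> q; rewrite mem_cat => /orP[/sP|/tP].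
(* The units of the three factorizations are absorbed into [p], which is put in front so that index
   0 finds its partner. *)
have prP : rirreducibles ((u * v)^-1 * w * p :: r).
  move=> q; rewrite inE => /orP[/eqP->|/rP//]; apply: rirreducible_unitM => //.
  by rewrite unitrM Uw unitrV unitrM Uu Uv.
have Uuv : u * v \is a GRing.unit by rewrite unitrM Uu.
have Eprod : \prod_(q <- (u * v)^-1 * w * p :: r) q = \prod_(q <- s ++ t) q.
  rewrite big_cat big_cons /=; apply: (mulrI Uuv); rewrite !mulrA divrr // mul1r.
  by transitivity (c * p); [rewrite Ec; ring | rewrite -E Ea Eb; ring].
have [t' [pt _ /(_ 0%N isT)]] := un _ _ prP stP Eprod.
move=> [z Uz /= Ez].
(* An empty [t'] would give the default value 0 at index 0, hence [p = 0]. *)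
have t0 : t'`_0 \in s ++ t.
  rewrite (perm_mem pt) mem_nth //; case: (t') pt Ez => // _ /= /eqP.
  by rewrite mulr0 mulf_eq0 (negbTE p0) orbF => /eqP H; move: (Uw); rewrite -(unitrMr _ (x:=(u*v)^-1)) ?unitrV // H unitr0.
have pt0 : rdvd p t'`_0.
  exists (z^-1 * ((u * v)^-1 * w)); rewrite -mulrA Ez mulrA mulVr ?mul1r //.
move: t0; rewrite mem_cat => /orP[H|H]; [left|right].
  by rewrite Ea (perm_big _ (perm_to_rem H)) big_cons /=; apply: rdvd_mull; apply: rdvd_mulr.
by rewrite Eb (perm_big _ (perm_to_rem H)) big_cons /=; apply: rdvd_mull; apply: rdvd_mulr.
Qed.

Lemma unique_factorizationP : unique_factorization <-> prime_factorization.
Proof.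
split=> [U p p0|F].
  case: (boolP (p \is a GRing.unit)) => [/prime_factored_unit//|pU].
  have [s sP E] := U.1 p p0 pU; exists 1, s; split; rewrite ?unitr1 ?mul1r // => q /sP.
  exact: unique_factorization_prime.
have irrP s : rirreducibles s -> rprimes s.
  by move=> sP q /sP; apply: factorization_irreducible_prime.
(* The unit [w] is carried by the induction, because cancelling [p] against an associate leaves a
   unit behind. *)
have un s : forall t w, w \is a GRing.unit -> rirreducibles s -> rirreducibles t ->
     \prod_(q <- s) q = w * \prod_(q <- t) q ->
     exists t', [/\ perm_eq t t', size s = size t' &
       forall i, (i < size s)%N ->
         exists2 u, u \is a GRing.unit & s`_i = u * t'`_i].
  elim: s => [|p s IH] t w Uw sP tP E.
    exists [::]; split=> //; case: t tP E => // q t tP; rewrite big_nil big_cons => E.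
    have [_ qU _] := tP q (mem_head _ _).
    case/negP: qU; apply: (@unitr_mul_eq1 _ (w * \prod_(j <- t) j)); rewrite [RHS]E /=; ring.
  have pP : rprime p by apply: irrP sP _ (mem_head _ _).
  have p0 : p != 0 by case: pP.
  have dp : rdvd p (w * \prod_(q <- t) q) by rewrite -E big_cons; apply/rdvd_mulr/rdvd_refl.
  have [z [q [Uz qt Eq Et]]] := rprime_dvd_factored pP Uw tP dp.
  have [|||| t' [pt sz H]] := IH (rem q t) (w * z).
  - by rewrite unitrM Uw.
  - by move=> r rs; apply: sP; rewrite inE rs orbT.
  - by move=> r /mem_rem; apply: tP.
  - by apply: (mulfI p0); rewrite -Et -E big_cons.
  exists (q :: t'); split; rewrite /= ?sz //.
    by rewrite (perm_trans (perm_to_rem qt)) // perm_cons.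
  case=> [_|i] /=; last by rewrite -sz; apply: H.
  by exists z^-1; rewrite ?unitrV // Eq mulKr.
split=> [p p0 pU|s t sP tP E].
  have [u [[|q s] [Uu sP E]]] := F p p0; first by rewrite E big_nil mulr1 Uu in pU.
  exists (u * q :: s); last by rewrite E !big_cons mulrA.
  move=> r; rewrite inE => /orP[/eqP->|rs].
    by apply: rirreducible_unitM => //; apply/rprime_irreducible/sP/mem_head.
  by apply/rprime_irreducible/sP; rewrite inE rs orbT.
by apply: (un s t 1); rewrite ?unitr1 ?mul1r.
Qed.
End Divisibility.

(** * Gauss's lemma *)

Section Gauss.
Variable R : idomainType.
Hypothesis RF : prime_factorization R.
Implicit Types (p q a b : {poly R}) (c : R).

Lemma rdvd_polyCP c p : rdvd c%:P p <-> forall i, rdvd c p`_i.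
Proof.
split=> [[q ->] i|H]; first by exists q`_i; rewrite coefMC.
have {}H i : exists d, p`_i = d * c by apply: H.
pose g i := proj1_sig (constructive_indefinite_description _ (H i)).
exists (\poly_(i < size p) g i); apply/polyP=> i; rewrite coefMC coef_poly.
case: ltnP => [_|/(nth_default 0) ->]; last by rewrite mul0r.
by rewrite /g; case: constructive_indefinite_description.
Qed.

Lemma poly_drop_lead p : p != 0 ->
  exists2 q, p = lead_coef p *: 'X^((size p).-1) + q & (size q < size p)%N.
Proof.
move=> p0; have sp : (0 < size p)%N by rewrite size_poly_gt0.
exists (\poly_(i < (size p).-1) p`_i); last first.
  by apply: leq_ltn_trans (size_poly _ _) _; rewrite prednK.
apply/polyP=> i; rewrite coefD coefZ coefXn coef_poly lead_coefE.
case: (ltngtP i (size p).-1) => [_|H|->]; rewrite ?mulr0 ?add0r ?mulr1 ?addr0 //.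
by rewrite nth_default // -ltnS -(prednK sp) ltnS.
Qed.

Lemma rprime_polyC c : rprime c -> rprime c%:P.
Proof.
move=> [c0 cU cP]; split; first by rewrite polyC_eq0.
  by rewrite poly_unitE size_polyC c0 coefC /=.
suff H n : forall p q, (size p + size q <= n)%N -> rdvd c%:P (p * q) -> rdvd c%:P p \/ rdvd c%:P q.
  by move=> p q; apply: H (leqnn _).
elim: n => [|n IH] p q.
  rewrite leqn0 addn_eq0 !size_poly_eq0 => /andP[/eqP-> _] _; left; exists 0; rewrite mul0r //.
move=> le dpq.
case: (eqVneq p 0) => [->|p0]; first by left; exists 0; rewrite mul0r.
case: (eqVneq q 0) => [->|q0]; first by right; exists 0; rewrite mul0r.
have [p1 Ep sp] := poly_drop_lead p0; have [q1 Eq sq] := poly_drop_lead q0.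
have : rdvd c (lead_coef p * lead_coef q).
  by rewrite -lead_coefM lead_coefE; exact: (proj1 (rdvd_polyCP _ _) dpq).
have dC (a : R) m : rdvd c a -> rdvd c%:P (a *: 'X^m).
  by move=> [d ->]; exists (d *: 'X^m); rewrite [RHS]mulrC mul_polyC scalerA mulrC.
case/cP => dl.
  have [||dp1|] := IH p1 q; last by right.
  - by rewrite -ltnS; apply: leq_trans le; rewrite ltn_add2r.
  - have -> : p1 * q = p * q - (lead_coef p *: 'X^((size p).-1)) * q by rewrite {1}Ep; ring.
    by apply: rdvd_sub => //; apply/rdvd_mulr/dC.
  by left; rewrite Ep; apply: rdvd_add => //; apply: dC.
have [|||dp1] := IH p q1; last by right; rewrite Eq; apply: rdvd_add => //; apply: dC.
- by rewrite -ltnS; apply: leq_trans le; rewrite ltn_add2l.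
- have -> : p * q1 = p * q - p * (lead_coef q *: 'X^((size q).-1)) by rewrite {1}Eq; ring.
  by apply: rdvd_sub => //; apply/rdvd_mull/dC.
by left.
Qed.

Definition primitive p := forall c, rprime c -> ~ rdvd c%:P p.

(* Dividing out a prime constant shortens the factorization of the leading
   coefficient, so it can be done only finitely often. *)
Lemma primitive_part p : p != 0 ->
  exists c q, [/\ c != 0, p = c%:P * q & primitive q].
Proof.
move=> p0; have [u [s [Uu sP E]]] := RF (p := lead_coef p) (etrans (f_equal negb (lead_coef_eq0 p)) p0).
elim: {s}(size s) {-2}s (leqnn (size s)) u Uu sP p p0 E => [|n IH] s ls u Uu sP p p0 E.
  exists 1, p; split; rewrite ?oner_neq0 ?mul1r // => c [c0 cU _] [q Eq].
  case/negP: cU; apply: rdvd_unit Uu _; exists (lead_coef q).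
  move: E; rewrite Eq lead_coefM lead_coefC => ->.
  by case: s ls {sP} => //; rewrite big_nil mulr1.
case: (classic (exists2 c, rprime c & rdvd c%:P p)) => [[c cP [q Eq]]|pp]; last first.
  by exists 1, p; split; rewrite ?oner_neq0 ?mul1r // => c cP cp; apply: pp; exists c.
have c0 : c != 0 by case: cP.
have dc : rdvd c (u * \prod_(q <- s) q).
  by exists (lead_coef q); rewrite -E Eq lead_coefM lead_coefC.
have [w [r [Uw rs Er Es]]] := rprime_dvd_factored cP Uu (fun x xs => rprime_irreducible (sP x xs)) dc.
have q0 : q != 0 by apply: contraNneq p0 => H; rewrite Eq H mul0r.
have [||||d [q' [d0 Eq' pq']]] := IH (rem r s) _ (u * w) _ _ q q0.
- by rewrite size_rem //; case: (size s) ls.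
- by rewrite unitrM Uu.
- by move=> x /mem_rem/sP.
- by apply: (mulfI c0); rewrite -Es -E Eq lead_coefM lead_coefC mulrC.
by exists (c * d), q'; split; rewrite ?mulf_neq0 // Eq Eq' polyCM; ring.
Qed.

(** The prime factors of [c] are cancelled one at a time: each divides [p * b] and not the primitive
    [p], hence divides [b]. *)
Lemma primitive_cancel c (p a b : {poly R}) : c != 0 -> primitive p -> c%:P * a = p * b ->
  exists2 b', b = c%:P * b' & a = p * b'.
Proof.
move=> c0; have [u [s [Uu sP ->]]] := RF c0 => pp.
elim: s sP a b => [|q s IH] sP a b.
  rewrite big_nil mulr1 => E; exists (u^-1%:P * b).
    by rewrite mulrA -polyCM divrr // mul1r.
  by rewrite mulrCA -E mulrA -polyCM mulVr // mul1r.
rewrite big_cons => E.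
have qP := sP q (mem_head _ _); have q0 : q != 0 by case: qP.
have [|/(pp _ qP)//|[b1 Eb1]] := (let: And3 _ _ H := rprime_polyC qP in H) p b.
  by rewrite -E !polyCM; exists (u%:P * (\prod_(j <- s) j)%:P * a); ring.
have [||b' E1 E2] := IH _ a b1.
- by move=> r rs; apply: sP; rewrite inE rs orbT.
- have q0' : q%:P != 0 by rewrite polyC_eq0.
  apply: (mulfI q0'); transitivity (p * b); last by rewrite Eb1; ring.
  by rewrite -E !polyCM; ring.
by exists b' => //; rewrite Eb1 E1 !polyCM; ring.
Qed.

Import Pdiv.Idomain.

(** Both [irreducible_poly] and [%|] ignore nonzero constants, so they speak of polynomials over the
    fraction field, where Euclid's lemma is available; [primitive_cancel] brings the quotient back
    to [R]. *)
Lemma primitive_irreducible_prime p : primitive p -> irreducible_poly p -> rprime p.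
Proof.
move=> pp [sp pI]; have p0 : p != 0 by rewrite -size_poly_gt0; apply: ltn_trans sp.
split=> //; first by apply/negP; rewrite poly_unitE => /andP[/eqP E]; rewrite E in sp.
have dP a : p %| a -> rdvd p a.
  case/Pdiv.Idomain.dvdpP => [[c q]] /= c0; rewrite -mul_polyC mulrC => E.
  have [b' _ ->] : exists2 b', q = c%:P * b' & a = p * b'.
    by apply: primitive_cancel => //; rewrite mulrC E mulrC.
  by exists b'; rewrite mulrC.
move=> a b [c E].
have pab : p %| a * b by apply/Pdiv.Idomain.dvdpP; exists (1, c); rewrite ?oner_neq0 //= scale1r.
case: (boolP (coprimep p a)) => [/Gauss_dvdpr H|].
  by right; apply: dP; rewrite -H.
rewrite coprimep_def => /(pI _) /(_ (dvdp_gcdl _ _)) H; left; apply: dP.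
by rewrite -(eqp_dvdl _ H) dvdp_gcdr.
Qed.

Lemma prime_factored_polyC c : c != 0 -> prime_factored c%:P.
Proof.
move=> c0; have [u [s [Uu sP ->]]] := RF c0; rewrite polyCM; apply: prime_factoredM.
  by apply: prime_factored_unit; rewrite poly_unitE size_polyC coefC Uu andbT (_ : u != 0) //; apply: contraTneq Uu => ->; rewrite unitr0.
rewrite rmorph_prod -(big_map polyC xpredT id); apply: prime_factored_prod.
by move=> _ /mapP[q qs ->]; apply/prime_factored_prime/rprime_polyC/sP.
Qed.

(** Induction on the size: the content is factored in [R], and a primitive part that is not prime
    splits over the fraction field into two factors of smaller size. *)
Lemma prime_factorization_poly : prime_factorization {poly R}.
Proof.
move=> p; elim: {p}(size p) {-2}p (leqnn (size p)) => [|n IH] p.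
  by rewrite leqn0 size_poly_eq0 => ->.
move=> ls p0; have [c [q [c0 Ep pq]]] := primitive_part p0.
rewrite Ep; apply: prime_factoredM; first exact: prime_factored_polyC.
have q0 : q != 0 by apply: contraNneq p0 => H; rewrite Ep H mulr0.
have sq : size p = size q by rewrite Ep mul_polyC size_scale.
rewrite {}sq in ls; case: (leqP (size q) 1) => [/size1_polyC E|sq].
  by rewrite E; apply: prime_factored_polyC; rewrite -polyC_eq0 -E.
case: (classic (irreducible_poly q)) => [/(primitive_irreducible_prime pq)|].
  exact: prime_factored_prime.
move=> H; have [a [sa aq naq]] : exists a, [/\ size a != 1%N, a %| q & ~~ (a %= q)].
  apply: NNPP => H'; apply: H; split=> // a sa aq; apply: contraT => naq.
  by case: H'; exists a.
have [[d b] /= d0] := Pdiv.Idomain.dvdpP _ _ aq; rewrite -mul_polyC => E.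
have a0 : a != 0 by apply: contraTneq aq => ->; rewrite dvd0p.
have b0 : b != 0 by apply/negP=> /eqP b0; move: E; rewrite b0 mul0r => /eqP; rewrite mulf_eq0 polyC_eq0 (negbTE d0) (negbTE q0).
have sE : size q = (size a + size b).-1.
  by rewrite addnC -size_mul // -E mul_polyC size_scale.
have sa' : (size a < size q)%N.
  rewrite ltn_neqAle dvdp_leq // andbT; apply: contra naq => sE'.
  by rewrite -dvdp_size_eqp.
have sb' : (size b < size q)%N.
  have : (0 < size a)%N by rewrite size_poly_gt0. lia.
(* Clearing the denominator in [d q = a b]: each prime factor of [d] divides [a] or [b] and is
   removed there, which leaves the sizes unchanged. *)
have [a' [b' [Eq sa2 sb2]]] : exists a' b', [/\ q = a' * b', size a' = size a & size b' = size b].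
  have [u [s [Uu sP Ed]]] := RF d0; rewrite {d d0}Ed in E.
  have {E} : u%:P * (\prod_(j <- s) j)%:P * q = a * b by rewrite -polyCM E mulrC.
  clear aq naq sa sE sa' sb'; elim: s sP a b a0 b0 => [|r s IHs] sP a b a0 b0.
    rewrite big_nil mulr1 => E; exists (u^-1%:P * a), b; split=> //.
      by rewrite -mulrA -E mulrA -polyCM mulVr // mul1r.
    by rewrite mul_polyC size_scale // invr_eq0; apply: contraTneq Uu => ->; rewrite unitr0.
  rewrite big_cons => E; have rP := sP r (mem_head _ _).
  have r0 : r != 0 by case: rP.
  have sP' : rprimes s by move=> x xs; apply: sP; rewrite inE xs orbT.
  have r0' : r%:P != 0 by rewrite polyC_eq0.
  have [|[a1 Ea]|[b1 Eb]] := (let: And3 _ _ H := rprime_polyC rP in H) a b.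
  - by rewrite -E !polyCM; exists (u%:P * (\prod_(j <- s) j)%:P * q); ring.
  - have a10 : a1 != 0 by apply: contraNneq a0 => H1; rewrite Ea H1 mul0r.
    have [|a' [b' [Eq S1 S2]]] := IHs sP' a1 b a10 b0.
      apply: (mulfI r0'); transitivity (a * b); last by rewrite Ea; ring.
      by rewrite -E !polyCM; ring.
    by exists a', b'; rewrite S1 S2; split=> //; rewrite Ea mulrC mul_polyC size_scale.
  - have b10 : b1 != 0 by apply: contraNneq b0 => H1; rewrite Eb H1 mul0r.
    have [|a' [b' [Eq S1 S2]]] := IHs sP' a b1 a0 b10.
      apply: (mulfI r0'); transitivity (a * b); last by rewrite Eb; ring.
      by rewrite -E !polyCM; ring.
    by exists a', b'; rewrite S1 S2; split=> //; rewrite Eb mulrC mul_polyC size_scale.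
have [a0' b0'] : a' != 0 /\ b' != 0 by apply/andP; rewrite -negb_or -mulf_eq0 -Eq.
rewrite Eq; apply: prime_factoredM; apply: IH => //; rewrite -ltnS ?sa2 ?sb2.
  exact: leq_trans sa' ls.
exact: leq_trans sb' ls.
Qed.
End Gauss.

(** * Factorization in the suspension ring *)

Lemma rprime_expr_bound (R : idomainType) (f a : R) :
  prime_factorization R -> rprime f -> a != 0 ->
  exists N, forall m, rdvd (f ^+ m) a -> (m <= N)%N.
Proof.
move=> RF fP a0; have [u [s [Uu sP ->]]] := RF a a0; exists (size s) => m.
have f0 : f != 0 by case: fP.
elim: m s u Uu sP => // m IH s u Uu sP [c E].
have [|w [q [Uw qs Eq Es]]] := rprime_dvd_factored fP Uu (fun x xs => rprime_irreducible (sP x xs)).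
  by exists (c * f ^+ m); rewrite E exprS; ring.
have -> : size s = (size (rem q s)).+1 by rewrite (perm_size (perm_to_rem qs)).
apply: (IH (rem q s) (u * w)); first by rewrite unitrM Uu.
  by move=> x /mem_rem/sP.
by exists c; apply: (mulfI f0); rewrite -Es E exprS; ring.
Qed.

(** The cancellation in Nagata's criterion: among the prime factors, [N] are associates of [p] and
    can be struck out. *)
Lemma rprime_cancel_factored (R : idomainType) (p b : R) N :
  rprime p -> prime_factored (p ^+ N * b) -> prime_factored b.
Proof.
move=> pP; have p0 : p != 0 by case: pP.
elim: N => [|N IH]; first by rewrite expr0 mul1r.
move=> [u [s [Uu sP E]]]; apply: IH.
have [|w [q [Uw qs Eq Es]]] := rprime_dvd_factored pP Uu (fun x xs => rprime_irreducible (sP x xs)).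
  by exists (p ^+ N * b); rewrite -E exprS; ring.
exists (u * w), (rem q s); split; first by rewrite unitrM Uu.
  by move=> x /mem_rem/sP.
by apply: (mulfI p0); rewrite -Es -E exprS mulrA.
Qed.

(** As long as [m] is positive, the constant term of [P] or of [Q] is zero and a factor ['X] can be
    removed from it. *)
Lemma monomial_factor (R : idomainType) (P Q : {poly R}) a m :
  a != 0 -> P * Q = a *: 'X^m -> exists r k, P = r *: 'X^k.
Proof.
move=> a0; elim: m P Q => [|m IH] P Q E.
  exists P`_0, 0%N; rewrite expr0 alg_polyC; apply/size1_polyC.
  have [P0 Q0] : P != 0 /\ Q != 0.
    by apply/andP; rewrite -negb_or -mulf_eq0 E expr0 alg_polyC polyC_eq0.
  have := size_mul P0 Q0; rewrite E expr0 alg_polyC size_polyC a0.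
  have : (0 < size Q)%N by rewrite size_poly_gt0.
  lia.
have X0 : ('X : {poly R}) != 0 by rewrite polyX_eq0.
have XP (p : {poly R}) : p`_0 = 0 -> exists q, p = q * 'X.
  move=> p0; have /factor_theorem[q ->] : root p 0 by rewrite rootE horner_coef0 p0.
  by exists q; rewrite subr0.
have /eqP : P`_0 * Q`_0 = 0.
  by rewrite -!horner_coef0 -hornerM E hornerZ hornerXn expr0n mulr0.
rewrite mulf_eq0 => /orP[/eqP/XP[P1 EP]|/eqP/XP[Q1 EQ]].
  have [|r [k EP1]] := IH P1 Q.
    by apply: (mulIf X0); rewrite -scalerAl -exprSr -E EP; ring.
  by exists r, k.+1; rewrite EP EP1 -scalerAl -exprSr.
by apply: (IH P Q1); apply: (mulIf X0); rewrite -scalerAl -exprSr -E EQ; ring.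
Qed.

Lemma polyX_irreducible (R : idomainType) : rirreducible ('X : {poly R}).
Proof.
have cU (a b : {poly R}) : size a = 1%N -> 'X = a * b -> a \is a GRing.unit.
  move=> /eqP/size_poly1P[c c0 ->] /(congr1 (fun p : {poly R} => p`_1)).
  rewrite coefX coefCM eqxx => /esym/unitr_mul_eq1 cU.
  by rewrite poly_unitE size_polyC c0 coefC.
split; rewrite ?polyX_eq0 // ?poly_unitE ?size_polyX // => a b E.
have : a * b != 0 by rewrite -E polyX_eq0.
rewrite mulf_eq0 negb_or => /andP[a0 b0]; have := size_mul a0 b0.
rewrite -E size_polyX; move: a0 b0; rewrite -!size_poly_gt0 => a0 b0 S.
have [S1|S1] : size a = 1%N \/ size b = 1%N by lia.
  by left; apply: cU S1 E.
by right; apply: cU S1 _; rewrite mulrC; apply: E.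
Qed.

Lemma poly_split_const (R : comNzRingType) (P : {poly R}) : exists Q, P = Q * 'X + (P`_0)%:P.
Proof.
elim/poly_ind: P => [|P c _]; first by exists 0; rewrite coef0 mul0r addr0.
by exists P; rewrite coefD coefMX coefC add0r.
Qed.

Section Suspension.
(* [B] is the suspension ring [A[u,v]/(uv - f)], with [u = ju 'X], [v = jv 'X]. *)
Variables (A B : idomainType) (f : A) (ju jv : {rmorphism {poly A} -> B}).
Hypothesis juvC : forall c, jv c%:P = ju c%:P.
Local Notation u := (ju 'X).
Local Notation v := (jv 'X).
Hypothesis uvE : u * v = ju f%:P.
(** With [uniq_dec] this says that [B] is the direct sum of [A[u]] and [v A[v]], with the monomials
    not divisible by [uv] as a basis over [A]. *)
Hypothesis dec : forall b, exists P Q, b = ju P + v * jv Q.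
Hypothesis uniq_dec : forall P Q, ju P + v * jv Q = 0 -> P = 0 /\ Q = 0.

Lemma susp_ju_inj : injective ju.
Proof.
move=> P Q E; apply/eqP; rewrite -subr_eq0; apply/eqP.
by have [] := @uniq_dec (P - Q) 0; rewrite // rmorph0 mulr0 addr0 rmorphB E subrr.
Qed.

Lemma susp_u_neq0 : u != 0.
Proof.
by apply/eqP; rewrite -(rmorph0 ju) => /susp_ju_inj/eqP; rewrite polyX_eq0.
Qed.

(** Since [u ^ N v ^ k = f ^ k u ^ (N - k)], the coefficient at [u ^ i] carries the factor
    [f ^ (N - i)]. Truncated subtraction makes the condition void for [i >= N]. This divisibility is
    how membership in [B] is recognized inside [A[u, 1/u]]. *)
Lemma susp_jvE Q : exists N P, u ^+ N * jv Q = ju P /\ forall i, rdvd (f ^+ (N - i)) P`_i.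
Proof.
elim/poly_ind: Q => [|Q c [N [P [E D]]]].
  exists 0%N, 0; rewrite !rmorph0 mulr0; split=> // i.
  by rewrite coef0; exists 0; rewrite mul0r.
exists N.+1, (f *: P + c *: 'X^(N.+1)); split.
  rewrite rmorphD rmorphM /= juvC rmorphD -!mul_polyC !rmorphM /= rmorphXn -E -uvE exprS; ring.
move=> i; rewrite coefD !coefZ coefXn; have [d ->] := D i.
case: eqP => [->|_]; first by rewrite subnn expr0; apply: rdvd1.
rewrite mulr0 addr0; case: (leqP i N) => [le|lt].
  by rewrite subSn //; exists d; rewrite exprS; ring.
rewrite (_ : (N.+1 - i = 0)%N) ?expr0; last by apply/eqP; rewrite subn_eq0.
exact: rdvd1.
Qed.

Lemma susp_fraction b : exists N P, u ^+ N * b = ju P /\ forall i, rdvd (f ^+ (N - i)) P`_i.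
Proof.
have [P [Q ->]] := dec b; have [N [R [E D]]] := susp_jvE (Q * 'X).
exists N, ('X^N * P + R); split.
  by rewrite rmorphD !rmorphM rmorphXn -E rmorphM; ring.
move=> i; rewrite coefD; apply: rdvd_add => //; rewrite coefXnM.
case: ltnP => [_|/eqP->]; first by exists 0; rewrite mul0r.
by rewrite expr0; apply: rdvd1.
Qed.

Lemma susp_den b : exists N P, u ^+ N * b = ju P.
Proof. by have [N [P [E _]]] := susp_fraction b; exists N, P. Qed.

(** The divisibility of coefficients does not depend on the chosen denominator: two fractions for
    [b] agree after multiplication by powers of [u]. *)
Lemma susp_dvd_coef b M P i : u ^+ M * b = ju P -> rdvd (f ^+ (M - i)) P`_i.
Proof.
have [N [T [ET DT]]] := susp_fraction b => E.
have {E ET} E : 'X^N * P = 'X^M * T.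
  by apply: susp_ju_inj; rewrite !rmorphM !rmorphXn -E -ET; ring.
have := congr1 (fun p : {poly A} => p`_(i + N)) E.
rewrite !coefXnM ltnNge leq_addl addnK /= => ->.
case: ltnP => [_|le]; first by exists 0; rewrite mul0r.
by have := DT (i + N - M)%N; rewrite (_ : (N - (i + N - M) = M - i)%N) //; lia.
Qed.

Lemma susp_monomial_dvd b M r m : u ^+ M * b = ju (r *: 'X^m) -> (m < M)%N -> rdvd f r.
Proof.
move=> E lt; have := susp_dvd_coef m E; rewrite coefZ coefXn eqxx mulr1.
rewrite -(subnSK lt) exprS => [[c ->]]; exists (c * f ^+ (M - m.+1)); ring.
Qed.

Lemma susp_unit_coef r s k m n : ju (r *: 'X^m) * ju (s *: 'X^n) = u ^+ k ->
  r * s = 1 /\ (m + n = k)%N.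
Proof.
rewrite -rmorphM -rmorphXn => /susp_ju_inj.
rewrite -scalerAl -scalerAr scalerA -exprD => E.
have Ek := congr1 (fun p : {poly A} => p`_k) E.
have : r * s != 0.
  apply: contraTneq (oner_neq0 A) => H; move: Ek; rewrite H scale0r coef0 coefXn eqxx => /esym/eqP -> //.
move: Ek; rewrite coefZ !coefXn eqxx; case: eqP => [->|_]; first by rewrite mulr1.
by rewrite mulr0 => /esym/eqP; rewrite oner_eq0.
Qed.

(** Induction on the number of primes of [B]. The first prime [q] divides a monomial in [A[u, 1/u]],
    so it is [r] times a power of [u], and [r] splits off from [a]. If [q] divides [u], then [r] is
    a unit; otherwise [q] divides [r], and [r] is a unit or inherits primality from [q]. *)
Lemma susp_descent_aux a m N w s : a != 0 -> w \is a GRing.unit -> rprimes s ->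
  u ^+ N * (w * \prod_(q <- s) q) = ju (a *: 'X^m) -> prime_factored a.
Proof.
have u0 := susp_u_neq0.
elim: s a m N => [|q s IH] a m N a0 Uw sP E.
  have [M [P EP]] := susp_den w^-1.
  have EE : ju (a *: 'X^m) * ju P = u ^+ (N + M).
    rewrite -E -EP big_nil mulr1 mulrACA mulrC divrr // mul1r -exprD //.
  have : P * (a *: 'X^m) = 1 *: 'X^(N + M).
    by apply: susp_ju_inj; rewrite scale1r rmorphXn rmorphM mulrC.
  case/monomial_factor => [|r [k EP']]; first exact: oner_neq0.
  apply: prime_factored_unit; move: EE; rewrite EP'.
  by case/susp_unit_coef => /unitr_mul_eq1.
have [M1 [P EP]] := susp_den q; have [M2 [Q EQ]] := susp_den (w * \prod_(q <- s) q).
have qP := sP q (mem_head _ _).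
have EPQ : P * ('X^N * Q) = a *: 'X^(m + M1 + M2).
  apply: susp_ju_inj; rewrite !rmorphM rmorphXn -EP -EQ -addnA exprD scalerAl rmorphM -E big_cons rmorphXn /= exprD; ring.
have [r [k Er]] := monomial_factor a0 EPQ.
have [a' [l Ea']] : exists a' l, 'X^N * Q = a' *: 'X^l.
  by apply: (monomial_factor a0 (Q := P)); rewrite mulrC EPQ.
have Ea : a = r * a'.
  move: EPQ; rewrite Er Ea' -scalerAl -scalerAr scalerA -exprD => EPQ.
  have := congr1 (fun p : {poly A} => p`_(m + M1 + M2)) EPQ.
  rewrite !coefZ !coefXn eqxx mulr1; case: eqP => [_|_ H]; first by rewrite mulr1.
  by rewrite -H mulr0 eqxx in a0.
have [r0 a'0] : r != 0 /\ a' != 0 by apply/andP; rewrite -negb_or -mulf_eq0 -Ea.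
rewrite Ea; apply: prime_factoredM; last first.
  apply: (IH a' l (N + M2)%N) => //; first by move=> x xs; apply: sP; rewrite inE xs orbT.
  by rewrite -Ea' rmorphM rmorphXn -EQ exprD mulrA.
have {Er EP}EP : u ^+ M1 * q = ju r%:P * u ^+ k by rewrite EP Er -mul_polyC rmorphM rmorphXn.
have [q0 qU qdvd] := qP.
case: (classic (rdvd q u)) => [[e Ee]|nqu].
  have [M3 [T ET]] := susp_den e.
  have E1 : ju (r *: 'X^k) * ju T = u ^+ (M1 + M3).+1.
    rewrite -ET -mul_polyC rmorphM rmorphXn -EP mulrACA [q * e]mulrC -Ee -exprD exprSr //.
  have : T * (r *: 'X^k) = 1 *: 'X^((M1 + M3).+1).
    by apply: susp_ju_inj; rewrite scale1r rmorphXn rmorphM mulrC.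
  case/monomial_factor => [|t [l' ET']]; first exact: oner_neq0.
  apply: prime_factored_unit; move: E1; rewrite ET'.
  by case/susp_unit_coef => /unitr_mul_eq1.
have qr : rdvd q (ju r%:P).
  have : rdvd q (ju r%:P * u ^+ k) by exists (u ^+ M1); rewrite EP.
  case/qdvd => // {}qk; case: nqu; elim: k qk {Ea' EP} => [|k IHk].
    by move/rdvd_unit; rewrite expr0 unitr1 (negbTE qU) => /(_ isT).
  by rewrite exprS => /qdvd[].
case: (boolP (r \is a GRing.unit)) => [/prime_factored_unit//|rU].
apply: prime_factored_prime; split=> // x y [z Ez].
(* Divisibility by [q] in [B] descends to divisibility by [r] in [A]: read off the coefficient of
   the only monomial on the left-hand side. *)
have dx x1 : rdvd q (ju x1%:P) -> rdvd r x1.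
  move=> [c Ec]; have [M3 [T ET]] := susp_den c.
  have : x1 *: 'X^(M1 + M3) = (r *: T) * 'X^k.
    apply: susp_ju_inj; rewrite -!mul_polyC !rmorphM !rmorphXn Ec -ET exprD.
    transitivity (u ^+ M3 * c * (u ^+ M1 * q)); first by ring.
    by rewrite EP; ring.
  move/(congr1 (fun p : {poly A} => p`_(M1 + M3))); rewrite coefZ coefXn eqxx mulr1.
  rewrite coefMXn; case: ltnP => _ ->; first by exists 0; rewrite mul0r.
  by rewrite coefZ; exists T`_(M1 + M3 - k); rewrite mulrC.
have : rdvd q (ju x%:P * ju y%:P).
  rewrite -rmorphM -polyCM Ez polyCM rmorphM; exact: rdvd_mull.
by case/qdvd => /dx; [left|right].
Qed.

Lemma susp_descent : prime_factorization B -> prime_factorization A.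
Proof.
move=> BF a a0; have [|w [s [Uw sP E]]] := BF (ju a%:P).
  by apply/eqP; rewrite -(rmorph0 ju) => /susp_ju_inj/eqP; rewrite polyC_eq0 (negbTE a0).
apply: (@susp_descent_aux a 0 0 w s) => //.
by rewrite !expr0 mul1r -E alg_polyC.
Qed.

(** If [u = a b], then [a = r u ^ (m - M)] and [b = t u ^ (n - N)] with [r t = 1] and exponents
    adding up to 1. A negative exponent would make [f] divide the unit [r] or [t], so one exponent
    is 0 and that factor is a unit. *)
Lemma susp_u_irreducible : f != 0 -> f \isn't a GRing.unit -> rirreducible u.
Proof.
move=> f0 fU; have u0 := susp_u_neq0.
have nf r s : r * s = 1 -> ~ rdvd f r.
  move=> /unitr_mul_eq1 Ur /(rdvd_unit Ur) H; by rewrite H in fU.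
split=> //.
  apply/negP=> Uu; have [N [P EP]] := susp_den u^-1.
  have EE : ju (1 *: 'X^1) * ju P = u ^+ N.
    by rewrite -EP scale1r expr1 mulrCA divrr // mulr1.
  have : P * 'X = 1 *: 'X^N.
    by apply: susp_ju_inj; rewrite scale1r rmorphXn rmorphM mulrC -EE scale1r expr1.
  case/monomial_factor => [|r [k EP']]; first exact: oner_neq0.
  move: EE; rewrite EP' => /susp_unit_coef[E1 E2].
  rewrite EP' in EP; have lt : (k < N)%N by rewrite -E2.
  by apply: (nf r 1); [rewrite mulrC | apply: susp_monomial_dvd EP lt].
move=> a b E; have [M [P EP]] := susp_den a; have [N [Q EQ]] := susp_den b.
have EPQ : P * Q = 1 *: 'X^((M + N).+1).
  apply: susp_ju_inj; rewrite scale1r rmorphXn rmorphM -EP -EQ exprSr exprD {5}E; ring.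
have [r [m Er]] := monomial_factor (oner_neq0 _) EPQ.
have [t [n Et]] : exists t n, Q = t *: 'X^n.
  by apply: (monomial_factor (oner_neq0 _) (Q := P)); rewrite mulrC EPQ.
move: EPQ => /(congr1 ju); rewrite rmorphM scale1r rmorphXn Er Et => /susp_unit_coef[E1 E2].
have lem : (M <= m)%N.
  by rewrite leqNgt; apply/negP=> lt; apply: (nf r t) => //; rewrite Er in EP; apply: susp_monomial_dvd EP lt.
have len : (N <= n)%N.
  rewrite leqNgt; apply/negP=> lt; apply: (nf t r); first by rewrite mulrC.
  by rewrite Et in EQ; apply: susp_monomial_dvd EQ lt.
have jU x y : x * y = 1 -> ju x%:P \is a GRing.unit.
  by move=> Exy; apply: (@unitr_mul_eq1 _ _ (ju y%:P)); rewrite -rmorphM -polyCM Exy rmorph1.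
have fin x K s (k : nat) : u ^+ K * x = ju (s *: 'X^k) -> k = K -> x = ju s%:P.
  move=> Ex Ek; apply: (mulfI (expf_neq0 K u0)); rewrite Ex Ek -mul_polyC rmorphM rmorphXn mulrC //.
have [Em|Em] : m = M \/ n = N by lia.
- by left; rewrite Er in EP; rewrite (fin _ _ _ _ EP Em); apply: jU E1.
- by right; rewrite Et in EQ; rewrite (fin _ _ _ _ EQ Em); apply: (jU t r); rewrite mulrC.
Qed.

(** An element of [A] divisible by [u] in [B] is divisible by [f] in [A], and [u] divides [f = u v];
    primality of [u] thus restricts to primality of [f]. *)
Lemma susp_prime : f != 0 -> f \isn't a GRing.unit -> prime_factorization B -> rprime f.
Proof.
move=> f0 fU BF; have u0 := susp_u_neq0.
have [_ _ uP] := factorization_irreducible_prime BF (susp_u_irreducible f0 fU).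
split=> // x y [z Ez].
have dx x1 : rdvd u (ju x1%:P) -> rdvd f x1.
  move=> [c Ec]; have [M [R ER]] := susp_den c.
  have E : x1 *: 'X^M = R * 'X.
    by apply: susp_ju_inj; rewrite -mul_polyC !rmorphM rmorphXn Ec -ER; ring.
  case: M ER E => [|M] ER E.
    move: E => /(congr1 (fun p : {poly A} => p`_0)); rewrite coefZ coefXn coefMX mulr1 => ->.
    by exists 0; rewrite mul0r.
  move: E => /(congr1 (fun p : {poly A} => p`_M.+1)); rewrite coefZ coefXn coefMX eqxx mulr1 /= => ->.
  by have := susp_dvd_coef M ER; rewrite subSnn expr1.
have : rdvd u (ju x%:P * ju y%:P).
  by rewrite -rmorphM -polyCM Ez polyCM rmorphM -uvE; exists (ju z%:P * v); ring.
by case/uP => /dx; [left|right].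
Qed.

(** This is [B/(u) = (A/f)[v]] without quotients: modulo [u] every element is some [jv S] ([red]),
    and [u] divides [jv S] exactly when [f] divides [S] ([udvd]). *)
Lemma susp_u_prime : rprime f -> rprime u.
Proof.
move=> fP; have [f0 fU _] := fP; have u0 := susp_u_neq0.
have [_ uU _] := susp_u_irreducible f0 fU.
have [_ _ fCP] := rprime_polyC fP.
have red b : exists S, rdvd u (b - jv S).
  have [P [Q ->]] := dec b; have [P1 E] := poly_split_const P.
  exists ((P`_0)%:P + 'X * Q); exists (ju P1).
  rewrite {1}E !rmorphD !rmorphM /= juvC; ring.
have udvd S : rdvd u (jv S) <-> rdvd f%:P S.
  split=> [[b Eb]|[T ->]]; last by rewrite rmorphM juvC -uvE; exists (jv T * v); ring.
  have [P [Q Edec]] := dec b; have [Q1 EQ] := poly_split_const Q; have [S1 ES] := poly_split_const S.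
  (* The two arguments are the components in [A[u]] and [v A[v]] of [jv S - u b], where [u v Q] has
     been rewritten as [f Q], with its constant term moved to the first component. *)
  have [] := @uniq_dec ((S`_0)%:P - P * 'X - (f * Q`_0)%:P) (S1 - f%:P * Q1).
    have Ev : jv S = ju (S`_0)%:P + v * jv S1.
      by rewrite {1}ES rmorphD rmorphM juvC; ring.
    have Eq : jv Q = ju (Q`_0)%:P + v * jv Q1.
      by rewrite {1}EQ rmorphD rmorphM juvC; ring.
    rewrite !rmorphB /= polyCM !rmorphM /= juvC -uvE.
    have := Eb; rewrite Edec Ev Eq => H.
    transitivity ((ju (S`_0)%:P + v * jv S1) - (ju P + v * (ju (Q`_0)%:P + v * jv Q1)) * u); first by ring.
    by rewrite H subrr.
  move=> E0 /eqP; rewrite subr_eq0 => /eqP ES1.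
  move: E0 => /(congr1 (fun p : {poly A} => p`_0)); rewrite !coefB coefMX !coefC /= subr0.
  move=> /eqP; rewrite subr_eq0 => /eqP ES0.
  by exists ((Q`_0)%:P + Q1 * 'X); rewrite ES ES0 ES1 polyCM; ring.
split=> // b c d; have [S [x Ex]] := red b; have [T [y Ey]] := red c.
have bE : b = jv S + x * u by rewrite -Ex; ring.
have cE : c = jv T + y * u by rewrite -Ey; ring.
have : rdvd f%:P (S * T).
  apply/udvd; have -> : jv (S * T) = b * c - (jv S * y + x * c) * u.
    by rewrite rmorphM bE cE; ring.
  by apply: rdvd_sub => //; exists (jv S * y + x * c).
case/fCP => /udvd H; [left; rewrite bE|right; rewrite cE]; apply: rdvd_add => //.
  by exists x.
by exists y.
Qed.

(** Unless [q] is associate to ['X], its image is [u ^ m q'] with [u] not dividing [q']. Then [q']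
    is prime: divisibility holds in [A[u, 1/u]], and since [u] is prime, powers of [u] can be
    cancelled. *)
Lemma susp_prime_factored q : prime_factorization A -> rprime f ->
  rprime q -> prime_factored (ju q).
Proof.
move=> AF fP qP; have uP := susp_u_prime fP; have [u0 uU udvd] := uP.
have [q0 qU qdvd] := qP.
have XU : ('X : {poly A}) \isn't a GRing.unit.
  by rewrite poly_unitE size_polyX.
case: (classic (rdvd 'X q)) => [Xq|nXq].
  have [w Uw ->] := rdvd_irreducible XU (rprime_irreducible qP) Xq.
  rewrite rmorphM; apply: prime_factoredM; last exact: prime_factored_prime.
  by apply: prime_factored_unit; apply: rmorph_unit.
have [m [q' [Em nq']]] : exists m q', u ^+ m * q' = ju q /\ ~ rdvd u q'.
  have [i qi] : exists i, q`_i != 0.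
    by exists (size q).-1; rewrite -lead_coefE lead_coef_eq0.
  have [N NP] := rprime_expr_bound AF fP qi.
  apply: NNPP => H.
  have {H} K m : exists q', u ^+ m * q' = ju q.
    elim: m => [|m [q' IH]]; first by exists (ju q); rewrite mul1r.
    have [[c Ec]|n] := classic (rdvd u q'); last by case: H; exists m, q'.
    by exists c; rewrite -IH Ec exprS; ring.
  (* Divisibility by [u ^ (i + N + 1)] makes [f ^ (N + 1)] divide the nonzero coefficient at [i],
     beyond the bound [N]. *)
  have [q' Eq'] := K (i + N.+1)%N.
  have := NP _ (susp_dvd_coef i Eq'); rewrite addKn ltnn //.
rewrite -Em; apply: prime_factoredM.
  elim: (m) => [|k IH]; first exact/prime_factored_unit/unitr1.
  by rewrite exprS; apply: prime_factoredM => //; apply: prime_factored_prime.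
have q'0 : q' != 0.
  apply: contra_not_neq nq' => ->; exists 0; rewrite mul0r //.
case: (boolP (q' \is a GRing.unit)) => [/prime_factored_unit//|q'U].
apply: prime_factored_prime; split=> // a b [c Ec].
have canc N x d : u ^+ N * x = d * q' -> rdvd q' x.
  elim: N d => [|N IH] d E; first by exists d; rewrite -E mul1r.
  have : rdvd u (d * q') by rewrite -E exprS; exists (u ^+ N * x); ring.
  case/udvd => // [[d' Ed]]; apply: (IH d'); apply: (mulfI u0).
  by rewrite mulrA -exprS E Ed; ring.
have [N1 [P EP]] := susp_den a; have [N2 [Q EQ]] := susp_den b.
have [M [R ER]] := susp_den c.
have : P * Q * 'X^(m + M) = 'X^(N1 + N2) * R * q.
  apply: susp_ju_inj; rewrite !rmorphM !rmorphXn -EP -EQ -ER -Em !exprD.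
  transitivity (u ^+ N1 * u ^+ N2 * u ^+ m * u ^+ M * (a * b)); first by ring.
  by rewrite Ec; ring.
move=> E; have : rdvd q (P * Q * 'X^(m + M)) by exists ('X^(N1 + N2) * R).
have fin N x T : u ^+ N * x = ju T -> rdvd q T -> rdvd q' x.
  move=> ET [h Eh]; apply: (canc N x (ju h * u ^+ m)).
  by rewrite ET Eh rmorphM -Em; ring.
case/qdvd => [/qdvd[H|H]|H]; [left|right|].
- exact: fin EP H.
- exact: fin EQ H.
case: nXq; elim: (m + M)%N H => [|k IH].
  by move/rdvd_unit; rewrite expr0 unitr1 (negbTE qU) => /(_ isT).
rewrite exprS => /qdvd[|//] /rdvd_irreducible; case/(_ qU) => [|w Uw E'].
  exact: polyX_irreducible.
by exists w^-1; rewrite E' mulKr.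
Qed.
Lemma susp_factorization : prime_factorization A -> rprime f -> prime_factorization B.
Proof.
move=> AF fP b b0; have [N [P EP]] := susp_den b.
apply: (@rprime_cancel_factored _ u b N); first exact: susp_u_prime.
rewrite EP; have P0 : P != 0.
  apply: contra_neq b0 => E; have := EP; rewrite E rmorph0 => /eqP.
  by rewrite mulf_eq0 expf_eq0 (negbTE susp_u_neq0) andbF => /eqP.
have [w [s [Uw sP ->]]] := prime_factorization_poly AF P0.
rewrite rmorphM; apply: prime_factoredM; first by apply/prime_factored_unit/rmorph_unit.
rewrite rmorph_prod -(big_map ju xpredT id); apply: prime_factored_prod.
by move=> _ /mapP[q qs ->]; apply: susp_prime_factored (sP q qs).
Qed.
End Suspension.

(** * Elimination and the Nullstellensatz for prime ideals *)

Lemma ex_minimal (T : Type) (m : T -> nat) (P : T -> Prop) :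
  (exists x, P x) -> exists2 x, P x & forall y, P y -> (m x <= m y)%N.
Proof.
move=> [x0 Px0]; suff H k : forall x, P x -> (m x <= k)%N ->
    exists2 x, P x & forall y, P y -> (m x <= m y)%N by exact: (H (m x0) x0).
elim: k => [|k IH] x Px le; first by exists x => // y _; move: le; rewrite leqn0 => /eqP->.
case: (classic (exists2 y, P y & (m y <= k)%N)) => [[y Py ley]|H]; first exact: IH Py ley.
exists x => // y Py; apply: leq_trans le _; rewrite ltnNge; apply/negP=> ley.
by apply: H; exists y.
Qed.

Section PrimeIdeals.

(** The empty predicate satisfies these clauses; it is excluded by the separate assumption that 0
    belongs to [I]. *)
Record prime_ideal (R : comNzRingType) (I : R -> Prop) : Prop := PrimeIdeal {
  prime_idealD : forall a b, I a -> I b -> I (a + b);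
  prime_idealM : forall a b, I b -> I (a * b);
  prime_ideal1 : ~ I 1;
  prime_idealP : forall a b, I (a * b) -> I a \/ I b }.

Variables (R : comNzRingType) (I : R -> Prop).
Hypothesis IP : prime_ideal I.
Hypothesis I0 : I 0.

Lemma prime_idealMl a b : I a -> I (a * b).
Proof. by rewrite mulrC; apply: prime_idealM. Qed.

Lemma prime_idealN a : I a -> I (- a).
Proof. by rewrite -mulN1r; apply: prime_idealM. Qed.

Lemma prime_idealB a b : I a -> I b -> I (a - b).
Proof. by move=> Ia /prime_idealN; apply: prime_idealD. Qed.

Lemma prime_ideal_exp a k : I (a ^+ k) -> I a.
Proof.
elim: k => [/(prime_ideal1 IP)//|k IH]; rewrite exprS => /(prime_idealP IP)[]//.
Qed.

Lemma prime_ideal_sum (J : Type) (r : seq J) (F : J -> R) :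
  (forall i, I (F i)) -> I (\sum_(i <- r) F i).
Proof. by move=> H; apply: big_ind => // a b; apply: prime_idealD. Qed.

End PrimeIdeals.

Lemma prime_ideal_preim (R S : comNzRingType) (phi : {rmorphism R -> S}) (I : S -> Prop) :
  prime_ideal I -> prime_ideal (fun a => I (phi a)).
Proof.
move=> [D M I1 P]; split.
- by move=> a b; rewrite rmorphD; apply: D.
- by move=> a b; rewrite rmorphM; apply: M.
- by rewrite rmorph1.
- by move=> a b; rewrite rmorphM; apply: P.
Qed.

Lemma rprime_ideal (R : idomainType) (p : R) : rprime p -> prime_ideal (rdvd p).
Proof.
case=> _ pU pP; split=> // [a b|a b|/(rdvd_unit (unitr1 _)) H].
- exact: rdvd_add.
- exact: rdvd_mull.
by rewrite H in pU.
Qed.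

Lemma rdvd0 (R : idomainType) (p : R) : rdvd p 0.
Proof. by exists 0; rewrite mul0r. Qed.

Section Elimination.
Variables (R : idomainType) (K : closedFieldType) (J : {poly R} -> Prop).
Hypothesis JP : prime_ideal J.
Hypothesis J0 : J 0.

Local Notation Jc := (fun c : R => J c%:P).
Let JcP : prime_ideal Jc := prime_ideal_preim (polyC : {rmorphism R -> {poly R}}) JP.
Let Jx (q : {poly R}) := forall i, Jc q`_i.

Let JxJ q : Jx q -> J q.
Proof.
move=> H; rewrite -[q]coefK poly_def; apply: prime_ideal_sum => // i.
by rewrite -mul_polyC mulrC; apply: prime_idealM.
Qed.

Let lead_min (G : {poly R} -> Prop) c :
  (forall a b, G a -> J b -> G (a - b)) -> G c -> ~ Jx c ->
  (forall d, G d -> ~ Jx d -> (size c <= size d)%N) -> ~ Jc (lead_coef c).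
Proof.
move=> GB Gc nc cmin Jl.
have c0 : c != 0 by apply: contra_not_neq nc => -> i; rewrite coef0.
have [d Ed sd] := poly_drop_lead c0.
have JxX : Jx (lead_coef c *: 'X^((size c).-1)).
  by move=> i; rewrite coefZ polyCM mulrC; apply: prime_idealM.
have : (size c <= size d)%N; last by rewrite leqNgt sd.
apply: cmin.
  by have -> : d = c - lead_coef c *: 'X^((size c).-1); [rewrite {1}Ed addrC addKr | apply: GB; last exact: JxJ].
move=> Jd; apply: nc => i; rewrite Ed coefD polyCD.
by apply: prime_idealD.
Qed.

Let small_Jx (G : {poly R} -> Prop) (c r : {poly R}) :
  (forall d, G d -> ~ Jx d -> (size c <= size d)%N) -> G r -> (size r < size c)%N -> Jx r.
Proof.
by move=> cmin Gr lt; apply: NNPP => nr; have := cmin r Gr nr; rewrite leqNgt lt.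
Qed.

(* [p] and [c] are elements of least degree, modulo the coefficients vanishing
   on the base, of [J] and of [J + (g)]; [c] turns out to be a constant. *)
Lemma prime_elimination g : ~ J g -> exists2 h, ~ Jc h &
  forall ev : {rmorphism R -> K}, (forall c, Jc c -> ev c = 0) -> ev h != 0 ->
  exists2 t, (forall q, J q -> (map_poly ev q).[t] = 0) & (map_poly ev g).[t] != 0.
Proof.
move=> nJg; have evx (ev : {rmorphism R -> K}) q : (forall c, Jc c -> ev c = 0) -> Jx q -> map_poly ev q = 0.
  by move=> H Jq; apply/polyP=> i; rewrite coef_map coef0; apply: H.
case: (classic (exists p, J p /\ ~ Jx p)) => [/(ex_minimal (fun p : {poly R} => size p)) [p [Jp np] pmin]|H]; last first.
  (* Here every element of [J] has its coefficients in the trace of [J] on [R], so it vanishes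
     identically once [ev] kills the trace; any [t] off the roots of the image of [g] serves. *)
  have [i gi] : exists i, ~ Jc g`_i by apply: not_all_ex_not => /JxJ.
  exists g`_i => // ev evJ evg.
  have /closed_nonrootP[t nt] : map_poly ev g != 0.
    by apply: contraNneq evg => E; rewrite -coef_map E coef0.
  exists t => // q Jq; rewrite evx ?horner0 //.
  by apply: NNPP => nq; apply: H; exists q.
have {}pmin d : J d -> ~ Jx d -> (size p <= size d)%N by move=> Jd nd; apply: pmin.
have lp : ~ Jc (lead_coef p) by apply: (lead_min (G := J)) => // a b; apply: prime_idealB.
pose G (c : {poly R}) := exists a b : {poly R}, J a /\ c = a + b * g.
have GB a b : G a -> J b -> G (a - b).
  by move=> [x [y [Jx' ->]]] Jb; exists (x - b), y; split; [apply: prime_idealB | ring].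
have GM a b : G a -> G (b * a).
  by move=> [x [y [Jx' ->]]]; exists (b * x), (b * y); split; [apply: prime_idealM | ring].
have GBG a b : G a -> G b -> G (a - b).
  move=> [x [y [Jx' ->]]] [x2 [y2 [Jx2 ->]]]; exists (x - x2), (y - y2); split; [exact: prime_idealB | ring].
have Gp : G p by exists p, 0; split=> //; ring.
have Gg : G g by exists 0, 1; split=> //; ring.
have [|c [Gc nc] cmin] := @ex_minimal _ (fun p : {poly R} => size p) (fun c => G c /\ ~ Jx c); first by exists p.
have {}cmin d : G d -> ~ Jx d -> (size c <= size d)%N by move=> Gd nd; apply: cmin.
have lc : ~ Jc (lead_coef c) by apply: (lead_min (G := G)).
have c0 : c != 0 by apply: contra_not_neq nc => -> i; rewrite coef0.
have p0 : p != 0 by apply: contra_not_neq np => -> i; rewrite coef0.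
have pdiv (d e : {poly R}) : d != 0 -> exists k h r, lead_coef d ^+ k *: e = d * h + r /\ (size r < size d)%N.
  move=> d0; exists (scalp e d), (e %/ d), (e %% d); rewrite Pdiv.Idomain.divp_eq mulrC; split=> //.
  by rewrite ltn_modp.
have JZ d k : J (lead_coef c ^+ k *: d) -> J d.
  rewrite -mul_polyC => /(prime_idealP JP)[|//]; rewrite polyC_exp => /(prime_ideal_exp JP) //.
(* If [c] lay in [J], pseudo-division of [g] by [c] would put [g] in [J]. Otherwise pseudo-division
   of [p] by [c] gives a quotient [h] in [J] of size at least that of [p], while [c h] is no longer
   than [p]; this leaves only a constant [c]. *)
have c1 : size c = 1%N.
  apply/eqP; rewrite eqn_leq size_poly_gt0 c0 andbT leqNgt; apply/negP=> sc.
  have nJc : ~ J c.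
    move=> Jc'; apply: nJg; have [k [h [r [E sr]]]] := pdiv c g c0.
    apply: (JZ _ k); rewrite E; apply: prime_idealD => //; first exact: prime_idealMl.
    apply/JxJ/(small_Jx cmin) => //; have -> : r = lead_coef c ^+ k *: g - h * c by rewrite E; ring.
    by rewrite -mul_polyC; apply: GBG; apply: GM.
  have [k [h [r [E sr]]]] := pdiv c p c0.
  have Jr : Jx r.
    apply: (small_Jx cmin) => //; have -> : r = lead_coef c ^+ k *: p - h * c by rewrite E; ring.
    by rewrite -mul_polyC; apply: GBG; apply: GM.
  have Jch : J (c * h).
    have -> : c * h = lead_coef c ^+ k *: p - r by rewrite E; ring.
    by apply: prime_idealB => //; [rewrite -mul_polyC; apply: prime_idealM | apply: JxJ].
  have Jh : J h by case: (prime_idealP JP Jch).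
  have nJh : ~ Jx h.
    move=> Jh'; apply: lp; have : Jx (lead_coef c ^+ k *: p).
      move=> i; rewrite E coefD polyCD; apply: prime_idealD => //.
      rewrite coefM; apply: (big_ind (fun a => Jc a)); rewrite ?polyC0 //.
        by move=> a b; apply: (prime_idealD JcP).
      by move=> j _; rewrite polyCM; apply: prime_idealM.
    move=> /(_ (size p).-1); rewrite coefZ polyCM => /(prime_idealP JP)[|//].
    by rewrite polyC_exp => /(prime_ideal_exp JP).
  have h0 : h != 0 by apply: contra_not_neq nJh => -> i; rewrite coef0.
  have sh : (size p <= size h)%N by apply: pmin.
  have scp : (size c <= size p)%N by apply: cmin.
  have : (size (c * h)%R <= size p)%N.
    have -> : c * h = lead_coef c ^+ k *: p - r by rewrite E; ring.
    apply: leq_trans (size_polyD _ _) _; rewrite size_polyN geq_max size_scale_leq /=.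
    exact: leq_trans (ltnW sr) scp.
  rewrite size_mul //; move: sc sh; lia.
have sp : size p != 1%N.
  apply/eqP=> sp; apply: np => i; move: Jp; rewrite (size1_polyC (eq_leq sp)) coefC.
  by case: eqP => // _ _; rewrite polyC0.
have Ec := size1_polyC (eq_leq c1).
have nc0 : ~ Jc c`_0 by move: lc; rewrite {1}Ec lead_coefC.
(* When the leading coefficient of [p] survives, [p] has a root and all of [J] vanishes there; the
   constant [c = a + b g], with [a] in [J], then keeps [g] from vanishing at it. *)
exists (lead_coef p * c`_0).
  by rewrite polyCM => /(prime_idealP JP)[].
move=> ev evJ; rewrite rmorphM mulf_eq0 negb_or => /andP[evl evc].
have [|t rt] := closed_rootP (map_poly ev p) _; first by rewrite size_poly_eq.
have Jt q : J q -> (map_poly ev q).[t] = 0.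
  move=> Jq; have [k [h [r [E sr]]]] := pdiv p q p0.
  have Jr : Jx r.
    apply: (small_Jx pmin) => //; have -> : r = lead_coef p ^+ k *: q - h * p by rewrite E; ring.
    by apply: prime_idealB => //; [rewrite -mul_polyC; apply: prime_idealM | apply: prime_idealM].
  have := congr1 (fun P => (map_poly ev P).[t]) E.
  rewrite /= rmorphD rmorphM /= (evx _ r) // addr0 hornerM (rootP rt) mul0r.
  rewrite map_polyZ hornerZ rmorphXn => /eqP; rewrite mulf_eq0 expf_eq0 (negbTE evl) andbF /= => /eqP //.
exists t => //; apply: contraNneq evc => gt0.
have [a [b [Ja Eab]]] := Gc; have := Eab; rewrite [X in X = _]Ec => /(congr1 (fun P => (map_poly ev P).[t])).
by rewrite /= rmorphD rmorphM /= hornerD hornerM (Jt _ Ja) gt0 mulr0 addr0 map_polyC hornerC => ->.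
Qed.
End Elimination.

(** * Splitting off the last variable of a polynomial ring *)

Section MpolySplit.
Variable R : comNzRingType.

Lemma mpoly_rmorph_ext n (S : comNzRingType) (phi psi : {rmorphism {mpoly R[n]} -> S}) :
  (forall c, phi c%:MP = psi c%:MP) -> (forall i, phi 'X_i = psi 'X_i) -> phi =1 psi.
Proof.
move=> HC HX p; elim/mpolyind: p => [|c m p _ _ IH]; first by rewrite !rmorph0.
rewrite !rmorphD IH -mul_mpolyC !rmorphM HC mpolyXE_id !rmorph_prod; congr (_ * _ + _).
by apply: eq_bigr => i _; rewrite !rmorphXn HX.
Qed.

Variable n : nat.
Local Notation wid := (widen_ord (leqnSn n)).

Lemma muniXw i : muni 'X_(wid i) = ('X_i)%:P :> {poly {mpoly R[n]}}.
Proof.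
rewrite muniE msuppX big_seq1 mcoeffX eqxx scale1r mnm1E.
have -> : (wid i == ord_max :> 'I_n.+1) = false.
  by apply/negbTE; rewrite -val_eqE /= neq_ltn ltn_ord.
rewrite expr0 alg_polyC; congr (_%:P); congr 'X_[_].
by apply/mnmP=> j; rewrite !mnmE -!val_eqE /=.
Qed.

Lemma muniXmax : muni 'X_ord_max = 'X :> {poly {mpoly R[n]}}.
Proof.
rewrite muniE msuppX big_seq1 mcoeffX eqxx scale1r mnm1E eqxx expr1.
rewrite (_ : [multinom _ | _ < n] = 0%MM) ?mpolyX0 ?scale1r //.
by apply/mnmP=> j; rewrite !mnmE -!val_eqE /= gtn_eqF.
Qed.

Definition mjoin : {poly {mpoly R[n]}} -> {mpoly R[n.+1]} :=
  horner_eval 'X_ord_max \o map_poly (@mwiden n R).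

Lemma mjoin_is_rmorph : additive mjoin * multiplicative mjoin.
Proof.
split; first by move=> p q; rewrite /mjoin rmorphB.
by split=> [p q|]; rewrite /mjoin ?rmorphM ?rmorph1.
Qed.
HB.instance Definition _ := GRing.isAdditive.Build _ _ mjoin mjoin_is_rmorph.1.
HB.instance Definition _ := GRing.isMultiplicative.Build _ _ mjoin mjoin_is_rmorph.2.

Lemma mwidenXU i : mwiden 'X_i = 'X_(wid i) :> {mpoly R[n.+1]}.
Proof. by rewrite mwidenX mnmwiden1. Qed.

Lemma mjoinC c : mjoin c%:P = mwiden c.
Proof. by rewrite /mjoin /= map_polyC /horner_eval hornerC. Qed.

Lemma mjoinX : mjoin 'X = 'X_ord_max.
Proof. by rewrite /mjoin /= map_polyX /horner_eval hornerX. Qed.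

Lemma muniK : cancel (@muni n R) mjoin.
Proof.
apply: (mpoly_rmorph_ext (phi := mjoin \o @muni n R) (psi := idfun)) => [c|i] /=.
  by rewrite muniC mjoinC mwidenC.
have [[j ->]|->] : (exists j, i = wid j) \/ i = ord_max.
- case: (unliftP ord_max i) => [j ->|]; [left; exists j | by right].
  by apply: val_inj; rewrite /= /bump leqNgt ltn_ord add0n.
- by rewrite muniXw mjoinC mwidenXU.
by rewrite muniXmax mjoinX.
Qed.

Lemma mjoinK : cancel mjoin (@muni n R).
Proof.
have HC (c : {mpoly R[n]}) : muni (mwiden c) = c%:P.
  move: c; apply: (mpoly_rmorph_ext (phi := @muni n R \o @mwiden n R) (psi := polyC)) => [c|i] /=.
    by rewrite mwidenC muniC.
  by rewrite mwidenXU muniXw.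
elim/poly_ind => [|p c IH]; first by rewrite !rmorph0.
rewrite rmorphD rmorphM /= rmorphD rmorphM /= IH mjoinX mjoinC.
by rewrite HC muniXmax.
Qed.

Lemma mjoin_eval (x : 'I_n.+1 -> R) q :
  (mjoin q).@[x] = (map_poly (meval (fun i => x (wid i))) q).[x ord_max].
Proof.
elim/poly_ind: q => [|p c IH]; first by rewrite !rmorph0 horner0.
rewrite !rmorphD !rmorphM /= hornerD hornerM -IH mjoinX mjoinC.
rewrite !map_polyX !map_polyC !hornerX !hornerC /= mevalXU; congr (_ + _).
move: c; apply: (mpoly_rmorph_ext (phi := meval x \o @mwiden n R) (psi := meval _)) => [c|i] /=.
  by rewrite mwidenC !mevalC.
by rewrite mwidenXU !mevalXU.
Qed.
End MpolySplit.

(* By eliminating one variable at a time. *)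
Theorem prime_nullstellensatz (K : closedFieldType) n (I : {mpoly K[n]} -> Prop) g :
  prime_ideal I -> I 0 -> ~ I g ->
  exists2 x : 'I_n -> K, (forall p, I p -> p.@[x] = 0) & g.@[x] != 0.
Proof.
elim: n I g => [|n IH] I g IP I0 ng.
  have cst (p : {mpoly K[0]}) x : p = (p.@[x])%:MP by rewrite [p]nvar0_mpolyC mevalC.
  have x : 'I_0 -> K by case.
  exists x.
    move=> p Ip; apply/eqP; apply: contraT => px; case: (prime_ideal1 IP).
    rewrite (_ : 1 = (p.@[x])^-1%:MP * p); first exact: prime_idealM.
    by rewrite {2}(cst p x) -mpolyCM mulVf // mpolyC1.
  by apply: contra_not_neq ng => gx; rewrite (cst g x) gx mpolyC0.
pose J q := I (mjoin q).
have JP : prime_ideal J by apply: prime_ideal_preim.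
have J0 : J 0 by rewrite /J rmorph0.
have ngJ : ~ J (muni g) by rewrite /J muniK.
have [h nh H] := prime_elimination K JP J0 ngJ.
have [|x xI xh] := IH (fun c => J c%:P) h _ J0 nh.
  exact: (prime_ideal_preim (polyC : {rmorphism {mpoly K[n]} -> {poly {mpoly K[n]}}}) JP).
have [|t tJ tg] := H (meval x) _ xh; first by move=> c Jc; apply: xI.
pose y (i : 'I_n.+1) := if unlift ord_max i is Some j then x j else t.
have yw : (fun i => y (widen_ord (leqnSn n) i)) =1 x.
  move=> i; have E : widen_ord (leqnSn n) i = lift ord_max i.
    by apply: val_inj; rewrite /= /bump leqNgt ltn_ord.
  by rewrite /y E liftK.
have yE q : (mjoin q).@[y] = (map_poly (meval x) q).[t].
  rewrite mjoin_eval; congr (_.[_]); last by rewrite /y unlift_none.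
  by apply: eq_map_poly => c; apply: meval_eq.
exists y => [p Ip|]; first by rewrite -[p]muniK yE; apply: tJ; rewrite /J muniK.
by rewrite -[g]muniK yE.
Qed.

Lemma mpoly_eval_eq0 (K : closedFieldType) n (p : {mpoly K[n]}) :
  (forall x, p.@[x] = 0) -> p = 0.
Proof.
move=> H; apply: NNPP => p0; have [||x _] := @prime_nullstellensatz K n (eq^~ 0) p _ _ p0 => //.
  split=> [a b -> ->|a b ->||a b /eqP]; rewrite ?addr0 ?mulr0 //; first exact/eqP/oner_neq0.
  by rewrite mulf_eq0 => /orP[]/eqP; [left|right].
by rewrite H eqxx.
Qed.

Lemma prime_factorization_bij (R S : idomainType) (phi : {rmorphism R -> S}) (psi : {rmorphism S -> R}) :
  cancel phi psi -> cancel psi phi -> prime_factorization S -> prime_factorization R.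
Proof.
move=> phiK psiK F p p0; have [|u [s [Uu sP E]]] := F (phi p).
  by apply: contraNneq p0 => E; rewrite -[p]phiK E rmorph0.
exists (psi u), (map psi s); split; first exact: rmorph_unit.
  move=> _ /mapP[q qs ->]; have [q0 qU qP] := sP q qs; split.
  - by apply: contraNneq q0 => E'; rewrite -[q]psiK E' rmorph0.
  - by apply: contraNN qU => H; rewrite -[q]psiK; apply: rmorph_unit.
  move=> a b [c Ec].
  have [|[d Ed]|[d Ed]] := qP (phi a) (phi b).
  - by exists (phi c); rewrite -rmorphM Ec rmorphM psiK.
  - by left; exists (psi d); rewrite -rmorphM -Ed phiK.
  - by right; exists (psi d); rewrite -rmorphM -Ed phiK.
by rewrite -[p]phiK E rmorphM rmorph_prod big_map.
Qed.

Lemma prime_factorization_mpoly (K : fieldType) n : prime_factorization {mpoly K[n]}.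
Proof.
elim: n => [|n IH].
  move=> p p0; apply: prime_factored_unit; apply/unitrP; exists (p@_0%MM)^-1%:MP.
  have c0 : p@_0%MM != 0 by apply: contraNneq p0 => H; rewrite [p]nvar0_mpolyC H mpolyC0.
  have E := nvar0_mpolyC p; move: (p@_0%MM) c0 E => c c0 ->.
  by rewrite -!mpolyCM mulVf ?divff // mpolyC1.
apply: (prime_factorization_bij (phi := @muni n K) (psi := @mjoin K n)).
- exact: muniK.
- exact: mjoinK.
exact: prime_factorization_poly.
Qed.

(** * Polynomial maps and algebraic dependence *)

Section PolynomialMaps.
Variable K : fieldType.

Lemma comp_mpoly_comp n m k (p : {mpoly K[n]}) (g : n.-tuple {mpoly K[m]}) (h : m.-tuple {mpoly K[k]}) :
  (p \mPo g) \mPo h = p \mPo [tuple tnth g i \mPo h | i < n].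
Proof.
move: p; apply: (mpoly_rmorph_ext (phi := comp_mpoly h \o comp_mpoly g) (psi := comp_mpoly _)) => [c|i] /=.
  by rewrite !comp_mpolyC.
by rewrite !comp_mpolyXU -!tnth_nth tnth_mktuple.
Qed.

Lemma mderivXU n (i l : 'I_n) : ('X_i)^`M(l) = (i == l)%:R%:MP :> {mpoly K[n]}.
Proof.
rewrite mderivX mnm1E; case: eqP => [->|_]; last by rewrite scale0r mpolyC0.
rewrite (_ : (_ - _)%MM = 0%MM) ?mpolyX0 -?mul_mpolyC ?mulr1 //.
by apply/mnmP=> j; rewrite mnmBE mnm0E subnn.
Qed.

Lemma mpoly_ring_ind n (P : {mpoly K[n]} -> Prop) :
  (forall c, P c%:MP) -> (forall i, P 'X_i) ->
  (forall p q, P p -> P q -> P (p + q)) -> (forall p q, P p -> P q -> P (p * q)) ->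
  forall p, P p.
Proof.
move=> PC PX PD PM; elim/mpolyind => [|c m p _ _ Pp]; first by rewrite -mpolyC0.
apply: (PD) => //; rewrite -mul_mpolyC; apply: (PM) => //; rewrite mpolyXE_id.
have P1 : P 1 by rewrite -mpolyC1.
apply: (big_ind P P1 PM) => i _; elim: (m i) => [|k IH]; first by rewrite expr0.
by rewrite exprS; apply: PM.
Qed.

Lemma mderiv_comp n m (p : {mpoly K[n]}) (g : n.-tuple {mpoly K[m]}) l :
  (p \mPo g)^`M(l) = \sum_j (p^`M(j) \mPo g) * (tnth g j)^`M(l).
Proof.
elim/mpoly_ring_ind: p => [c|i|p q IHp IHq|p q IHp IHq].
- by rewrite comp_mpolyC mderivC big1 // => j _; rewrite mderivC comp_mpoly0 mul0r.
- rewrite comp_mpolyXU -tnth_nth (bigD1 i) //= mderivXU eqxx comp_mpolyC mpolyC1 mul1r.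
  rewrite big1 ?addr0 // => j ji.
  by rewrite mderivXU eq_sym (negbTE ji) comp_mpolyC mpolyC0 mul0r.
- rewrite comp_mpolyD mderivD IHp IHq -big_split /=.
  by apply: eq_bigr => j _; rewrite mderivD comp_mpolyD mulrDl.
rewrite rmorphM mderivM /= IHp IHq big_distrl big_distrr -big_split /=.
by apply: eq_bigr => j _; rewrite mderivM comp_mpolyD !rmorphM /= mulrDl mulrAC -!mulrA.
Qed.

(** Rows are indexed by source variables: tangent vectors are rows multiplied from the left, and an
    injective differential is a row-free matrix. *)
Definition jac n m (g : n.-tuple {mpoly K[m]}) (x : 'I_m -> K) : 'M[K]_(m, n) :=
  \matrix_(l, j) ((tnth g j)^`M(l)).@[x].

Definition mpmap n m (g : n.-tuple {mpoly K[m]}) (x : 'I_m -> K) : 'I_n -> K :=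
  fun i => (tnth g i).@[x].

Definition pmcomp n m k (g : n.-tuple {mpoly K[m]}) (h : m.-tuple {mpoly K[k]}) :=
  [tuple tnth g i \mPo h | i < n].

Definition lin m k (C : 'M[K]_(k, m)) : m.-tuple {mpoly K[k]} :=
  [tuple \sum_i C i j *: 'X_i | j < m].

Lemma mpmap_pmcomp n m k (g : n.-tuple {mpoly K[m]}) (h : m.-tuple {mpoly K[k]}) x :
  mpmap (pmcomp g h) x =1 mpmap g (mpmap h x).
Proof. by move=> i; rewrite /mpmap tnth_mktuple comp_mpoly_meval. Qed.

Lemma meval_comp n m (p : {mpoly K[n]}) (g : n.-tuple {mpoly K[m]}) x :
  (p \mPo g).@[x] = p.@[mpmap g x].
Proof. exact: comp_mpoly_meval. Qed.

Lemma jac_pmcomp n m k (g : n.-tuple {mpoly K[m]}) (h : m.-tuple {mpoly K[k]}) x :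
  jac (pmcomp g h) x = jac h x *m jac g (mpmap h x).
Proof.
apply/matrixP=> l j; rewrite !mxE tnth_mktuple mderiv_comp raddf_sum /=.
by apply: eq_bigr => i _; rewrite mevalM meval_comp !mxE mulrC.
Qed.

Lemma mderiv_lin m k (C : 'M[K]_(k, m)) l j x : ((tnth (lin C) j)^`M(l)).@[x] = C l j.
Proof.
rewrite tnth_mktuple (big_morph _ (mderivD l) (mderiv0 _ l)) (big_morph _ (mevalD x) (meval0 x)).
rewrite (bigD1 l) //= big1 ?addr0.
  by rewrite mderivZ mevalZ mderivXU eqxx mevalC mulr1.
by move=> i il; rewrite mderivZ mevalZ mderivXU (negbTE il) mevalC mulr0.
Qed.

Lemma jac_lin m k (C : 'M[K]_(k, m)) x : jac (lin C) x = C.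
Proof. by apply/matrixP=> l j; rewrite mxE mderiv_lin. Qed.

Lemma mpmap_lin m k (C : 'M[K]_(k, m)) x : mpmap (lin C) x =1 fun j => \sum_i C i j * x i.
Proof.
move=> j; rewrite /mpmap tnth_mktuple raddf_sum /=.
by apply: eq_bigr => i _; rewrite mevalZ mevalXU.
Qed.

Lemma mpmap_lin0 m k (C : 'M[K]_(k, m)) : mpmap (lin C) (fun _ => 0) =1 fun _ => 0.
Proof. by move=> j; rewrite mpmap_lin big1 // => i _; rewrite mulr0. Qed.

End PolynomialMaps.

(** * Dependence of [r + 1] polynomials in [r] variables *)

Section AlgebraicDependence.
Variable K : fieldType.

Lemma msize_mulS n (p q : {mpoly K[n]}) d e :
  (msize p <= d.+1)%N -> (msize q <= e.+1)%N -> (msize (p * q) <= (d + e).+1)%N.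
Proof.
move=> hp hq; case: (eqVneq p 0) => [->|p0]; first by rewrite mul0r msize0.
case: (eqVneq q 0) => [->|q0]; first by rewrite mulr0 msize0.
rewrite msizeM // -!subn1 leq_subLR; apply: leq_trans (leq_add hp hq) _.
by rewrite addSn addnS.
Qed.

Lemma msize_prod_expr n m (g : 'I_m -> {mpoly K[n]}) (a : 'I_m -> nat) D N :
  (forall i, (msize (g i) <= D.+1)%N) -> (forall i, (a i <= N)%N) ->
  (msize (\prod_i g i ^+ a i) <= (m * N * D).+1)%N.
Proof.
move=> hg ha; have hX i : (msize (g i ^+ a i) <= (N * D).+1)%N.
  apply: (@leq_trans (a i * D).+1); last by rewrite ltnS leq_mul2r ha orbT.
  elim: (a i) => [|k IH]; first by rewrite expr0 msize1.
  by rewrite exprS mulSn; apply: msize_mulS.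
rewrite -mulnA -[m in (m * _)%N](size_enum_ord m) -big_enum /=.
elim: (enum 'I_m) => [|i s IH]; first by rewrite big_nil msize1.
by rewrite big_cons mulSn; apply: msize_mulS.
Qed.

(** A count of monomials. The [N ^ (r + 1)] monomials with exponents below [N] are sent to
    polynomials with exponents below [M <= N C], a space of dimension at most [N ^ r C ^ r]; the
    choice [N = C ^ r + 1] forces a linear relation. *)
Lemma algebraic_dependence r (g : r.+1.-tuple {mpoly K[r]}) :
  exists2 P : {mpoly K[r.+1]}, P != 0 & P \mPo g = 0.
Proof.
pose D := \max_i msize (tnth g i).
have gD i : (msize (tnth g i) <= D.+1)%N by apply: leqW; apply: (leq_bigmax i).
pose C := (r.+1 * D).+1; pose N := (C ^ r).+1; pose M := (r.+1 * N * D).+1.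
pose I := {ffun 'I_r.+1 -> 'I_N}; pose J := {ffun 'I_r -> 'I_M}.
have lt : (#|{: J}| < #|{: I}|)%N.
  rewrite !card_ffun !card_ord; apply: (@leq_ltn_trans ((N * C) ^ r)).
    have MNC : (M <= N * C)%N.
      by rewrite /M /C mulnS [(r.+1 * N)%N]mulnC -mulnA -add1n leq_add2r.
    by case: (posnP r) => [->|r0]; [rewrite !expn0 | rewrite leq_exp2r].
  by rewrite expnMn expnS mulnC ltn_pmul2r ?expn_gt0.
pose mI (a : I) : 'X_{1..r.+1} := [multinom a i : nat | i < r.+1].
pose mJ (b : J) : 'X_{1..r} := [multinom b i : nat | i < r].
have mI_inj : injective mI.
  by move=> a b E; apply/ffunP=> i; apply/val_inj; have := congr1 (fun m : 'X_{1..r.+1} => m i) E; rewrite !mnmE.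
pose G (a : I) := 'X_[mI a] \mPo g.
pose A : 'M[K]_(#|{: I}|, #|{: J}|) := \matrix_(a, b) (G (enum_val a))@_(mJ (enum_val b)).
have /rowV0Pn[v vker v0] : kermx A != 0.
  rewrite -mxrank_eq0 mxrank_ker -lt0n subn_gt0.
  exact: leq_ltn_trans (rank_leq_col _) lt.
have vA : v *m A = 0 by apply/sub_kermxP.
exists (\sum_a v 0 a *: 'X_[mI (enum_val a)]).
  apply: contra_neq v0 => E; apply/rowP=> a; rewrite mxE.
  have := congr1 (mcoeff (mI (enum_val a))) E; rewrite mcoeff0 raddf_sum (bigD1 a) //= big1.
    by rewrite mcoeffZ mcoeffX eqxx mulr1 addr0.
  move=> b ba; rewrite mcoeffZ mcoeffX (inj_eq mI_inj) (inj_eq enum_val_inj) (negbTE ba) mulr0 //.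
rewrite raddf_sum /=; apply/mpolyP=> m; rewrite mcoeff0 raddf_sum /=.
have Gs a : (msize (G a) < M.+1)%N.
  rewrite ltnS /G comp_mpolyX; apply: (msize_prod_expr (N := N) gD) => i.
  by rewrite mnmE ltnW.
case: (boolP [forall i, m i < M]%N) => [/forallP mM|].
  pose b : J := [ffun i => Ordinal (mM i)].
  have -> : m = mJ b by apply/mnmP=> i; rewrite mnmE ffunE.
  have := congr1 (fun w : 'rV_ _ => w 0 (enum_rank b)) vA; rewrite !mxE => E.
  rewrite -[RHS]E; apply: eq_bigr => a _.
  by rewrite comp_mpolyZ mcoeffZ !mxE enum_rankK.
rewrite negb_forall => /existsP[i]; rewrite -leqNgt => mi.
rewrite big1 // => a _; rewrite comp_mpolyZ mcoeffZ -/(G _).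
rewrite [_@_m]memN_msupp_eq0 ?mulr0 //; apply: msize_mdeg_ge.
rewrite -ltnS; apply: leq_trans (Gs _) _; rewrite ltnS; apply: leq_trans mi _.
by rewrite mdegE (bigD1 i) //= leq_addr.
Qed.
End AlgebraicDependence.

(** * Affine varieties *)

Section Varieties.
Variable K : closedFieldType.

Definition vanishing n (J : {mpoly K[n]} -> Prop) : point K n -> Prop :=
  fun x => forall p, J p -> p.@[x] = 0.

Lemma prime_ideal_zero (R : idomainType) : prime_ideal (fun a : R => a = 0).
Proof.
split=> [a b -> ->|a b ->|/eqP|a b /eqP]; rewrite ?addr0 ?mulr0 ?oner_eq0 //.
by rewrite mulf_eq0 => /orP[]/eqP; [left|right].
Qed.

Lemma zclosed_vanishing n (J : {mpoly K[n]} -> Prop) : zclosed (vanishing J).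
Proof. by exists J. Qed.

Lemma zclosed_eqX0 n (X : point K n -> Prop) x : zclosed X ->
  (forall p, eqX X p 0 -> p.@[x] = 0) -> X x.
Proof.
move=> [S XS] H; apply/XS => p Sp; apply: H => y Xy; rewrite meval0.
exact: (proj1 (XS y) Xy).
Qed.

Lemma zclosed_zero n (p : {mpoly K[n]}) : zclosed (fun x : point K n => p.@[x] = 0).
Proof. by exists (eq^~ p) => x; split=> [px q ->|]; [|apply]. Qed.

Lemma irreducible_domain n (X : point K n -> Prop) a b : irreducible_var X ->
  eqX X (a * b) 0 -> eqX X a 0 \/ eqX X b 0.
Proof.
move=> [_ [_ Xirr]] ab0; have [||||] := Xirr (fun x => a.@[x] = 0) (fun x => b.@[x] = 0).
- exact: zclosed_zero.
- exact: zclosed_zero.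
- move=> x /ab0/eqP; rewrite mevalM meval0 mulf_eq0 => /orP[]/eqP; [left|right]; done.
- by move=> H; left=> x /H; rewrite meval0.
by move=> H; right=> x /H; rewrite meval0.
Qed.

Lemma irreducible_ideal n (X : point K n -> Prop) : irreducible_var X ->
  prime_ideal (fun p => eqX X p 0).
Proof.
move=> Xirr; split.
- by move=> a b Ha Hb x Xx; rewrite mevalD Ha // Hb // meval0 addr0.
- by move=> a b Hb x Xx; rewrite mevalM Hb // meval0 mulr0.
- by have [_ [[x Xx] _]] := Xirr; move/(_ x Xx)/eqP; rewrite meval1 meval0 oner_eq0.
- by move=> a b; apply: irreducible_domain.
Qed.

Lemma domain_irreducible n (X : point K n -> Prop) : zclosed X -> domainX X ->
  irreducible_var X.
Proof.
move=> Xcl [X1 Xdom]; split=> //; split.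
  by apply: NNPP => H; apply: X1 => x Xx; case: H; exists x.
move=> Z1 Z2 [S1 ZS1] [S2 ZS2] cov; apply: NNPP => H.
have sep (Z : point K n -> Prop) S : (forall x, Z x <-> forall p, S p -> p.@[x] = 0) ->
    ~ Defs.subsetP X Z -> exists p, S p /\ ~ eqX X p 0.
  move=> ZS nXZ; apply: NNPP => nex; apply: nXZ => x Xx; apply/ZS => p Sp.
  by apply: NNPP => px; apply: nex; exists p; split=> // /(_ x Xx); rewrite meval0.
have [p1 [Sp1 n1]] : exists p, S1 p /\ ~ eqX X p 0 by apply: (sep Z1) => // ?; apply: H; left.
have [p2 [Sp2 n2]] : exists p, S2 p /\ ~ eqX X p 0 by apply: (sep Z2) => // ?; apply: H; right.
suff /Xdom[] : eqX X (p1 * p2) 0 by [].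
move=> x Xx; rewrite mevalM meval0; case: (cov x Xx) => [/ZS1 /(_ p1 Sp1)|/ZS2 /(_ p2 Sp2)] ->; rewrite ?mul0r ?mulr0 //.
Qed.

Lemma vanishing_ideal n (J : {mpoly K[n]} -> Prop) p : prime_ideal J -> J 0 ->
  eqX (vanishing J) p 0 -> J p.
Proof.
move=> JP J0 H; apply: NNPP => nJp; have [x xJ /eqP[]] := prime_nullstellensatz JP J0 nJp.
by rewrite H // meval0.
Qed.

Lemma irreducible_vanishing n (J : {mpoly K[n]} -> Prop) : prime_ideal J -> J 0 ->
  irreducible_var (vanishing J).
Proof.
move=> JP J0; apply: domain_irreducible; first exact: zclosed_vanishing.
split=> [H|a b H]; have JH := vanishing_ideal JP J0 H; first exact: (prime_ideal1 JP).
by case: (prime_idealP JP JH) => Jab; [left|right] => x /(_ _ Jab); rewrite meval0.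
Qed.

(** * Algebraic independence on a variety *)

(** A lower bound [e] for the transcendence degree of the function field, expressed by polynomials
    only. *)
Definition algindep n (X : point K n -> Prop) e :=
  exists g : e.-tuple {mpoly K[n]}, forall P, eqX X (P \mPo g) 0 -> P = 0.

Lemma comp_mwiden n e (P : {mpoly K[e]}) (g : e.+1.-tuple {mpoly K[n]}) :
  mwiden P \mPo g = P \mPo [tuple tnth g (widen_ord (leqnSn e) i) | i < e].
Proof.
move: P; apply: (mpoly_rmorph_ext (phi := comp_mpoly g \o @mwiden e K) (psi := comp_mpoly _)) => [c|i] /=.
  by rewrite mwidenC !comp_mpolyC.
by rewrite mwidenXU !comp_mpolyXU -!tnth_nth tnth_mktuple.
Qed.

Lemma algindep_leq n (X : point K n -> Prop) d e : (d <= e)%N -> algindep X e -> algindep X d.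
Proof.
move=> le; rewrite -(subnK le); elim: (e - d)%N => // m IH [g gP]; apply: IH.
exists [tuple tnth g (widen_ord (leqnSn _) i) | i < (m + d)%N] => P.
by rewrite -comp_mwiden => /gP E; apply: inj_mwiden; rewrite mwiden0.
Qed.

(** Pullback along a dominant map preserves independence, and [r + 1] polynomials in [r] variables
    are dependent. *)
Lemma algindep_dominant n (X : point K n -> Prop) r (phi : n.-tuple {mpoly K[r]}) e :
  (forall p, p \mPo phi = 0 -> eqX X p 0) -> algindep X e -> (e <= r)%N.
Proof.
move=> dom Xe; rewrite leqNgt; apply/negP=> lt.
have [g gP] := algindep_leq lt Xe.
have [P P0] := algebraic_dependence (pmcomp g phi).
rewrite -comp_mpoly_comp => /dom /gP PE; by rewrite PE eqxx in P0.
Qed.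

Lemma mjoin_comp n e (Q : {poly {mpoly K[e]}}) (g : e.-tuple {mpoly K[n]}) h :
  mjoin Q \mPo [tuple of rcons g h] = (map_poly (comp_mpoly g) Q).[h].
Proof.
have lastE : tnth [tuple of rcons g h] ord_max = h.
  by rewrite (tnth_nth h) nth_rcons size_tuple ltnn eqxx.
have widE i : tnth [tuple of rcons g h] (widen_ord (leqnSn e) i) = tnth g i.
  by rewrite !(tnth_nth h) nth_rcons size_tuple /= ltn_ord.
elim/poly_ind: Q => [|Q c IH]; first by rewrite !rmorph0 horner0.
rewrite !rmorphD !rmorphM /= hornerD hornerM -IH mjoinX mjoinC.
rewrite map_polyX map_polyC hornerX hornerC comp_mwiden comp_mpolyXU -tnth_nth lastE /=.
by congr (_ + comp_mpoly _ _); apply: eq_from_tnth => i; rewrite tnth_mktuple widE.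
Qed.

(* A function vanishing on a proper closed subset is independent of the
   functions that are independent on this subset. *)
Lemma algindep_proper n (Z X : point K n -> Prop) e : zclosed Z -> irreducible_var X ->
  Defs.subsetP Z X -> (exists y, X y /\ ~ Z y) -> algindep Z e -> algindep X e.+1.
Proof.
move=> [S ZS] Xirr ZX [y [Xy nZy]] [g gP].
have [h [hZ hX]] : exists h, eqX Z h 0 /\ ~ eqX X h 0.
  apply: NNPP => H; apply: nZy; apply/ZS => p Sp; apply: NNPP => py; apply: H; exists p.
  split=> [x /ZS/(_ p Sp) ->|/(_ y Xy)]; rewrite ?meval0 //.
exists [tuple of rcons g h] => P.
rewrite -[P]muniK; move: (muni P) => Q {P}.
elim/poly_ind: Q => [|Q c IH]; first by rewrite rmorph0.
rewrite mjoin_comp rmorphD rmorphM /= hornerD hornerM map_polyX map_polyC hornerX hornerC -mjoin_comp /= => H.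
have c0 : c = 0.
  by apply: gP => x Zx; have := H x (ZX x Zx); rewrite mevalD mevalM hZ // meval0 mulr0 add0r.
rewrite {}c0 comp_mpoly0 addr0 in H *.
have [/IH E|//] := irreducible_domain Xirr H.
by rewrite addr0 rmorphM /= E mul0r.
Qed.

Lemma chain_algindep n (X : point K n -> Prop) x d Z :
  irreducible_var X -> chain_at X x d Z -> algindep X d.
Proof.
move=> Xirr [Zirr [Z0 Zlt]].
have H i : (i <= d)%N -> algindep (Z i) i.
  elim: i => [_|i IH lt].
    exists [tuple] => P; rewrite [P]nvar0_mpolyC comp_mpolyC => /(_ x Z0).
    by rewrite mevalC meval0 => ->; rewrite mpolyC0.
  have [Zsub Zex] := Zlt i lt.
  apply: algindep_proper Zsub Zex (IH (ltnW lt)); last by case: (Zirr _ lt).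
  by have [[]] := Zirr i (ltnW lt).
have [g gP] := H d (leqnn d); exists g => P PX; apply: gP => y Zy; apply: PX.
by have [_] := Zirr d (leqnn d); apply.
Qed.

Lemma chain_of_primes n (X : point K n -> Prop) x d (J : nat -> {mpoly K[n]} -> Prop) :
  (forall i, (i <= d)%N -> [/\ prime_ideal (J i), J i 0 & Defs.subsetP (vanishing (J i)) X]) ->
  (forall p, J 0%N p -> p.@[x] = 0) ->
  (forall i, (i < d)%N -> (forall p, J i.+1 p -> J i p) /\ exists p, J i p /\ ~ J i.+1 p) ->
  chain_at X x d (fun i => vanishing (J i)).
Proof.
move=> JP Jx Jlt; split=> [i lt|].
  by have [JP1 J0 JX] := JP i lt; split=> //; apply: irreducible_vanishing.
split=> // i lt; have [Jsub [p [Jp nJp]]] := Jlt i lt.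
split=> [y Jy q /Jsub|]; first exact: Jy.
have [JP1 J0 _] := JP _ lt; have [y yJ py] := prime_nullstellensatz JP1 J0 nJp.
by exists y; split=> // /(_ p Jp)/eqP; rewrite (negbTE py).
Qed.

Lemma chain_extend n (Z X : point K n -> Prop) x d C : irreducible_var X ->
  Defs.subsetP Z X -> (exists y, X y /\ ~ Z y) -> chain_at Z x d C ->
  exists C', chain_at X x d.+1 C'.
Proof.
move=> Xirr ZX [y [Xy nZy]] [Cirr [C0 Clt]].
exists (fun i => if (i <= d)%N then C i else X); split=> [i _|].
  by case: ifP => [/Cirr[? CZ]|_]; split=> // z /CZ/ZX.
split=> // i; rewrite ltnS => le; rewrite le; case: ifP => [lt|nlt].
  exact: Clt.
have [_ CZ] := Cirr i le; split=> [z /CZ/ZX//|].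
by exists y; split=> // /CZ.
Qed.

(** * The Jacobian criterion *)

Hypothesis char0 : [pchar K] =i pred0.

Lemma mderiv_eq0_const m (P : {mpoly K[m]}) : (forall j, P^`M(j) = 0) -> P = (P@_0%MM)%:MP.
Proof.
move=> H; apply/mpolyP=> u; rewrite mcoeffC; case: (eqVneq u 0%MM) => [->|u0]; first by rewrite mulr1.
rewrite mulr0; have [j uj] : exists j, u j != 0%N.
  apply: NNPP => nj; move/eqP: u0; apply; apply/mnmP=> j; rewrite mnm0E.
  by apply/eqP; apply: contraT => uj; case: nj; exists j.
have := congr1 (mcoeff (u - U_(j))%MM) (H j); rewrite mcoeff_deriv mcoeff0 submK ?lep1mP //.
move/eqP; rewrite -mulr_natr mulf_eq0 => /orP[/eqP//|].
by rewrite (proj1 (pcharf0P _) char0).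
Qed.

Lemma msize_mderiv m (P : {mpoly K[m]}) j : P^`M(j) != 0 -> (msize P^`M(j) < msize P)%N.
Proof.
move=> n0; have : P@_(mlead P^`M(j) + U_(j)) != 0.
  apply: contraTneq (mlead_supp n0) => E.
  by rewrite mcoeff_msupp mcoeff_deriv E mul0rn eqxx.
by rewrite -mcoeff_msupp -(mlead_deg n0) => /msize_mdeg_lt; rewrite mdegD mdeg1 addn1.
Qed.

(** Descending the degree: by [der] the partial derivatives of a relation are relations of smaller
    degree, hence zero. In characteristic zero the relation is then constant, and a prime ideal
    contains no nonzero constant. *)
Lemma derivation_indep s m (q : {mpoly K[s]} -> Prop) (g : m.-tuple {mpoly K[s]}) :
  prime_ideal q ->
  (forall P j, q (P \mPo g) -> q (P^`M(j) \mPo g)) ->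
  forall P, q (P \mPo g) -> P = 0.
Proof.
move=> qP der; suff H k : forall P, (msize P <= k)%N -> q (P \mPo g) -> P = 0.
  by move=> P; apply: (H (msize P)).
elim: k => [|k IH] P le qPg; first by apply/eqP; rewrite -msize_poly_eq0 -leqn0.
have /mderiv_eq0_const E : forall j, P^`M(j) = 0.
  move=> j; apply: NNPP => n0; apply: (n0); apply: IH; last exact: der.
  by rewrite -ltnS; apply: leq_trans le; apply: msize_mderiv; apply/eqP.
move: qPg; rewrite E comp_mpolyC; case: (eqVneq (P@_0%MM) 0) => [->|c0]; first by rewrite mpolyC0.
move=> /(prime_idealM qP (P@_0%MM)^-1%:MP); rewrite -mpolyCM mulVf // mpolyC1.
by move/(prime_ideal1 qP).
Qed.

Definition pjac n m (g : n.-tuple {mpoly K[m]}) : 'M[{mpoly K[m]}]_(m, n) :=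
  \matrix_(l, j) (tnth g j)^`M(l).

(** The adjugate puts [\det A] times each entry of [v] in [q], and [\det A] is outside [q] because
    it does not vanish at [x]. *)
Lemma prime_cramer s m (q : {mpoly K[s]} -> Prop) (A : 'M[{mpoly K[s]}]_m) (v : 'rV_m) x :
  prime_ideal q -> q 0 -> (forall p, q p -> p.@[x] = 0) -> \det (map_mx (meval x) A) != 0 ->
  (forall j, q ((v *m A) 0 j)) -> forall i, q (v 0 i).
Proof.
move=> qP q0 qx dA H i; have nd : ~ q (\det A).
  by move/qx => E; move: dA; rewrite det_map_mx /= E eqxx.
have : q ((v *m A *m \adj A) 0 i).
  rewrite mxE; apply: prime_ideal_sum => // j; rewrite mulrC; exact: prime_idealM.
by rewrite -mulmxA mul_mx_adj mul_mx_scalar mxE => /(prime_idealP qP)[].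
Qed.

Lemma jacobian_indep m (g : m.-tuple {mpoly K[m]}) x : \det (jac g x) != 0 ->
  forall P, P \mPo g = 0 -> P = 0.
Proof.
move=> dg; apply: (@derivation_indep _ _ (fun p => p = 0)); first exact: prime_ideal_zero.
move=> P j PE; pose v := \row_j (P^`M(j) \mPo g).
have -> : P^`M(j) \mPo g = v 0 j by rewrite mxE.
apply: (@prime_cramer _ _ (fun p => p = 0) (pjac g)^T v x) => //.
- exact: prime_ideal_zero.
- by move=> p ->; rewrite meval0.
- rewrite -map_trmx det_tr (_ : map_mx _ _ = jac g x) //.
  by apply/matrixP=> a b; rewrite !mxE.
move=> l; rewrite mxE; transitivity (P \mPo g)^`M(l); last by rewrite PE mderiv0.
by rewrite mderiv_comp; apply: eq_bigr => i _; rewrite !mxE.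
Qed.

Lemma jacobian_indep_mod m (G : {mpoly K[m.+1]}) (g : m.-tuple {mpoly K[m.+1]}) x :
  rprime G -> G.@[x] = 0 -> \det (jac [tuple of G :: g] x) != 0 ->
  forall P, rdvd G (P \mPo g) -> P = 0.
Proof.
move=> GP Gx dg; have qP := rprime_ideal GP.
apply: (derivation_indep qP) => P j [h PE].
(* Differentiating [P o g = h G] gives an extra term [h dG]; the entry [- h] moves it to the left,
   and what remains, [G dh], is zero modulo [G]. *)
pose v := \row_(i < m.+1) if unlift ord0 i is Some j then P^`M(j) \mPo g else - h.
have -> : P^`M(j) \mPo g = v 0 (lift ord0 j) by rewrite mxE liftK.
apply: (@prime_cramer _ _ (rdvd G) (pjac [tuple of G :: g])^T v x) => //; first exact: rdvd0.
- by move=> p [c ->]; rewrite mevalM Gx mulr0.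
- rewrite -map_trmx det_tr (_ : map_mx _ _ = jac [tuple of G :: g] x) //.
  by apply/matrixP=> a b; rewrite !mxE.
move=> l; rewrite mxE big_ord_recl !mxE unlift_none tnth0.
have := congr1 (mderiv l) PE; rewrite mderiv_comp mderivM => E.
rewrite (eq_bigr (fun j => (P^`M(j) \mPo g) * (tnth g j)^`M(l))); last first.
  by move=> i _; rewrite !mxE liftK tnthS.
by rewrite E; exists (h^`M(l)); ring.
Qed.
End Varieties.

(** * Parametrizations immersive at a point *)

Section Parametrizations.
Variable K : closedFieldType.
Hypothesis char0 : [pchar K] =i pred0.

Definition parametrization n (X : point K n -> Prop) x r (phi : n.-tuple {mpoly K[r]}) :=
  [/\ forall t, X (mpmap phi t), mpmap phi (fun _ => 0) = x
    & row_free (jac phi (fun _ => 0))].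

Lemma mpmap_origin_lin m k (C : 'M[K]_(k, m)) : mpmap (lin C) (fun _ => 0) = fun _ => 0.
Proof. by apply: functional_extensionality; apply: mpmap_lin0. Qed.

Lemma mpmap_pmcompE n m k (g : n.-tuple {mpoly K[m]}) (h : m.-tuple {mpoly K[k]}) x :
  mpmap (pmcomp g h) x = mpmap g (mpmap h x).
Proof. by apply: functional_extensionality; apply: mpmap_pmcomp. Qed.

Lemma pmcompA n m k l (f : n.-tuple {mpoly K[m]}) (g : m.-tuple {mpoly K[k]}) (h : k.-tuple {mpoly K[l]}) :
  pmcomp (pmcomp f g) h = pmcomp f (pmcomp g h).
Proof. by apply: eq_from_tnth => i; rewrite !tnth_mktuple comp_mpoly_comp. Qed.

Lemma pmcomp_lin m k l (C : 'M[K]_(k, m)) (D : 'M[K]_(l, k)) :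
  pmcomp (lin C) (lin D) = lin (D *m C).
Proof.
apply: eq_from_tnth => j; rewrite !tnth_mktuple raddf_sum /=.
transitivity (\sum_i \sum_a (C i j * D a i) *: ('X_a : {mpoly K[l]})).
  apply: eq_bigr => i _; rewrite comp_mpolyZ comp_mpolyXU -tnth_nth tnth_mktuple scaler_sumr.
  by apply: eq_bigr => a _; rewrite scalerA.
rewrite exchange_big; apply: eq_bigr => a _; rewrite mxE scaler_suml.
by apply: eq_bigr => i _; rewrite mulrC.
Qed.

Lemma parametrization_lin n (X : point K n -> Prop) x r (phi : n.-tuple {mpoly K[r]}) s (C : 'M[K]_(s, r)) :
  parametrization X x phi -> row_free C -> parametrization X x (pmcomp phi (lin C)).
Proof.
move=> [phiX phi0 phiJ] CF; split.
- by move=> t; rewrite mpmap_pmcompE.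
- by rewrite mpmap_pmcompE mpmap_origin_lin.
by rewrite jac_pmcomp jac_lin mpmap_origin_lin /row_free mxrankMfree.
Qed.

Lemma right_inverse_jac n r (phi : n.-tuple {mpoly K[r]}) x :
  row_free (jac phi x) -> exists D, jac phi x *m D = 1%:M.
Proof. by move/row_freeP=> [D DE]; exists D. Qed.

Lemma mul_pid_mxS i r : pid_mx i = (pid_mx i : 'M[K]_(i, i.+1)) *m (pid_mx i.+1 : 'M_(i.+1, r)).
Proof. by rewrite mul_pid_mx; congr pid_mx; lia. Qed.

Lemma param_chain n (X : point K n -> Prop) x r (phi : n.-tuple {mpoly K[r]}) :
  zclosed X -> parametrization X x phi ->
  exists2 Z, chain_at X x r Z & forall p, p \mPo phi = 0 -> eqX (Z r) p 0.
Proof.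
move=> Xcl [phiX phi0 phiJ]; have [D DE] := right_inverse_jac phiJ.
pose ph i := pmcomp phi (lin (pid_mx i : 'M[K]_(i, r))).
pose J i p := p \mPo ph i = 0.
have ph0 i : mpmap (ph i) (fun _ => 0) = x by rewrite mpmap_pmcompE mpmap_origin_lin.
have phS i : ph i = pmcomp (ph i.+1) (lin (pid_mx i)).
  by rewrite /ph pmcompA pmcomp_lin -mul_pid_mxS.
exists (fun i => vanishing (J i)); last first.
  move=> p pphi y; rewrite meval0; apply.
  by rewrite /J /ph /pmcomp -comp_mpoly_comp pphi comp_mpoly0.
apply: chain_of_primes => [i _|p|i lt].
- split; first exact: (prime_ideal_preim (comp_mpoly (ph i)) (prime_ideal_zero _)).
    exact: comp_mpoly0.
  move=> y Jy; apply: zclosed_eqX0 Xcl _ => p pX; apply: Jy.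
  apply: mpoly_eval_eq0 => t; rewrite meval_comp pX ?meval0 //.
  by rewrite mpmap_pmcompE.
- by move=> E; rewrite -(ph0 0%N) -meval_comp E meval0.
split=> [p E|].
  by rewrite /J phS /pmcomp -comp_mpoly_comp E comp_mpoly0.
(* As [D] inverts the Jacobian, these [i + 1] linear functions restrict to the space of [i + 1]
   parameters with identity Jacobian at 0, so they are independent there; on [i] parameters they are
   dependent. Their relation separates the two closures. *)
pose xi : i.+1.-tuple {mpoly K[n]} := lin (D *m (pid_mx i.+1 : 'M_(r, i.+1))).
have [P P0 PE] := algebraic_dependence (pmcomp xi (ph i)).
exists (P \mPo xi); split; first by rewrite /J comp_mpoly_comp.
rewrite /J comp_mpoly_comp => E; move/eqP: P0; apply.
apply: (jacobian_indep char0 (g := pmcomp xi (ph i.+1)) (x := fun _ => 0)) E.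
rewrite !jac_pmcomp !jac_lin mpmap_origin_lin mulmxA -[_ *m _ *m D]mulmxA DE mulmx1.
by rewrite mul_pid_mx !minnn (minn_idPr lt) pid_mx_1 det1 oner_neq0.
Qed.

Lemma param_algindep n (X : point K n -> Prop) x r (phi : n.-tuple {mpoly K[r]}) :
  parametrization X x phi -> algindep X r.
Proof.
move=> [phiX _ phiJ]; have [D DE] := right_inverse_jac phiJ.
exists (lin D) => P PX; apply: (jacobian_indep char0 (g := pmcomp (lin D) phi) (x := fun _ => 0)).
  by rewrite jac_pmcomp jac_lin DE det1 oner_neq0.
rewrite -comp_mpoly_comp; apply: mpoly_eval_eq0 => t.
by rewrite meval_comp PX ?meval0.
Qed.

(** A function vanishing on the image but not on [X] would allow [X] to be added on top of the chain
    of length [r], exceeding the local dimension. *)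
Lemma param_dominant n (X : point K n -> Prop) x r (phi : n.-tuple {mpoly K[r]}) :
  irreducible_var X -> local_dim X x r -> parametrization X x phi ->
  forall p, p \mPo phi = 0 -> eqX X p 0.
Proof.
move=> Xirr [_ Xmax] ph p pE; have [Xcl _] := Xirr.
have [Z ZC ZE] := param_chain Xcl ph; apply: NNPP => nX.
have ex : exists y, X y /\ ~ (Z r y /\ X y).
  have [y [Xy py]] : exists y, X y /\ p.@[y] <> 0.
    apply: NNPP => H; apply: nX => y Xy; rewrite meval0; apply: NNPP => py; apply: H; by exists y.
  by exists y; split=> // [[/(ZE p pE)]]; rewrite meval0.
have [|C CC] := chain_extend Xirr (fun y (Zy : Z r y /\ X y) => proj2 Zy) ex (C := Z) (d := r) (x := x).
  have [Zirr [Z0 Zlt]] := ZC; split=> //.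
  move=> i le; have [Zi ZX] := Zirr i le; split=> // y Zy; split; last exact: ZX.
  have mono k : (i + k <= r)%N -> Defs.subsetP (Z i) (Z (i + k)%N).
    elim: k => [|k IH]; first by rewrite addn0 => _ z.
    by rewrite addnS => lt z /(IH (ltnW lt)); have [H _] := Zlt _ lt; apply: H.
  by have := mono (r - i)%N; rewrite subnKC // => /(_ (leqnn _)); apply.
by have := Xmax _ _ CC; rewrite ltnn.
Qed.

(** * Chains in a smooth hypersurface *)

(** Divisibility by [F] in the local ring of affine space at the origin. It describes the branch of
    [F = 0] through 0 without choosing a prime factor, so restriction to fewer coordinates clearly
    preserves it. *)
Definition local_multiple s (F p : {mpoly K[s]}) :=
  exists2 h : {mpoly K[s]}, h.@[fun _ => 0] != 0 & rdvd F (h * p).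

(** If two prime factors, counted with multiplicity, vanished at 0, the differential of [F] would
    vanish there. *)
Lemma local_factor s (F : {mpoly K[s]}) : F.@[fun _ => 0] = 0 ->
  (exists l, (F^`M(l)).@[fun _ => 0] != 0) ->
  exists G H, [/\ F = G * H, rprime G, G.@[fun _ => 0] = 0 & H.@[fun _ => 0] != 0].
Proof.
move=> F0 [l dF]; have Fn0 : F != 0 by apply: contraNneq dF => ->; rewrite mderiv0 meval0.
have [u [t [Uu tP E]]] := prime_factorization_mpoly Fn0.
have [G Gt G0] : exists2 G, G \in t & G.@[fun _ => 0] = 0.
  have u0 : u.@[fun _ => 0] != 0.
    by have := rmorph_unit (meval (fun _ => 0)) Uu; rewrite unitfE.
  move: F0; rewrite E mevalM => /eqP; rewrite mulf_eq0 (negbTE u0) /=.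
  rewrite rmorph_prod /= prodf_seq_eq0 => /hasP[G Gt /eqP G0]; by exists G.
exists G, (u * \prod_(r <- rem G t) r); split=> //; last 1 first.
- apply: contraNneq dF => H0; move: H0; rewrite E (perm_big _ (perm_to_rem Gt)) big_cons /=.
  rewrite mulrCA; move: (u * _) => H H0.
  by rewrite mderivM mevalD !mevalM H0 G0 mulr0 mul0r addr0.
- by rewrite {1}E (perm_big _ (perm_to_rem Gt)) big_cons /= mulrCA.
exact: tP.
Qed.

Lemma local_multipleP s (F G H p : {mpoly K[s]}) : F = G * H -> rprime G ->
  G.@[fun _ => 0] = 0 -> H.@[fun _ => 0] != 0 -> local_multiple F p <-> rdvd G p.
Proof.
move=> E [_ _ GP] G0 H0; split=> [[h h0 [c hp]]|[c Ec]].
  have [||//] := GP h p; first by exists (c * H); rewrite hp E; ring.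
  by move=> [d Ed]; move: h0; rewrite Ed mevalM G0 mulr0 eqxx.
by exists H => //; exists c; rewrite Ec E; ring.
Qed.

(** The [g] together with [F] are dependent. Once the relation has been freed of powers of the
    variable standing for [F], its constant term in that variable is a relation modulo [F]. *)
Lemma dependence_mod m (g : m.-tuple {mpoly K[m]}) F : F != 0 ->
  exists2 P : {mpoly K[m]}, P != 0 & rdvd F (P \mPo g).
Proof.
move=> F0; have [R R0] := algebraic_dependence [tuple of rcons g F].
rewrite -[R]muniK in R0 *; have Q0 : muni R != 0 by apply: contraNneq R0 => ->; rewrite rmorph0.
move: (muni R) Q0 => Q {R R0}; elim/poly_ind: Q => [|Q c IH]; first by rewrite eqxx.
rewrite mjoin_comp rmorphD rmorphM /= hornerD hornerM map_polyX map_polyC hornerX hornerC -mjoin_comp /=.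
case: (eqVneq c 0) => [->|c0 _ E].
  rewrite comp_mpoly0 !addr0 => QX /eqP; rewrite mulf_eq0 (negbTE F0) orbF => /eqP; apply: IH.
  by apply: contraNneq QX => ->; rewrite mul0r.
by exists c => //; exists (- (mjoin Q \mPo [tuple of rcons g F])); apply/eqP; rewrite mulNr -addr_eq0 addrC E.
Qed.

Lemma normalize_col k (v : 'cV[K]_k.+1) : v != 0 ->
  exists2 C : 'M[K]_k.+1, C \in unitmx & exists2 a, a != 0 & C *m v = a *: delta_mx 0 0.
Proof.
move=> v0; have rv : \rank v = 1%N.
  by apply/eqP; rewrite eqn_leq rank_leq_col lt0n mxrank_eq0.
exists (invmx (col_ebase v)); first by rewrite unitmx_inv col_ebase_unit.
exists (row_ebase v 0 0).
  have := row_ebase_unit v; rewrite unitmxE [row_ebase v]mx11_scalar det_scalar expr1 mxE eqxx mulr1n unitfE //.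
rewrite -{2}(mulmx_ebase v) rv !mulmxA mulVmx ?col_ebase_unit // mul1mx.
apply/matrixP=> i j; rewrite !mxE big_ord1 !mxE !ord1 !eqxx /= mulrC.
by rewrite -!val_eqE /=; case: (i : nat) => [|?]; rewrite ?eqxx ?mulr0 //=; case: k.
Qed.

(** A linear change of parameters leaves only the first partial derivative of the pullback of [f]
    nonzero at 0. Its restrictions to the first coordinates then keep a nonzero differential, and
    the branches through 0 of these hypersurfaces give the chain. *)
Lemma hypersurface_chain n (Y : point K n -> Prop) y k (phi : n.-tuple {mpoly K[k.+1]}) f :
  zclosed Y -> parametrization Y y phi -> f.@[y] = 0 ->
  (exists l, ((f \mPo phi)^`M(l)).@[fun _ => 0] != 0) ->
  exists Z, chain_at (zero_locus Y f) y k Z.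
Proof.
move=> Ycl phiP fy [l0 dl0].
pose v : 'cV[K]_k.+1 := \col_l ((f \mPo phi)^`M(l)).@[fun _ => 0].
have v0 : v != 0 by apply: contraNneq dl0 => /colP/(_ l0); rewrite !mxE => ->.
have [C CU [a a0 Cv]] := normalize_col v0.
have {phiP} [psiY psi0 psiJ] := parametrization_lin phiP (s := k.+1) (C := C) (etrans (row_free_unit _) CU).
have dF l : ((f \mPo pmcomp phi (lin C))^`M(l)).@[fun _ => 0] = a *+ (l == 0).
  have -> : ((f \mPo pmcomp phi (lin C))^`M(l)).@[fun _ => 0] = (C *m v) l 0.
    rewrite /pmcomp -comp_mpoly_comp mderiv_comp raddf_sum mxE /=.
    by apply: eq_bigr => i _; rewrite mevalM meval_comp mpmap_origin_lin mderiv_lin mulrC mxE.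
  by rewrite Cv !mxE eqxx andbT; case: eqP => _; rewrite ?mulr1 ?mulr0.
move: (pmcomp phi (lin C)) psiY psi0 psiJ dF => psi psiY psi0 psiJ dF {phi v l0 dl0 v0 C CU Cv}.
have [D DE] := right_inverse_jac psiJ.
(* The index is shifted: a hypersurface in the space of [i + 1] parameters has dimension [i]. *)
pose ps i := pmcomp psi (lin (pid_mx i.+1 : 'M[K]_(i.+1, k.+1))).
pose F i := f \mPo ps i.
pose J i p := local_multiple (F i) (p \mPo ps i).
have ps0 i : mpmap (ps i) (fun _ => 0) = y by rewrite mpmap_pmcompE mpmap_origin_lin.
have psS i : ps i = pmcomp (ps i.+1) (lin (pid_mx i.+1)).
  by rewrite /ps pmcompA pmcomp_lin -mul_pid_mxS.
have F0 i : (F i).@[fun _ => 0] = 0 by rewrite meval_comp ps0.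
have dFi i l : (i <= k)%N -> ((F i)^`M(l)).@[fun _ => 0] = a *+ (l == 0).
  move=> le; rewrite /F /ps /pmcomp -comp_mpoly_comp mderiv_comp raddf_sum /=.
  rewrite (bigD1 (widen_ord (le : i < k.+1)%N l)) //= big1 => [|j jl]; rewrite mevalM meval_comp mpmap_origin_lin dF mderiv_lin mxE.
    by rewrite eqxx ltn_ord addr0 mulr1 -!val_eqE.
  by rewrite -val_eqE /= eq_sym in jl; rewrite (negbTE jl) mulr0.
have loc i : (i <= k)%N -> exists G H, [/\ F i = G * H, rprime G, G.@[fun _ => 0] = 0 & H.@[fun _ => 0] != 0].
  by move=> le; apply: local_factor => //; exists 0; rewrite dFi // eqxx.
exists (fun i => vanishing (J i)); apply: chain_of_primes => [i le|p [h h0 [c E]]|i lt].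
- have [G [H [FE GP G0 H0]]] := loc i le.
  have LM p : local_multiple (F i) p <-> rdvd G p by apply: local_multipleP FE GP G0 H0.
  have [JD JM J1 JI] := prime_ideal_preim (comp_mpoly (ps i)) (rprime_ideal GP).
  split.
  + split.
    * by move=> p q /LM Hp /LM Hq; apply/LM; apply: JD.
    * by move=> p q /LM Hq; apply/LM; apply: JM.
    * by move/LM.
    * by move=> p q /LM /JI[/LM|/LM]; [left|right].
  + by apply/LM; rewrite comp_mpoly0; apply: rdvd0.
  move=> z Jz; split.
    apply: zclosed_eqX0 Ycl _ => p pY; apply: Jz; apply/LM.
    rewrite (_ : p \mPo _ = 0); first exact: rdvd0.
    apply: mpoly_eval_eq0 => t; rewrite meval_comp pY ?meval0 //.
    by rewrite mpmap_pmcompE.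
  by apply: Jz; apply/LM; rewrite -/(F i) FE; exists H; rewrite mulrC.
- have := congr1 (meval (fun _ => 0)) E; rewrite !mevalM F0 mulr0 meval_comp ps0 => /eqP.
  by rewrite mulf_eq0 (negbTE h0) => /eqP.
split=> [p [h h0 [c E]]|].
  exists (h \mPo lin (pid_mx i.+1)); first by rewrite meval_comp mpmap_origin_lin.
  exists (c \mPo lin (pid_mx i.+1)).
  have psc q : q \mPo ps i = (q \mPo ps i.+1) \mPo lin (pid_mx i.+1).
    by rewrite psS comp_mpoly_comp.
  by rewrite /F !psc -!rmorphM /= E.
(* [E] omits the first parameter, whose place in the Jacobian is taken by the equation of the
   hypersurface. *)
pose E : 'M[K]_(k.+1, i.+1) := \matrix_(b, c) (b == c.+1 :> nat)%:R.
pose xi : i.+1.-tuple {mpoly K[n]} := lin (D *m E).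
have [G [H [FE GP G0 H0]]] := loc i (ltnW lt).
have Fn0 : F i != 0.
  by apply: contraNneq a0 => FE0; have := dFi i 0 (ltnW lt); rewrite FE0 mderiv0 meval0 eqxx => /esym/eqP.
have [P P0 PE] := dependence_mod (pmcomp xi (ps i)) Fn0.
exists (P \mPo xi); split.
  by exists 1; rewrite ?meval1 ?oner_neq0 // mul1r comp_mpoly_comp.
have {G H FE GP G0 H0} [G [H [FE GP G0 H0]]] := loc i.+1 lt.
move/(local_multipleP _ FE GP G0 H0); rewrite comp_mpoly_comp -/(pmcomp xi _) => PG.
move/eqP: P0; apply; apply: (jacobian_indep_mod char0 GP G0) PG.
(* From [F = G H] and [G(0) = 0] comes [dF = H(0) dG] at 0, whence the first entry. *)
pose d : 'rV[K]_i.+2 := \row_j if j == 0 then a / H.@[fun _ => 0] else 1.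
have -> : jac [tuple of G :: pmcomp xi (ps i.+1)] (fun _ => 0) = diag_mx d.
  apply/matrixP=> l j; rewrite !mxE; case: (unliftP 0 j) => [b ->|->].
    rewrite tnthS (_ : (if _ then _ else _) *+ _ = (l == lift 0 b)%:R); last first.
      by case: (eqVneq l (lift 0 b)) => [->|_]; rewrite ?mulr0n // eq_sym (negbTE (neq_lift _ _)).
    have := congr1 (fun M : 'M_(_, _) => M l b) (jac_pmcomp xi (ps i.+1) (fun _ => 0)).
    rewrite /= mxE => ->; rewrite jac_pmcomp !jac_lin mpmap_origin_lin mulmxA -[_ *m _ *m D]mulmxA DE mulmx1.
    rewrite mxE (bigD1 (widen_ord (lt : i.+1 < k.+1)%N l)) //= big1 ?addr0 => [|c cl].
      by rewrite !mxE eqxx ltn_ord mul1r -val_eqE /= /bump /=.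
    by rewrite !mxE -val_eqE /= eq_sym in cl *; rewrite (negbTE cl) mul0r.
  rewrite tnth0; have := dFi i.+1 l lt; rewrite FE mderivM mevalD !mevalM G0 mul0r addr0 => Ed.
  by apply: (mulIf H0); rewrite Ed; case: eqP => _; rewrite ?mulr1n ?mulr0n ?divfK ?mul0r.
rewrite det_diag big_ord_recl mxE eqxx mulf_neq0 //; last first.
  by rewrite big1 ?oner_neq0 // => j _; rewrite mxE eq_sym (negbTE (neq_lift _ _)).
by rewrite mulf_neq0 // invr_eq0.
Qed.
End Parametrizations.

(** * Tangent vectors *)

Section Tangents.
Variable K : closedFieldType.

Definition dderiv n (p : {mpoly K[n]}) (x : point K n) (v : 'rV[K]_n) : K :=
  \sum_i v 0 i * (p^`M(i)).@[x].

Definition tangent_vec n (X : point K n -> Prop) x v :=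
  forall p, eqX X p 0 -> dderiv p x v = 0.

Lemma dderivE n (p : {mpoly K[n]}) x v : dderiv p x v = (v *m \col_i (p^`M(i)).@[x]) 0 0.
Proof. by rewrite mxE; apply: eq_bigr => i _; rewrite mxE. Qed.

Lemma dderiv_mul n (p : {mpoly K[n]}) x m (c : 'rV_m) (W : 'M_(m, n)) :
  dderiv p x (c *m W) = \sum_i c 0 i * dderiv p x (row i W).
Proof.
rewrite dderivE -mulmxA mxE; apply: eq_bigr => i _; congr (_ * _).
by rewrite dderivE -row_mul [RHS]mxE.
Qed.

Lemma dderivXU n (x : point K n) v i : dderiv 'X_i x v = v 0 i.
Proof.
rewrite /dderiv (bigD1 i) //= big1 ?addr0 => [|j ji]; rewrite mderivXU mevalC ?eqxx ?mulr1 //.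
by rewrite eq_sym (negbTE ji) mulr0.
Qed.

Lemma dderivB n (p q : {mpoly K[n]}) x v : dderiv (p - q) x v = dderiv p x v - dderiv q x v.
Proof. by rewrite /dderiv -sumrB; apply: eq_bigr => i _; rewrite mderivB mevalB mulrBr. Qed.

Lemma dderivD n (p q : {mpoly K[n]}) x v : dderiv (p + q) x v = dderiv p x v + dderiv q x v.
Proof. by rewrite /dderiv -big_split; apply: eq_bigr => i _; rewrite mderivD mevalD mulrDr. Qed.

Lemma dderivZ n a (p : {mpoly K[n]}) x v : dderiv (a *: p) x v = a * dderiv p x v.
Proof. by rewrite /dderiv big_distrr; apply: eq_bigr => i _; rewrite mderivZ mevalZ mulrCA. Qed.

Lemma dderivC n c (x : point K n) v : dderiv c%:MP x v = 0.
Proof. by rewrite /dderiv big1 // => i _; rewrite mderivC meval0 mulr0. Qed.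

Lemma dderivM n (p q : {mpoly K[n]}) x v :
  dderiv (p * q) x v = p.@[x] * dderiv q x v + q.@[x] * dderiv p x v.
Proof.
rewrite /dderiv !big_distrr -big_split; apply: eq_bigr => i _ /=.
by rewrite mderivM mevalD !mevalM; ring.
Qed.

Lemma dderiv_vecD n (p : {mpoly K[n]}) x v w : dderiv p x (v + w) = dderiv p x v + dderiv p x w.
Proof. by rewrite !dderivE mulmxDl mxE. Qed.

Lemma dderiv_vecZ n (p : {mpoly K[n]}) x a v : dderiv p x (a *: v) = a * dderiv p x v.
Proof. by rewrite !dderivE -scalemxAl mxE. Qed.

Lemma dderiv_comp n m (p : {mpoly K[n]}) (g : n.-tuple {mpoly K[m]}) t v :
  dderiv (p \mPo g) t v = dderiv p (mpmap g t) (v *m jac g t).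
Proof.
rewrite !dderivE -mulmxA; congr ((_ *m _) 0 0); apply/colP=> l.
rewrite !mxE mderiv_comp raddf_sum; apply: eq_bigr => j _ /=.
by rewrite mevalM meval_comp !mxE mulrC.
Qed.

(** By the Leibniz rule a derivation is determined by its values on the coordinates; tangent vectors
    thus become rows. *)
Lemma tangent_vecE n (X : point K n -> Prop) x (D : {mpoly K[n]} -> K) : tangent X x D ->
  forall p, D p = dderiv p x (\row_i D 'X_i).
Proof.
move=> [_ [DL DM]]; have D0 : D 0 = 0.
  have := DL 1 0 0; rewrite scale1r addr0 mul1r => H.
  by apply: (addrI (D 0)); rewrite -H addr0.
have DD p q : D (p + q) = D p + D q by have := DL 1 p q; rewrite scale1r mul1r.
have DC c : D c%:MP = 0.
  have D1 : D 1 = 0.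
    have := DM 1 1; rewrite mulr1 meval1 mul1r => H.
    by apply: (addrI (D 1)); rewrite -H addr0.
  by have := DL c 1 0; rewrite addr0 -mul_mpolyC mulr1 D1 D0 mulr0 addr0.
elim/mpoly_ring_ind => [c|i|p q IHp IHq|p q IHp IHq].
- by rewrite DC dderivC.
- by rewrite dderivXU mxE.
- by rewrite DD IHp IHq dderivD.
by rewrite DM IHp IHq dderivM.
Qed.

Lemma tangent_row n (X : point K n -> Prop) x D : tangent X x D -> tangent_vec X x (\row_i D 'X_i).
Proof.
move=> DT p pX; rewrite -(tangent_vecE DT); have [DE _] := DT.
by rewrite (DE _ _ pX) (tangent_vecE DT) -mpolyC0 dderivC.
Qed.

Lemma tangent_dderiv n (X : point K n -> Prop) x v : tangent_vec X x v ->
  tangent X x (fun p => dderiv p x v).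
Proof.
move=> vT; split=> [p q pq|].
  apply/eqP; rewrite -subr_eq0 -dderivB; apply/eqP/vT => y Xy.
  by rewrite mevalB pq // subrr meval0.
split=> [a p q|p q]; first by rewrite dderivD dderivZ.
exact: dderivM.
Qed.

Definition tangent_basis n (X : point K n -> Prop) x d (M : 'M[K]_(d, n)) :=
  row_free M /\ forall v, tangent_vec X x v <-> (v <= M)%MS.

Lemma row_freeV n d (M : 'M[K]_(d, n)) : (forall c : 'rV_d, c *m M = 0 -> c = 0) -> row_free M.
Proof.
move=> H; rewrite -kermx_eq0; apply/eqP/row_matrixP=> i; rewrite row0; apply: H.
by apply/sub_kermxP; apply: row_sub.
Qed.

Lemma tangent_dimP n (X : point K n -> Prop) x d :
  tangent_dim X x d <-> exists M : 'M[K]_(d, n), tangent_basis X x M.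
Proof.
split=> [[E [ET [Efree Espan]]]|[M [MF MT]]].
  pose M : 'M[K]_(d, n) := \matrix_(i, j) E i 'X_j.
  have ME i p : E i p = dderiv p x (row i M).
    by rewrite (tangent_vecE (ET i)); congr dderiv; apply/rowP=> j; rewrite !mxE.
  exists M; split.
    apply: row_freeV => c cM; apply/rowP=> i; rewrite mxE; apply: (Efree (fun i => c 0 i)) => p.
    transitivity (dderiv p x (c *m M)); last first.
      by rewrite cM dderivE mul0mx mxE.
    by rewrite dderiv_mul; apply: eq_bigr => j _; rewrite ME.
  move=> v; split=> [vT|/submxP[c ->] p pX].
    have [m [c [E' [EE H]]]] := Espan _ (tangent_dderiv vT).
    have -> : v = \sum_(i < m) c i *: \row_j E' i 'X_j.
      apply/rowP=> j; rewrite -[LHS](dderivXU x) H summxE.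
      by apply: eq_bigr => i _; rewrite !mxE.
    apply: summx_sub => i _; apply: scalemx_sub; have [l ->] := EE i.
    have -> : \row_j E l 'X_j = row l M by apply/rowP=> j; rewrite !mxE.
    exact: row_sub.
  rewrite dderiv_mul big1 // => i _; rewrite -ME; have [Eeq [EL _]] := ET i.
  by rewrite (Eeq _ _ pX) (tangent_vecE (ET i)) -mpolyC0 dderivC mulr0.
exists (fun i p => dderiv p x (row i M)); split.
  by move=> i; apply/tangent_dderiv/MT/row_sub.
split=> [c H i|D DT].
  have : \row_i c i = 0.
    apply: (row_free_inj MF); rewrite mul0mx; apply/rowP=> j; rewrite [RHS]mxE.
    rewrite -[LHS](dderivXU x) dderiv_mul -[RHS](H 'X_j).
    by apply: eq_bigr => l _; rewrite mxE.
  by move/rowP/(_ i); rewrite !mxE.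
have /MT/submxP[c Ec] := tangent_row DT.
exists d, (fun i => c 0 i), (fun i p => dderiv p x (row i M)); split=> [i|p]; first by exists i.
by rewrite (tangent_vecE DT) Ec dderiv_mul.
Qed.

Lemma subspace_basis n (P : 'rV[K]_n -> Prop) : P 0 ->
  (forall a v w, P v -> P w -> P (a *: v + w)) ->
  exists d (M : 'M[K]_(d, n)), row_free M /\ forall v, P v <-> (v <= M)%MS.
Proof.
move=> P0 PL; have [|M MP Mmax] := @ex_minimal 'M[K]_n (fun M => (n - \rank M)%N)
    (fun M => forall v, (v <= M)%MS -> P v).
  by exists 0 => v; rewrite submx0 => /eqP->.
exists (\rank M), (row_base M); split; first exact: row_base_free.
move=> v; rewrite eq_row_base; split=> [Pv|/MP//]; apply: contraT => nvM.
have {Mmax} : (n - \rank M <= n - \rank (M + v)%MS)%N.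
  apply: Mmax => w /sub_addsmxP[[c1 c2] ->] /=; rewrite addrC.
  have [a ->] : exists a, c2 = a%:M by exists (c2 0 0); apply: mx11_scalar.
  by rewrite mul_scalar_mx; apply: PL => //; apply: MP; apply: submxMl.
have lt : (\rank M < \rank (M + v)%MS)%N.
  rewrite ltn_neqAle mxrankS ?addsmxSl // andbT; apply: contra nvM => /eqP E.
  by have := mxrank_leqif_sup (addsmxSl M v) => /leqifP; rewrite E; case: ifP => [/(submx_trans (addsmxSr M v))//|_]; rewrite ltnn.
by have := rank_leq_col (M + v)%MS; lia.
Qed.

Lemma tangent_basis_exists n (X : point K n -> Prop) x :
  exists d (M : 'M[K]_(d, n)), tangent_basis X x M.
Proof.
apply: subspace_basis => [p _|a v w vT wT p pX]; first by rewrite dderivE mul0mx mxE.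
by rewrite dderiv_vecD dderiv_vecZ vT // wT // mulr0 addr0.
Qed.

Lemma basis_dim_uniq n (P : 'rV[K]_n -> Prop) d e (M : 'M[K]_(d, n)) (N : 'M[K]_(e, n)) :
  row_free M -> row_free N -> (forall v, P v <-> (v <= M)%MS) -> (forall v, P v <-> (v <= N)%MS) ->
  d = e.
Proof.
move=> /eqP rM /eqP rN MP NP; rewrite -rM -rN; apply/eqP; rewrite eqn_leq.
by rewrite !mxrankS //; apply/row_subP=> i; [apply/MP/NP|apply/NP/MP]; apply: row_sub.
Qed.

(** The boolean, read as 0 or 1, is the rank of the form [l] on the row space of [M], that is the
    drop in dimension. *)
Lemma hyperplane_basis n d (M : 'M[K]_(d, n)) (l : 'cV[K]_n) : row_free M ->
  exists e (N : 'M[K]_(e, n)), [/\ row_free N, d = (e + (M *m l != 0%R)%R)%N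
    & forall v : 'rV_n, (v <= N)%MS <-> (v <= M)%MS /\ v *m l = 0].
Proof.
move=> MF; pose A := kermx (M *m l) *m M.
exists (\rank A), (row_base A); split; first exact: row_base_free.
  rewrite mxrankMfree // mxrank_ker.
  have : (\rank (M *m l) <= 1)%N by apply: rank_leq_col.
  have := rank_leq_row (M *m l); rewrite -mxrank_eq0; case: (\rank _) => [|[|//]]; lia.
move=> v; rewrite eq_row_base; split=> [/submxP[c ->]|[/submxP[c ->] cl]].
  by rewrite /A mulmxA submxMl -mulmxA -(mulmxA c) mulmx_ker mulmx0.
by apply: submxMr; apply/sub_kermxP; rewrite mulmxA.
Qed.

(** * Orbits of additive group actions *)

Definition orbit_vec n (X : point K n -> Prop) x (v : 'rV[K]_n) :=
  exists2 Phi, Ga_action X Phi & v = \row_i ((tnth Phi i)^`M(ord0)).@[ext 0 x].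

Lemma act_mpmap n (Phi : n.-tuple {mpoly K[n.+1]}) t x : act Phi t x = mpmap Phi (ext t x).
Proof. by []. Qed.

Lemma act0 n (X : point K n -> Prop) Phi x : Ga_action X Phi -> X x -> act Phi 0 x = x.
Proof. by move=> [_ [H _]] Xx; apply: functional_extensionality => i; apply: H. Qed.

Lemma actD n (X : point K n -> Prop) Phi s t x : Ga_action X Phi -> X x ->
  act Phi (s + t) x = act Phi s (act Phi t x).
Proof. by move=> [_ [_ H]] Xx; apply: functional_extensionality => i; apply: H. Qed.

Lemma actX n (X : point K n -> Prop) Phi t x : Ga_action X Phi -> X x -> X (act Phi t x).
Proof. by move=> [H _]; apply: H. Qed.

Lemma orbit_tangentE n (X : point K n -> Prop) Phi x p : Ga_action X Phi -> X x ->
  orbit_tangent Phi x p = dderiv p x (\row_i ((tnth Phi i)^`M(ord0)).@[ext 0 x]).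
Proof.
move=> PhiG Xx; rewrite /orbit_tangent mderiv_comp raddf_sum; apply: eq_bigr => i _ /=.
by rewrite mevalM meval_comp -act_mpmap (act0 PhiG) // mxE mulrC.
Qed.

Lemma flexible_pointP n (X : point K n -> Prop) x : X x ->
  flexible_point X x <-> forall v, tangent_vec X x v ->
    exists m (W : 'M[K]_(m, n)), (forall i, orbit_vec X x (row i W)) /\ (v <= W)%MS.
Proof.
move=> Xx; split=> [fl v vT|H D DT].
  have [m [c [E [EO H]]]] := fl _ (tangent_dderiv vT).
  exists m, (\matrix_(i, j) E i 'X_j); split.
    move=> i; have [Phi [PhiG EE]] := EO i; exists Phi => //.
    by apply/rowP=> j; rewrite !mxE EE (orbit_tangentE _ PhiG) // dderivXU mxE.
  apply/submxP; exists (\row_i c i); apply/rowP=> j; rewrite -[LHS](dderivXU x) H mxE.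
  by apply: eq_bigr => i _; rewrite !mxE.
have [m [W [WO /submxP[c Ec]]]] := H _ (tangent_row DT).
exists m, (fun i => c 0 i), (fun i p => dderiv p x (row i W)); split=> [i|p].
  have [Phi PhiG E] := WO i; exists Phi; split=> // p.
  by rewrite (orbit_tangentE _ PhiG) // -E.
by rewrite (tangent_vecE DT) Ec dderiv_mul.
Qed.

(** The orbit of [x] under the group generated by the additive subgroups; the inverse of an action
    at [t] is the action at [- t]. *)
Inductive reach n (X : point K n -> Prop) (x : point K n) : point K n -> Prop :=
| reach_refl : reach X x x
| reach_act Phi t y : Ga_action X Phi -> reach X x y -> reach X x (act Phi t y).

Lemma reachX n (X : point K n -> Prop) x y : X x -> reach X x y -> X y.
Proof. by move=> Xx; elim=> // Phi t z PhiG _; apply: actX. Qed.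

Lemma mpmap_eq n r (phi psi : n.-tuple {mpoly K[r]}) : (forall t, mpmap phi t =1 mpmap psi t) -> phi = psi.
Proof.
move=> H; apply: eq_from_tnth => i; apply/eqP; rewrite -subr_eq0; apply/eqP.
by apply: mpoly_eval_eq0 => t; rewrite mevalB; have := H t i; rewrite /mpmap => ->; rewrite subrr.
Qed.

(* The map [(t_1, ..., t_m) |-> act Phi_1 t_1 (... (act Phi_m t_m x))]. *)
Lemma orbit_param n (X : point K n -> Prop) x m (W : 'M[K]_(m, n)) : X x ->
  (forall i, orbit_vec X x (row i W)) ->
  exists phi : n.-tuple {mpoly K[m]},
    [/\ forall t, reach X x (mpmap phi t), mpmap phi (fun _ => 0) = x
      & jac phi (fun _ => 0) = W].
Proof.
move=> Xx; elim: m W => [|m IH] W WO.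
  exists [tuple (x i)%:MP | i < n].
  have E t : mpmap [tuple (x i)%:MP_[0] | i < n] t = x.
    by apply: functional_extensionality => i; rewrite /mpmap tnth_mktuple mevalC.
  split=> [t||]; rewrite ?E //; first exact: reach_refl.
  by apply/matrixP; case.
have [|phi [phiX phi0 phiJ]] := IH (\matrix_(i, j) W (lift 0 i) j).
  by move=> i; have := WO (lift 0 i); congr (orbit_vec _ _ _); apply/rowP=> j; rewrite !mxE.
have [Phi PhiG E0] := WO 0.
pose inner : n.+1.-tuple {mpoly K[m.+1]} := [tuple if unlift ord0 i is Some j
  then tnth phi j \mPo [tuple 'X_(lift ord0 l) | l < m] else 'X_ord0 | i < n.+1].
pose inner0 : n.+1.-tuple {mpoly K[m]} := [tuple if unlift ord0 i is Some j
  then tnth phi j else 0 | i < n.+1].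
have shiftE (t : 'I_m.+1 -> K) : mpmap [tuple 'X_(lift ord0 l) | l < m] t =1 fun l => t (lift ord0 l).
  by move=> l; rewrite /mpmap tnth_mktuple mevalXU.
have innerE t : mpmap inner t = ext (t ord0) (mpmap phi (fun l => t (lift ord0 l))).
  apply: functional_extensionality => i; rewrite /mpmap tnth_mktuple /ext.
  case: unlift => [j|]; last by rewrite mevalXU.
  by rewrite meval_comp; apply: meval_eq (shiftE t).
have inner0E t : mpmap inner0 t = ext 0 (mpmap phi t).
  apply: functional_extensionality => i; rewrite /mpmap tnth_mktuple /ext.
  by case: unlift => [j|]; rewrite ?meval0.
(* [Phi] at time 0 is the identity only on [X], but [phi] takes its values in [X], so this is an
   identity of polynomial maps and can be differentiated. *)
have id0 : pmcomp Phi inner0 = phi.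
  apply: mpmap_eq => t i; rewrite mpmap_pmcomp inner0E -act_mpmap (act0 PhiG) //.
  exact: reachX (phiX t).
exists (pmcomp Phi inner); split.
- by move=> t; rewrite mpmap_pmcompE innerE -act_mpmap; apply: reach_act.
- by rewrite mpmap_pmcompE innerE -act_mpmap phi0 (act0 PhiG).
apply/matrixP=> l i; rewrite jac_pmcomp innerE phi0 mxE big_ord_recl.
have Dinner j a : ((tnth inner (lift ord0 j))^`M(a)).@[fun _ => 0] =
    if unlift ord0 a is Some b then (jac phi (fun _ => 0)) b j else 0.
  rewrite tnth_mktuple liftK mderiv_comp raddf_sum /=.
  case: unliftP => [b ->|->].
    rewrite (bigD1 b) //= big1 ?addr0 => [|c cb]; rewrite mevalM tnth_mktuple mderivXU mevalC.
      by rewrite eqxx mulr1 meval_comp mxE; apply: meval_eq => u; rewrite shiftE.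
    by rewrite (inj_eq (@lift_inj _ _)) (negbTE cb) mulr0.
  by rewrite big1 // => c _; rewrite mevalM tnth_mktuple mderivXU mevalC eq_sym (negbTE (neq_lift _ _)) mulr0.
have Dinner0 a : ((tnth inner ord0)^`M(a)).@[fun _ => 0] = (ord0 == a)%:R.
  by rewrite tnth_mktuple unlift_none mderivXU mevalC.
have jacE a j : jac inner (fun _ => 0) a j = ((tnth inner j)^`M(a)).@[fun _ => 0] by rewrite mxE.
case: (unliftP ord0 l) => [a ->|->].
  rewrite jacE Dinner0 (negbTE (neq_lift _ _)) mul0r add0r.
  have := congr1 (fun M : 'M_(_, _) => M a i) phiJ; rewrite -{1}id0 jac_pmcomp inner0E phi0 !mxE big_ord_recl => <-.
  rewrite !mxE tnth_mktuple unlift_none mderiv0 meval0 mul0r add0r.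
  by apply: eq_bigr => j _; rewrite jacE Dinner liftK !mxE tnth_mktuple liftK.
rewrite jacE Dinner0 eqxx mul1r big1 ?addr0 => [|j _]; last by rewrite jacE Dinner unlift_none mul0r.
by have := congr1 (fun M : 'M_(_, _) => M 0 i) E0; rewrite !mxE => ->.
Qed.

Lemma orbit_vec_span n (X : point K n -> Prop) x d (M : 'M[K]_(d, n)) :
  (forall v : 'rV_n, (v <= M)%MS -> exists m (W : 'M[K]_(m, n)), (forall i, orbit_vec X x (row i W)) /\ (v <= W)%MS) ->
  exists m (W : 'M[K]_(m, n)), (forall i, orbit_vec X x (row i W)) /\ (M <= W)%MS.
Proof.
move=> H; suff [m [W [WO WM]]] : exists m (W : 'M[K]_(m, n)), (forall i, orbit_vec X x (row i W)) /\
    forall i, i \in enum 'I_d -> (row i M <= W)%MS.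
  by exists m, W; split=> //; apply/row_subP=> i; apply: WM; rewrite mem_enum.
elim: (enum 'I_d) => [|i s [m [W [WO WM]]]]; first by exists 0%N, 0; split=> [[]|].
have [m' [W' [WO' WM']]] := H _ (row_sub i M).
exists (m' + m)%N, (col_mx W' W); split=> [j|j].
  by case: (split_ordP j) => a ->; rewrite ?rowKu ?rowKd.
rewrite -addsmxE inE => /orP[/eqP->|/WM]; first exact: submx_trans (addsmxSl _ _).
by move/submx_trans; apply; apply: addsmxSr.
Qed.

(** The spanning orbit vectors may outnumber the dimension [d]. Writing [M = C W] and precomposing
    with the linear map [C] leaves [d] parameters and the Jacobian [M]. *)
Lemma flexible_param n (X : point K n -> Prop) x d (M : 'M[K]_(d, n)) : X x ->
  flexible_point X x -> tangent_basis X x M ->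
  exists2 phi, parametrization X x phi &
    jac phi (fun _ => 0) = M /\ forall t, reach X x (mpmap phi t).
Proof.
move=> Xx /(flexible_pointP Xx) fl [MF MT].
have [|m [W [WO /submxP[C ME]]]] := @orbit_vec_span n X x d M; first by move=> v /MT/fl.
have [phi [phiR phi0 phiJ]] := orbit_param Xx WO.
exists (pmcomp phi (lin C)); last first.
  split=> [|t]; last by rewrite mpmap_pmcompE.
  by rewrite jac_pmcomp jac_lin mpmap_origin_lin phiJ -ME.
split=> [t||].
- by rewrite mpmap_pmcompE; apply: reachX (phiR _).
- by rewrite mpmap_pmcompE mpmap_origin_lin.
by rewrite jac_pmcomp jac_lin mpmap_origin_lin phiJ -ME.
Qed.

Lemma tangent_vec_jac n (X : point K n -> Prop) r (phi : n.-tuple {mpoly K[r]}) t c :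
  (forall t, X (mpmap phi t)) -> tangent_vec X (mpmap phi t) (c *m jac phi t).
Proof.
move=> phiX p pX; rewrite -dderiv_comp; have -> : p \mPo phi = 0.
  by apply: mpoly_eval_eq0 => s; rewrite meval_comp pX ?meval0.
by rewrite -mpolyC0 dderivC.
Qed.

End Tangents.

(** * The coordinate ring and the tangent spaces of a suspension *)

Section SuspensionGeometry.
Variables (K : closedFieldType) (n : nat).
Implicit Types (Y : point K n -> Prop) (f : {mpoly K[n]}).

Local Notation iu := (ord0 : 'I_n.+2).
Local Notation iv := (lift ord0 ord0 : 'I_n.+2).
Local Notation iy := (fun i : 'I_n => lift ord0 (lift ord0 i) : 'I_n.+2).
Local Notation pu := ('X_iu : {mpoly K[n.+2]}).
Local Notation pv := ('X_iv : {mpoly K[n.+2]}).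

Definition susp_pt (u v : K) (y : point K n) : point K n.+2 := ext u (ext v y).

Lemma susp_pt_u u v y : susp_pt u v y iu = u.
Proof. by rewrite /susp_pt /ext unlift_none. Qed.

Lemma susp_pt_v u v y : susp_pt u v y iv = v.
Proof. by rewrite /susp_pt /ext liftK unlift_none. Qed.

Lemma susp_pt_y u v y : susp_y (susp_pt u v y) = y.
Proof. by apply: functional_extensionality => i; rewrite /susp_y /susp_pt /ext !liftK. Qed.

Lemma susp_index (i : 'I_n.+2) : [\/ i = iu, i = iv | exists j, i = iy j].
Proof.
case: (unliftP ord0 i) => [j ->|->]; last by constructor 1.
by case: (unliftP ord0 j) => [l ->|->]; [constructor 3; exists l | constructor 2].
Qed.

Lemma susp_ptE z : z = susp_pt (z iu) (z iv) (susp_y z).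
Proof.
apply: functional_extensionality => i; have [->|->|[j ->]] := susp_index i.
- by rewrite susp_pt_u.
- by rewrite susp_pt_v.
by rewrite /susp_pt /ext !liftK.
Qed.

Lemma SuspE Y f u v y : Susp Y f (susp_pt u v y) <-> Y y /\ u * v = f.@[y].
Proof. by rewrite /Susp susp_pt_y susp_pt_u susp_pt_v. Qed.

Definition ytuple : n.-tuple {mpoly K[n.+2]} := [tuple 'X_(iy i) | i < n].
Definition ypoly : {mpoly K[n]} -> {mpoly K[n.+2]} := comp_mpoly ytuple.
HB.instance Definition _ := GRing.RMorphism.on ypoly.

Lemma mpmap_ytuple z : mpmap ytuple z = susp_y z.
Proof. by apply: functional_extensionality => i; rewrite /mpmap tnth_mktuple mevalXU. Qed.

Lemma meval_ypoly p z : (ypoly p).@[z] = p.@[susp_y z].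
Proof. by rewrite meval_comp mpmap_ytuple. Qed.

Definition upoly (P : {poly {mpoly K[n]}}) : {mpoly K[n.+2]} := (map_poly ypoly P).[pu].
Definition vpoly (P : {poly {mpoly K[n]}}) : {mpoly K[n.+2]} := (map_poly ypoly P).[pv].

Lemma horner_ypoly (P : {poly {mpoly K[n]}}) q z :
  ((map_poly ypoly P).[q]).@[z] = (map_poly (meval (susp_y z)) P).[q.@[z]].
Proof.
elim/poly_ind: P => [|P c IH]; first by rewrite !rmorph0 !horner0 meval0.
rewrite !rmorphD !rmorphM /= !hornerD !hornerM mevalD mevalM IH.
by rewrite !map_polyX !map_polyC !hornerX !hornerC /= meval_ypoly.
Qed.

Lemma mpoly_mulX_ind m (P : {mpoly K[m]} -> Prop) :
  P 1 -> (forall c p, P p -> P (c *: p)) -> (forall p q, P p -> P q -> P (p + q)) ->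
  (forall i p, P p -> P ('X_i * p)) -> forall p, P p.
Proof.
move=> P1 PZ PD PX; elim/mpolyind => [|c u p _ _ Pp].
  by rewrite -(scale0r 1); apply: PZ.
apply: (PD) => //; apply: PZ; rewrite mpolyXE_id.
elim: (index_enum _) => [|i s IH]; first by rewrite big_nil.
rewrite big_cons; elim: (u i) => [|k IHk]; first by rewrite expr0 mul1r.
by rewrite exprS -mulrA; apply: PX.
Qed.

Lemma susp_decomposition f p : exists h P Q,
  p = (pu * pv - ypoly f) * h + upoly P + pv * vpoly Q.
Proof.
have uX (P : {poly {mpoly K[n]}}) c : upoly (P * 'X + c%:P) = upoly P * pu + ypoly c.
  by rewrite /upoly rmorphD rmorphM /= hornerD hornerM map_polyX map_polyC hornerX hornerC.
have vX (P : {poly {mpoly K[n]}}) c : vpoly (P * 'X + c%:P) = vpoly P * pv + ypoly c.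
  by rewrite /vpoly rmorphD rmorphM /= hornerD hornerM map_polyX map_polyC hornerX hornerC.
have uD (P Q : {poly {mpoly K[n]}}) : upoly (P + Q) = upoly P + upoly Q.
  by rewrite /upoly rmorphD hornerD.
have vD (P Q : {poly {mpoly K[n]}}) : vpoly (P + Q) = vpoly P + vpoly Q.
  by rewrite /vpoly rmorphD hornerD.
have uZ (P : {poly {mpoly K[n]}}) c : upoly (c *: P) = ypoly c * upoly P.
  by rewrite /upoly map_polyZ hornerZ.
have vZ (P : {poly {mpoly K[n]}}) c : vpoly (c *: P) = ypoly c * vpoly P.
  by rewrite /vpoly map_polyZ hornerZ.
elim/mpoly_mulX_ind: p => [|c p [h [P [Q ->]]]|p q [h [P [Q ->]]] [h' [P' [Q' ->]]]|i p [h [P [Q ->]]]].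
- exists 0, 1, 0; rewrite /upoly /vpoly rmorph1 rmorph0 hornerC horner0.
  by rewrite !mulr0 add0r addr0.
- exists (c *: h), (c%:MP *: P), (c%:MP *: Q); rewrite uZ vZ /ypoly comp_mpolyC -!mul_mpolyC.
  move: (upoly P) (vpoly Q) (comp_mpoly _ f) (c%:MP) => A B F C; ring.
- exists (h + h'), (P + P'), (Q + Q'); rewrite uD vD.
  move: (upoly P) (vpoly Q) (upoly P') (vpoly Q') (ypoly f) => A B A' B' F; ring.
have [->|->|[j ->]] := susp_index i.
(* In [u v Q] the product [uv] is replaced by [f]; the constant term of [f Q] joins the [u]-part and
   the rest stays in the [v]-part. Multiplication by [v] is symmetric. *)
- have [Q1 EQ] := poly_split_const Q.
  have EQv : vpoly Q = vpoly Q1 * pv + ypoly Q`_0 by rewrite {1}EQ vX.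
  exists (pu * h + vpoly Q), (P * 'X + (f * Q`_0)%:P), (f *: Q1).
  rewrite uX vZ (_ : ypoly (f * Q`_0) = ypoly f * ypoly Q`_0) ?EQv; last exact: rmorphM.
  move: (upoly P) (vpoly Q1) (ypoly f) (ypoly Q`_0) => A B F C; ring.
- have [P1 EP] := poly_split_const P.
  have EPu : upoly P = upoly P1 * pu + ypoly P`_0 by rewrite {1}EP uX.
  exists (pv * h + upoly P1), (f *: P1), (Q * 'X + (P`_0)%:P).
  rewrite vX uZ EPu.
  move: (vpoly Q) (upoly P1) (ypoly f) (ypoly P`_0) => A B F C; ring.
exists ('X_(iy j) * h), ('X_j *: P), ('X_j *: Q).
have E : ypoly 'X_j = 'X_(iy j) by rewrite /ypoly comp_mpolyXU -tnth_nth tnth_mktuple.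
rewrite uZ vZ E; move: (vpoly Q) (upoly P) (ypoly f) ('X_(iy j)) => A B F C; ring.
Qed.

Variables (Y : point K n -> Prop) (f : {mpoly K[n]}).
Hypothesis Yirr : irreducible_var Y.
Hypothesis f0 : ~ eqX Y f 0.
Local Notation X := (Susp Y f).

Lemma poly_eq0_nonzero (p : {poly K}) : (forall u, u != 0 -> p.[u] = 0) -> p = 0.
Proof.
move=> H; suff /eqP : p * 'X = 0 by rewrite mulf_eq0 polyX_eq0 orbF => /eqP.
apply/eqP; apply: contraT => /closed_nonrootP[u]; rewrite rootE hornerM hornerX.
by case: (eqVneq u 0) => [->|/H ->]; rewrite ?mulr0 ?mul0r eqxx.
Qed.

(** On the chart [u != 0], where [v = f / u], multiplication by [u ^ N] gives a polynomial in [u]: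
    the coefficients of [P] fill the degrees from [N] on, and the [Q_i f ^ (i + 1)] fill those
    below. The powers of [f] cancel because [Y] is irreducible. *)
Lemma susp_decomposition_unique (P Q : {poly {mpoly K[n]}}) :
  (forall y u, Y y -> u != 0 -> (upoly P + pv * vpoly Q).@[susp_pt u (f.@[y] / u) y] = 0) ->
  (forall i, eqX Y P`_i 0) /\ (forall i, eqX Y Q`_i 0).
Proof.
move=> H; pose N := size Q.
have E y : Y y -> map_poly (meval y) P * 'X^N +
    \poly_(i < N) ((Q`_(N - i.+1)).@[y] * f.@[y] ^+ (N - i)) = 0.
  move=> Yy; apply: poly_eq0_nonzero => u u0; have := H y u Yy u0.
  rewrite mevalD mevalM !horner_ypoly !mevalXU susp_pt_y susp_pt_u susp_pt_v => /(congr1 (fun x => x * u ^+ N)).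
  rewrite mul0r mulrDl => E; rewrite hornerD hornerM hornerXn -[RHS]E; congr (_ + _).
  rewrite horner_poly (@horner_coef_wide _ N); last exact: size_poly.
  rewrite big_distrr big_distrl /= (reindex_inj rev_ord_inj) /=.
  apply: eq_bigr => i _; have iN : (i < N)%N := ltn_ord i.
  have E1 : (N - (N - i.+1).+1 = i)%N by lia.
  have E2 : (N - (N - i.+1) = i.+1)%N by lia.
  have E3 : u ^+ N = u ^+ (N - i.+1) * u ^+ i.+1 by rewrite -exprD subnK.
  rewrite E1 E2 E3 coef_map /= expr_div_n !exprS.
  have ui : u ^+ i != 0 by rewrite expf_neq0.
  by field; rewrite u0 ui.
split=> i y Yy; rewrite meval0.
  have := congr1 (fun p : {poly K} => p`_(i + N)) (E y Yy).
  by rewrite coefD coefMXn coef_map coef_poly coef0 ltnNge leq_addl addnK addr0.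
case: (ltnP i N) => [lt|le]; last by rewrite nth_default // meval0.
suff : eqX Y (Q`_i * f ^+ i.+1) 0.
  case/(irreducible_domain Yirr) => [/(_ y Yy)|]; first by rewrite meval0.
  elim: i.+1 => [/(_ y Yy)/eqP|k IH]; first by rewrite expr0 meval1 meval0 oner_eq0.
  by rewrite exprS => /(irreducible_domain Yirr)[/f0//|].
move=> z Yz; have := congr1 (fun p : {poly K} => p`_(N - i.+1)) (E z Yz).
have lt' : (N - i.+1 < N)%N by lia.
have E1 : (N - (N - i.+1).+1 = i)%N by lia.
have E2 : (N - (N - i.+1) = i.+1)%N by lia.
by rewrite coefD coefMXn lt' add0r coef_poly lt' coef0 mevalM rmorphXn meval0 /= E1 E2.
Qed.

(** The chart [u != 0] is dense in the suspension, whose ideal is generated by [uv - f] and the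
    ideal of [Y]. *)
Lemma susp_ideal p :
  (forall y u, Y y -> u != 0 -> p.@[susp_pt u (f.@[y] / u) y] = 0) ->
  exists h P Q, [/\ p = (pu * pv - ypoly f) * h + upoly P + pv * vpoly Q,
    forall i, eqX Y P`_i 0 & forall i, eqX Y Q`_i 0].
Proof.
move=> H; have [h [P [Q E]]] := susp_decomposition f p; exists h, P, Q.
have [|HP HQ] := @susp_decomposition_unique P Q; last by split.
move=> y u Yy u0; rewrite -[RHS](H y u Yy u0) E -addrA [in RHS]mevalD [in RHS]mevalM.
by rewrite mevalB mevalM !mevalXU meval_ypoly susp_pt_y susp_pt_u susp_pt_v [u * _]mulrC divfK // subrr mul0r add0r.
Qed.

Lemma susp_zclosed : zclosed X.
Proof.
have [[S YS] _] := Yirr.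
exists (fun p => p = pu * pv - ypoly f \/ exists2 q, S q & p = ypoly q) => z; split.
  move=> [/YS Yz Ez] p [->|[q Sq ->]].
    by rewrite mevalB mevalM !mevalXU meval_ypoly Ez subrr.
  by rewrite meval_ypoly Yz.
move=> H; split; first by apply/YS => q Sq; rewrite -meval_ypoly; apply: H; right; exists q.
have /eqP := H _ (or_introl erefl).
by rewrite mevalB mevalM !mevalXU meval_ypoly subr_eq0 => /eqP.
Qed.

Lemma upoly_coef0 (P : {poly {mpoly K[n]}}) q z : (forall i, eqX Y P`_i 0) -> Y (susp_y z) ->
  ((map_poly ypoly P).[q]).@[z] = 0.
Proof.
move=> HP Yz; rewrite horner_ypoly (_ : map_poly _ P = 0) ?horner0 //.
by apply/polyP=> i; rewrite coef_map coef0 /= HP // meval0.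
Qed.

Lemma susp_eqX0 p :
  (forall y u, Y y -> u != 0 -> p.@[susp_pt u (f.@[y] / u) y] = 0) -> eqX X p 0.
Proof.
move=> /susp_ideal[h [P [Q [-> HP HQ]]]] z [Yz Ez]; rewrite !mevalD !mevalM !upoly_coef0 //.
by rewrite mevalB mevalM !mevalXU meval_ypoly Ez subrr !mul0r mulr0 !addr0 meval0.
Qed.

Lemma susp_laurent p y : exists N (q : {poly K}), forall u : K, u != 0 ->
  q.[u] = u ^+ N * p.@[susp_pt u (f.@[y] / u) y].
Proof.
elim/mpoly_ring_ind: p => [c|i|p q [N [P IHp]] [M [Q IHq]]|p q [N [P IHp]] [M [Q IHq]]].
- by exists 0%N, c%:P => u _; rewrite mevalC hornerC mul1r.
- have [->|->|[j ->]] := susp_index i.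
  + by exists 0%N, 'X => u _; rewrite mevalXU susp_pt_u hornerX mul1r.
  + by exists 1%N, (f.@[y])%:P => u u0; rewrite mevalXU susp_pt_v hornerC expr1 mulrC divfK.
  exists 0%N, (y j)%:P => u _; rewrite mevalXU hornerC mul1r.
  by rewrite -[in LHS](susp_pt_y u (f.@[y] / u) y).
- exists (N + M)%N, (P * 'X^M + Q * 'X^N) => u u0.
  by rewrite hornerD !hornerM !hornerXn IHp // IHq // mevalD exprD; ring.
exists (N + M)%N, (P * Q) => u u0.
by rewrite hornerM IHp // IHq // mevalM exprD; ring.
Qed.

(** Each slice with fixed [u != 0] is a copy of the irreducible [Y], so [a] or [b] vanishes on it.
    If neither vanishes on [X], some [u] off the roots of two nonzero polynomials gives a slice on
    which neither vanishes. *)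
Lemma susp_domain : domainX X.
Proof.
have [_ [[y1 Yy1] _]] := Yirr; split.
  have Xz : X (susp_pt 1 f.@[y1] y1) by apply/SuspE; rewrite mul1r.
  by move=> /(_ _ Xz)/eqP; rewrite meval1 meval0 oner_eq0.
move=> a b ab; pose pos p u := p \mPo [tuple (if unlift ord0 i is Some j then
   if unlift ord0 j is Some l then 'X_l else u^-1 *: f else u%:MP) | i < n.+2].
have posE p u y : (pos p u).@[y] = p.@[susp_pt u (f.@[y] / u) y].
  rewrite meval_comp; apply: meval_eq => i; rewrite /mpmap tnth_mktuple /susp_pt /ext.
  case: unlift => [j|]; last by rewrite mevalC.
  by case: unlift => [l|]; rewrite ?mevalXU // mevalZ mulrC.
have posM u : u != 0 -> eqX Y (pos a u) 0 \/ eqX Y (pos b u) 0.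
  move=> u0; apply: (irreducible_domain Yirr) => y Yy; rewrite meval0 mevalM !posE -mevalM ab ?meval0 //.
  by apply/SuspE; rewrite mulrC divfK.
case: (classic (eqX X a 0)) => [|na]; first by left.
case: (classic (eqX X b 0)) => [|nb]; first by right.
have {na} [ya [va [Yya va0 na]]] : exists y u, [/\ Y y, u != 0 & (pos a u).@[y] != 0].
  apply: NNPP => H; apply: na; apply: susp_eqX0 => y u Yy u0; rewrite -posE.
  by apply/eqP; apply: contraT => nz; case: H; exists y, u.
have {nb} [yb [vb [Yyb vb0 nb]]] : exists y u, [/\ Y y, u != 0 & (pos b u).@[y] != 0].
  apply: NNPP => H; apply: nb; apply: susp_eqX0 => y u Yy u0; rewrite -posE.
  by apply/eqP; apply: contraT => nz; case: H; exists y, u.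
have [N [qa Ha]] := susp_laurent a ya; have [M [qb Hb]] := susp_laurent b yb.
have qa0 : qa != 0.
  apply: contraNneq na => qa0; have := Ha _ va0; rewrite qa0 horner0 => /esym/eqP.
  by rewrite mulf_eq0 expf_eq0 (negbTE va0) andbF posE.
have qb0 : qb != 0.
  apply: contraNneq nb => qb0; have := Hb _ vb0; rewrite qb0 horner0 => /esym/eqP.
  by rewrite mulf_eq0 expf_eq0 (negbTE vb0) andbF posE.
have /closed_nonrootP[u] : qa * qb * 'X != 0 by rewrite !mulf_neq0 ?polyX_eq0.
rewrite rootE !hornerM hornerX !mulf_eq0 !negb_or => /andP[/andP[ra rb] u0].
case: (posM u u0) => [/(_ ya Yya)|/(_ yb Yyb)]; rewrite meval0 posE => E.
  by move: ra; rewrite Ha // E mulr0 eqxx.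
by move: rb; rewrite Hb // E mulr0 eqxx.
Qed.
End SuspensionGeometry.

(** * Transport of flexibility by automorphisms *)

Section Transport.
Variable K : closedFieldType.

Definition automorphism n (X : point K n -> Prop) (g h : n.-tuple {mpoly K[n]}) :=
  forall x, X x -> [/\ X (mpmap g x), X (mpmap h x), mpmap h (mpmap g x) = x
    & mpmap g (mpmap h x) = x].

Definition act_at n (Phi : n.-tuple {mpoly K[n.+1]}) (t : K) : n.-tuple {mpoly K[n]} :=
  pmcomp Phi [tuple if unlift ord0 i is Some j then 'X_j else t%:MP | i < n.+1].

Lemma mpmap_act_at n (Phi : n.-tuple {mpoly K[n.+1]}) t x : mpmap (act_at Phi t) x = act Phi t x.
Proof.
rewrite mpmap_pmcompE act_mpmap; congr mpmap; apply: functional_extensionality => i.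
by rewrite /mpmap tnth_mktuple /ext; case: unlift => [j|]; rewrite ?mevalXU ?mevalC.
Qed.

Lemma act_automorphism n (X : point K n -> Prop) Phi t : Ga_action X Phi ->
  automorphism X (act_at Phi t) (act_at Phi (- t)).
Proof.
move=> PhiG x Xx; rewrite !mpmap_act_at; split.
- exact: (actX t PhiG Xx).
- exact: (actX (- t) PhiG Xx).
- by rewrite -(actD _ _ PhiG) // addNr (act0 PhiG).
by rewrite -(actD _ _ PhiG) // addrN (act0 PhiG).
Qed.

(** The vector is the velocity of the conjugate action [h o Phi_t o g]. *)
Lemma conj_action n (X : point K n -> Prop) g h x v : automorphism X g h -> X x ->
  orbit_vec X (mpmap g x) v -> orbit_vec X x (v *m jac h (mpmap g x)).
Proof.
move=> gh Xx [Phi PhiG ->].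
pose inner : n.+1.-tuple {mpoly K[n.+1]} := [tuple if unlift ord0 i is Some j
  then tnth g j \mPo [tuple 'X_(lift ord0 l) | l < n] else 'X_ord0 | i < n.+1].
have innerE t y : mpmap inner (ext t y) = ext t (mpmap g y).
  apply: functional_extensionality => i; rewrite /mpmap tnth_mktuple {2}/ext.
  case: unlift => [j|]; last by rewrite mevalXU /ext unlift_none.
  by rewrite meval_comp; apply: meval_eq => l; rewrite /mpmap tnth_mktuple mevalXU /ext liftK.
have actE t y : act (pmcomp h (pmcomp Phi inner)) t y = mpmap h (act Phi t (mpmap g y)).
  by rewrite act_mpmap !mpmap_pmcompE innerE.
exists (pmcomp h (pmcomp Phi inner)).
  split=> [t y Xy|]; first by rewrite actE; have [Xg _ _ _] := gh y Xy; have [] := gh _ (actX t PhiG Xg).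
  split=> [y Xy i|s t y Xy i]; have [Xg _ hg _] := gh y Xy.
    by rewrite actE (act0 PhiG) // hg.
  rewrite !actE; have [_ _ _ ->] := gh _ (actX t PhiG Xg).
  by rewrite (actD _ _ PhiG).
apply/rowP=> i; rewrite !mxE tnth_mktuple mderiv_comp raddf_sum /=; apply: eq_bigr => j _.
have [Xg _ _ _] := gh x Xx.
rewrite mevalM meval_comp mpmap_pmcompE innerE -act_mpmap (act0 PhiG) // !mxE mulrC; congr (_ * _).
rewrite tnth_mktuple mderiv_comp big_ord_recl [X in _ + X]big1 ?addr0 => [|l _].
  by rewrite mevalM meval_comp innerE tnth_mktuple unlift_none mderivXU eqxx mevalC mulr1.
rewrite tnth_mktuple liftK mderiv_comp big1 ?mulr0 // => a _.
by rewrite tnth_mktuple mderivXU eq_sym (negbTE (neq_lift _ _)) mulr0.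
Qed.

Lemma flexible_point_transport n (X : point K n -> Prop) g h x : automorphism X g h -> X x ->
  flexible_point X (mpmap g x) -> flexible_point X x.
Proof.
move=> gh Xx fl; have [Xg _ _ _] := gh x Xx; apply/(flexible_pointP Xx) => v vT.
have vgT : tangent_vec X (mpmap g x) (v *m jac g x).
  move=> p pX; rewrite -dderiv_comp; apply: vT => y Xy; rewrite meval_comp pX ?meval0 //.
  by have [] := gh y Xy.
have [m [W [WO WM]]] := proj1 (flexible_pointP Xg) fl _ vgT.
exists m, (W *m jac h (mpmap g x)); split=> [i|]; first by rewrite row_mul; apply: conj_action.
(* [h o g] is the identity on [X] only, so the product of the Jacobians fixes tangent vectors but
   need not be the identity matrix. *)
suff -> : v = v *m jac g x *m jac h (mpmap g x) by apply: submxMr.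
apply/rowP=> i; rewrite -[LHS](dderivXU x) -[RHS](dderivXU (mpmap (pmcomp h g) x)).
rewrite -mulmxA -jac_pmcomp -dderiv_comp; apply/eqP; rewrite -subr_eq0 -dderivB; apply/eqP; apply: vT => y Xy.
rewrite mevalB meval_comp mpmap_pmcompE; have [_ _ -> _] := gh y Xy.
by rewrite subrr meval0.
Qed.

Lemma flexible_point_reach n (X : point K n -> Prop) x y : X x -> reach X x y ->
  flexible_point X y -> flexible_point X x.
Proof.
move=> Xx; elim=> // Phi t z PhiG xz IH fl; apply: IH.
apply: (flexible_point_transport (act_automorphism t PhiG) (reachX Xx xz)).
by rewrite mpmap_act_at.
Qed.
End Transport.

(** * Tangent spaces of the suspension and of the zero locus *)

Section SuspensionTangent.
Variables (K : closedFieldType) (n : nat) (Y : point K n -> Prop) (f : {mpoly K[n]}).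
Hypothesis Yirr : irreducible_var Y.
Hypothesis f0 : ~ eqX Y f 0.
Local Notation X := (Susp Y f).
Local Notation iu := (ord0 : 'I_n.+2).
Local Notation iv := (lift ord0 ord0 : 'I_n.+2).
Local Notation iy := (fun i : 'I_n => lift ord0 (lift ord0 i) : 'I_n.+2).

Definition yvec (v : 'rV[K]_n.+2) : 'rV[K]_n := \row_j v 0 (iy j).

Definition susp_vec (a b : K) (w : 'rV[K]_n) : 'rV[K]_n.+2 :=
  \row_i susp_pt a b (fun j => w 0 j) i.

Lemma susp_vec_u a b w : susp_vec a b w 0 iu = a. Proof. by rewrite mxE susp_pt_u. Qed.
Lemma susp_vec_v a b w : susp_vec a b w 0 iv = b. Proof. by rewrite mxE susp_pt_v. Qed.
Lemma yvec_susp_vec a b w : yvec (susp_vec a b w) = w.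
Proof. by apply/rowP=> j; rewrite !mxE /susp_pt /ext !liftK. Qed.
Lemma mul_jac_ytuple m (V : 'M[K]_(m, n.+2)) z : V *m jac (ytuple K n) z = \matrix_(i, j) V i (iy j).
Proof.
apply/matrixP=> i j; rewrite !mxE (bigD1 (iy j)) //= big1 ?addr0 => [|l lj]; rewrite mxE tnth_mktuple mderivXU mevalC.
  by rewrite eqxx mulr1.
by rewrite eq_sym (negbTE lj) mulr0.
Qed.

Lemma dderiv_ypoly p z v : dderiv (ypoly p) z v = dderiv p (susp_y z) (yvec v).
Proof.
rewrite dderiv_comp mpmap_ytuple mul_jac_ytuple; congr dderiv.
by apply/rowP=> j; rewrite !mxE.
Qed.

Lemma dderiv_upoly (P : {poly {mpoly K[n]}}) q z v : Y (susp_y z) ->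
  tangent_vec Y (susp_y z) (yvec v) -> (forall i, eqX Y P`_i 0) ->
  dderiv (map_poly (@ypoly K n) P).[q] z v = 0.
Proof.
move=> Yz vT; elim/poly_ind: P => [|P c IH] HP.
  by rewrite rmorph0 horner0 -mpolyC0 dderivC.
have HP' i : eqX Y P`_i 0.
  by have := HP i.+1; rewrite coefD coefMX coefC /= addr0.
have Hc : eqX Y c 0 by have := HP 0%N; rewrite coefD coefMX coefC /= add0r.
rewrite rmorphD rmorphM /= hornerD hornerM map_polyX map_polyC hornerX hornerC /=.
by rewrite dderivD dderivM IH // (upoly_coef0 _ HP') // mul0r mulr0 !add0r dderiv_ypoly vT.
Qed.

Lemma susp_tangentE z (v : 'rV[K]_n.+2) : X z -> tangent_vec X z v <->
  tangent_vec Y (susp_y z) (yvec v) /\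
  z iv * v 0 iu + z iu * v 0 iv = dderiv f (susp_y z) (yvec v).
Proof.
move=> [Yz Ez]; have dF : dderiv ('X_iu * 'X_iv - ypoly f) z v =
    z iv * v 0 iu + z iu * v 0 iv - dderiv f (susp_y z) (yvec v).
  by rewrite dderivB dderivM dderiv_ypoly !dderivXU !mevalXU addrC; ring.
split=> [vT|[wT E] p pX].
  split=> [p pY|].
    by rewrite -dderiv_ypoly; apply: vT => x [Yx _]; rewrite meval_ypoly pY // !meval0.
  apply/eqP; rewrite -subr_eq0 -dF; apply/eqP/vT => x [_ Ex].
  by rewrite mevalB mevalM !mevalXU meval_ypoly Ex subrr meval0.
have [|h [P [Q [-> HP HQ]]]] := @susp_ideal _ _ _ _ Yirr f0 p.
  by move=> y u Yy u0; rewrite pX ?meval0 //; apply/SuspE; split=> //; rewrite mulrC divfK.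
rewrite !dderivD !dderivM !dderiv_upoly // dF E subrr (upoly_coef0 _ HQ) //.
by rewrite mevalB mevalM !mevalXU meval_ypoly Ez subrr !mul0r !mulr0 !addr0.
Qed.

Definition susp_block d (M : 'M[K]_(d, n)) : 'M[K]_(2 + d, 2 + n) := block_mx 1%:M 0 0 M.

Lemma sub_susp_block d (M : 'M[K]_(d, n)) (v : 'rV[K]_n.+2) : (v <= susp_block M)%MS = (yvec v <= M)%MS.
Proof.
have yE : yvec v = rsubmx (v : 'rV_(2 + n)).
  apply/rowP=> j; rewrite !mxE; congr (v _ _); apply: val_inj => //.
rewrite yE; apply/submxP/submxP => [[c ->]|[c E]].
  exists (rsubmx c).
  have -> : c *m susp_block M = row_mx (lsubmx c) (rsubmx c *m M).
    rewrite -[X in X *m _](hsubmxK (c : 'rV_(2 + d))) /susp_block.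
    by rewrite (mul_row_block (lsubmx c) (rsubmx c) 1%:M 0 0 M) mulmx1 !mulmx0 addr0 add0r.
  exact: row_mxKr.
exists (row_mx (lsubmx (v : 'rV_(2 + n))) c).
rewrite /susp_block (mul_row_block (lsubmx (v : 'rV_(2 + n))) c 1%:M 0 0 M).
by rewrite mulmx1 !mulmx0 addr0 add0r -E hsubmxK.
Qed.

(** The boolean [b] tells whether the form [v a + u b - df(w)] is nonzero on the sum of the plane
    and the tangent space of [Y], hence whether the dimension is [d + 1] or [d + 2]. *)
Lemma susp_tangent_basis z d (M : 'M[K]_(d, n)) : X z -> tangent_basis Y (susp_y z) M ->
  exists e (N : 'M[K]_(e, n.+2)) (b : bool), [/\ tangent_basis X z N, d.+2 = (e + b)%N &
    b <-> [\/ z iu != 0, z iv != 0 | exists2 w, tangent_vec Y (susp_y z) w & dderiv f (susp_y z) w != 0]].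
Proof.
move=> Xz [MF MT].
pose l : 'cV[K]_(2 + n) := \col_i susp_pt (z iv) (z iu) (fun j => - (f^`M(j)).@[susp_y z]) i.
have lE (v : 'rV_n.+2) : (v *m l) 0 0 = z iv * v 0 iu + z iu * v 0 iv - dderiv f (susp_y z) (yvec v).
  rewrite mxE !big_ord_recl !mxE susp_pt_u susp_pt_v addrA mulrC [v 0 iv * _]mulrC; congr (_ + _).
  rewrite /dderiv -sumrN; apply: eq_bigr => j _.
  by rewrite !mxE /susp_pt /ext !liftK mulrN.
have BF : row_free (susp_block M).
  by rewrite /row_free /susp_block rank_diag_block_mx mxrank1 (eqP MF).
have [e [N [NF E NE]]] := hyperplane_basis l BF.
exists e, N, (susp_block M *m l != 0); split=> //.
  split=> // v; rewrite NE susp_tangentE // sub_susp_block; split=> [[/MT wT Ev]|[/MT wT Ev]].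
    by split=> //; apply/matrixP=> i j; rewrite !ord1 lE Ev subrr mxE.
  by split=> //; apply/eqP; rewrite -subr_eq0 -lE Ev mxE.
split=> [nz|H].
  have [v vB vl] : exists2 v : 'rV_n.+2, (v <= susp_block M)%MS & (v *m l) 0 0 != 0.
    have [i ni] : exists i, (susp_block M *m l) i 0 != 0.
      apply: NNPP => H; case/eqP: nz; apply/matrixP=> i j; rewrite ord1 [RHS]mxE.
      by apply/eqP; apply: contraT => ?; case: H; exists i.
    exists (row i (susp_block M)); first exact: row_sub.
    by rewrite -row_mul mxE.
  rewrite sub_susp_block in vB; case: (eqVneq (z iu) 0) => [u0|]; last by constructor 1.
  case: (eqVneq (z iv) 0) => [v0|]; last by constructor 2.
  constructor 3; exists (yvec v); first exact/MT.
  by apply: contraNneq vl => E'; rewrite lE u0 v0 E' !mul0r addr0 subr0.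
have sep (v : 'rV_n.+2) : (v <= susp_block M)%MS -> (v *m l) 0 0 != 0 -> susp_block M *m l != 0.
  by move=> /submxP[c ->]; apply: contraNneq => E0; rewrite -mulmxA E0 mulmx0 mxE.
have dd0 : dderiv f (susp_y z) 0 = 0 by rewrite dderivE mul0mx mxE.
case: H => [u0|v0|[w wT dw]].
- apply: (sep (susp_vec 0 1 0)); first by rewrite sub_susp_block yvec_susp_vec sub0mx.
  by rewrite lE yvec_susp_vec susp_vec_u susp_vec_v dd0 mulr0 add0r mulr1 subr0.
- apply: (sep (susp_vec 1 0 0)); first by rewrite sub_susp_block yvec_susp_vec sub0mx.
  by rewrite lE yvec_susp_vec susp_vec_u susp_vec_v dd0 mulr0 addr0 mulr1 subr0.
apply: (sep (susp_vec 0 0 w)); first by rewrite sub_susp_block yvec_susp_vec; apply/MT.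
by rewrite lE yvec_susp_vec susp_vec_u susp_vec_v !mulr0 addr0 sub0r oppr_eq0.
Qed.

Lemma zero_locus_tangent_basis y d (M : 'M[K]_(d, n)) :
  (forall p, eqX (zero_locus Y f) p 0 -> exists h, eqX Y p (f * h)) ->
  zero_locus Y f y -> tangent_basis Y y M ->
  exists e (N : 'M[K]_(e, n)) (b : bool), [/\ tangent_basis (zero_locus Y f) y N, d = (e + b)%N &
    b <-> exists2 w, tangent_vec Y y w & dderiv f y w != 0].
Proof.
move=> ideal [Yy fy] [MF MT]; pose l : 'cV[K]_n := \col_i (f^`M(i)).@[y].
have [e [N [NF E NE]]] := hyperplane_basis l MF.
have lE (v : 'rV_n) : v *m l = 0 <-> dderiv f y v = 0.
  rewrite dderivE; split=> [->|E0]; first by rewrite mxE.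
  by apply/matrixP=> i j; rewrite !ord1 E0 mxE.
exists e, N, (M *m l != 0); split=> //.
  split=> // v; rewrite NE lE; split=> [vT|[/MT vT dv] p pZ].
    split; first by apply/MT => p pY; apply: vT => x [Yx _]; apply: pY.
    by apply: vT => x [_ fx]; rewrite fx meval0.
  have [h ph] := ideal p pZ; have : dderiv (p - f * h) y v = 0.
    by apply: vT => x Yx; rewrite mevalB ph // subrr meval0.
  by rewrite dderivB dderivM fy dv mulr0 mul0r addr0 subr0.
split=> [nz|[w /MT/submxP[c ->] dw]].
  have [i ni] : exists i, (M *m l) i 0 != 0.
    apply: NNPP => H; case/eqP: nz; apply/matrixP=> i j; rewrite ord1 [RHS]mxE.
    by apply/eqP; apply: contraT => ?; case: H; exists i.
  exists (row i M); first exact/MT/row_sub.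
  by rewrite dderivE -row_mul mxE.
by apply: contraNneq dw => E0; rewrite dderivE -mulmxA E0 mulmx0 mxE.
Qed.
End SuspensionTangent.

(** * Additive group actions on a suspension *)

Lemma ext_ord0 (K : closedFieldType) n t (x : point K n) : ext t x ord0 = t.
Proof. by rewrite /ext unlift_none. Qed.

Lemma ext_lift (K : closedFieldType) n t (x : point K n) j : ext t x (lift ord0 j) = x j.
Proof. by rewrite /ext liftK. Qed.

Lemma orbit_vec_tangent (K : closedFieldType) n (X : point K n -> Prop) x w :
  X x -> orbit_vec X x w -> tangent_vec X x w.
Proof.
move=> Xx wO; have [|phi [phiR phi0 phiJ]] := @orbit_param K n X x 1 w Xx.
  by move=> i; rewrite ord1 row_id.
have := @tangent_vec_jac K n X 1 phi (fun _ => 0) 1%:M (fun t => reachX Xx (phiR t)).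
by rewrite phi0 phiJ mul1mx.
Qed.

Section SuspensionLifts.
Variables (K : closedFieldType) (n : nat) (Y : point K n -> Prop) (f : {mpoly K[n]}).
Local Notation X := (Susp Y f).
Local Notation iu := (ord0 : 'I_n.+2).
Local Notation iv := (lift ord0 ord0 : 'I_n.+2).
Local Notation iy := (fun i : 'I_n => lift ord0 (lift ord0 i) : 'I_n.+2).

Definition susp_tuple r (a b : {mpoly K[r]}) (g : n.-tuple {mpoly K[r]}) : n.+2.-tuple {mpoly K[r]} :=
  [tuple if unlift ord0 i is Some j then (if unlift ord0 j is Some l then tnth g l else b) else a | i < n.+2].

Lemma mpmap_susp_tuple r (a b : {mpoly K[r]}) g t :
  mpmap (susp_tuple a b g) t = susp_pt a.@[t] b.@[t] (mpmap g t).
Proof.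
apply: functional_extensionality => i; rewrite /mpmap tnth_mktuple /susp_pt /ext.
by case: unlift => // j; case: unlift.
Qed.

Lemma susp_tuple_u r (a b : {mpoly K[r]}) g : tnth (susp_tuple a b g) iu = a.
Proof. by rewrite tnth_mktuple unlift_none. Qed.
Lemma susp_tuple_v r (a b : {mpoly K[r]}) g : tnth (susp_tuple a b g) iv = b.
Proof. by rewrite tnth_mktuple liftK unlift_none. Qed.
Lemma susp_tuple_y r (a b : {mpoly K[r]}) g j : tnth (susp_tuple a b g) (iy j) = tnth g j.
Proof. by rewrite tnth_mktuple !liftK. Qed.

Lemma divide_first_var m (p : {mpoly K[m.+1]}) : exists q,
  (forall s x, p.@[ext s x] = p.@[ext 0 x] + s * q.@[ext s x]) /\
  forall x, (p^`M(ord0)).@[ext 0 x] = q.@[ext 0 x].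
Proof.
elim/mpoly_mulX_ind: p => [|c p [q [qE qD]]|p q [p' [pE pD]] [q' [qE qD]]|i p [q [qE qD]]].
- by exists 0; split=> *; rewrite ?meval1 ?meval0 ?mulr0 ?addr0 // -mpolyC1 mderivC meval0.
- exists (c *: q); split=> *; rewrite ?mderivZ !mevalZ ?qD // qE; ring.
- exists (p' + q'); split=> *; rewrite ?mderivD !mevalD ?pD ?qD // pE qE; ring.
case: (unliftP ord0 i) => [j ->|->].
  exists ('X_(lift ord0 j) * q); split=> [s x|x].
    by rewrite !mevalM !mevalXU !ext_lift qE; ring.
  rewrite mderivM mderivXU eq_sym (negbTE (neq_lift _ _)) mpolyC0 mul0r add0r !mevalM qD //.
exists p; split=> [s x|x].
  by rewrite !mevalM !mevalXU !ext_ord0 mul0r add0r.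
by rewrite mderivM mderivXU eqxx mpolyC1 mul1r mevalD mevalM mevalXU ext_ord0 mul0r addr0.
Qed.

Definition orbit_row m (Phi : m.-tuple {mpoly K[m.+1]}) x : 'rV[K]_m :=
  \row_i ((tnth Phi i)^`M(ord0)).@[ext 0 x].

Lemma susp_lift Phi : Ga_action Y Phi -> exists Psi (q : K -> point K n -> K),
  [/\ Ga_action X Psi,
      forall t z, act Psi t z =
        susp_pt (z iu) (z iv + t * q (t * z iu) (susp_y z)) (act Phi (t * z iu) (susp_y z)),
      forall y, Y y -> q 0 y = dderiv f y (orbit_row Phi y)
    & forall z, X z -> orbit_row Psi z =
        susp_vec 0 (dderiv f (susp_y z) (orbit_row Phi (susp_y z))) (z iu *: orbit_row Phi (susp_y z))].
Proof.
move=> PhiG; have [Q [QE QD]] := divide_first_var (f \mPo Phi).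
pose zX (i : 'I_n.+2) : {mpoly K[n.+3]} := 'X_(lift ord0 i).
pose inner : n.+1.-tuple {mpoly K[n.+3]} :=
  [tuple if unlift ord0 i is Some j then zX (iy j) else 'X_ord0 * zX iu | i < n.+1].
pose Psi := susp_tuple (zX iu) (zX iv + 'X_ord0 * (Q \mPo inner)) (pmcomp Phi inner).
have zXE i t z : (zX i).@[ext t z] = z i by rewrite mevalXU ext_lift.
have tE t (z : point K n.+2) : ('X_ord0 : {mpoly K[n.+3]}).@[ext t z] = t.
  by rewrite mevalXU ext_ord0.
have innerE t z : mpmap inner (ext t z) = ext (t * z iu) (susp_y z).
  apply: functional_extensionality => i; rewrite /mpmap tnth_mktuple {2}/ext.
  by case: unlift => [j|]; rewrite ?mevalM ?tE ?zXE.
have actE t z : act Psi t z = susp_pt (z iu) (z iv + t * Q.@[ext (t * z iu) (susp_y z)])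
     (act Phi (t * z iu) (susp_y z)).
  by rewrite act_mpmap mpmap_susp_tuple mevalD mevalM meval_comp !zXE tE mpmap_pmcompE !innerE.
have fact s y : Y y -> f.@[act Phi s y] = f.@[y] + s * Q.@[ext s y].
  by move=> Yy; rewrite act_mpmap -meval_comp QE meval_comp -act_mpmap (act0 PhiG).
have q0 y : Y y -> Q.@[ext 0 y] = dderiv f y (orbit_row Phi y).
  by move=> Yy; rewrite -QD -(orbit_tangentE f PhiG).
exists Psi, (fun s y => Q.@[ext s y]); split=> //.
- split=> [t z [Yz Ez]|].
    rewrite actE; apply/SuspE; split; first exact: actX.
    by rewrite fact // -Ez; ring.
  split=> [z [Yz Ez] i|s t z [Yz Ez] i].
    by rewrite actE mul0r mul0r addr0 (act0 PhiG) // -susp_ptE.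
  rewrite !actE susp_pt_y susp_pt_u susp_pt_v [(s + t) * z iu]mulrDl -(actD _ _ PhiG) //.
  congr (susp_pt _ _ _ i); rewrite -addrA; congr (_ + _).
  (* Additivity in the [v]-coordinate follows from expanding [f] along the orbit of [Y] in two ways
     and cancelling [u]; for [u = 0] both sides are evaluated at time 0. *)
  case: (eqVneq (z iu) 0) => [->|u0]; first by rewrite !mulr0 addr0 (act0 PhiG) //; ring.
  have E := fact (s * z iu + t * z iu) _ Yz.
  rewrite (actD _ _ PhiG) // !fact // in E; last exact: actX.
  apply: (mulfI u0); apply: (addrI (f.@[susp_y z])).
  transitivity (f.@[susp_y z] + (s * z iu + t * z iu) * Q.@[ext (s * z iu + t * z iu) (susp_y z)]).
    by ring.
  by rewrite -E; ring.
move=> z [Yz Ez]; apply/rowP=> i; rewrite [LHS]mxE.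
have innerD j : ((tnth inner j)^`M(ord0)).@[ext 0 z] = if j == ord0 then z iu else 0.
  rewrite tnth_mktuple; case: (unliftP ord0 j) => [l ->|->].
    by rewrite mderivXU eq_sym (negbTE (neq_lift _ _)) mevalC eq_sym (negbTE (neq_lift _ _)).
  rewrite eqxx mderivM mderivXU eqxx mderivXU eq_sym (negbTE (neq_lift _ _)).
  by rewrite mpolyC1 mpolyC0 mul1r mulr0 addr0 zXE.
have [->|->|[j ->]] := susp_index i.
- by rewrite susp_tuple_u susp_vec_u mderivXU eq_sym (negbTE (neq_lift _ _)) mevalC.
- rewrite susp_tuple_v susp_vec_v -q0 // mderivD mderivM !mderivXU eqxx eq_sym (negbTE (neq_lift _ _)).
  rewrite mpolyC0 add0r mpolyC1 mul1r mevalD mevalM tE mul0r addr0 meval_comp innerE mul0r //.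
rewrite susp_tuple_y tnth_mktuple mderiv_comp !mxE /susp_pt /ext !liftK !mxE -/(ext _ _).
rewrite big_ord_recl [X in _ + X]big1 ?addr0 => [|l _].
  by rewrite mevalM meval_comp innerE mul0r innerD eqxx mulrC.
by rewrite tnth_mktuple liftK mderivXU eq_sym (negbTE (neq_lift _ _)) mpolyC0 mulr0.
Qed.

Definition swap_tuple : n.+2.-tuple {mpoly K[n.+2]} := susp_tuple 'X_iv 'X_iu (ytuple K n).

Lemma mpmap_swap z : mpmap swap_tuple z = susp_pt (z iv) (z iu) (susp_y z).
Proof. by rewrite mpmap_susp_tuple !mevalXU mpmap_ytuple. Qed.

Lemma swap_automorphism : automorphism X swap_tuple swap_tuple.
Proof.
move=> z [Yz Ez]; rewrite !mpmap_swap susp_pt_u susp_pt_v susp_pt_y -susp_ptE.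
by split=> //; apply/SuspE; rewrite mulrC.
Qed.

Lemma mul_jac_swap v z : v *m jac swap_tuple z = susp_vec (v 0 iv) (v 0 iu) (yvec v).
Proof.
have E j : (v *m jac swap_tuple z) 0 j = dderiv (tnth swap_tuple j) z v.
  by rewrite mxE; apply: eq_bigr => i _; rewrite mxE.
apply/rowP=> i; rewrite E; have [->|->|[j ->]] := susp_index i.
- by rewrite susp_tuple_u dderivXU susp_vec_u.
- by rewrite susp_tuple_v dderivXU susp_vec_v.
by rewrite susp_tuple_y tnth_mktuple dderivXU !mxE /susp_pt /ext !liftK mxE.
Qed.

Hypothesis Yirr : irreducible_var Y.
Hypothesis f0 : ~ eqX Y f 0.

Lemma orbit_vec_u z w : X z -> orbit_vec Y (susp_y z) w ->
  orbit_vec X z (susp_vec 0 (dderiv f (susp_y z) w) (z iu *: w)).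
Proof.
move=> Xz [Phi PhiG ->]; have [Psi [q [PsiG _ _ E]]] := susp_lift PhiG.
by exists Psi => //; rewrite -[RHS]/(orbit_row Psi z) E.
Qed.

Lemma orbit_vec_v z w : X z -> orbit_vec Y (susp_y z) w ->
  orbit_vec X z (susp_vec (dderiv f (susp_y z) w) 0 (z iv *: w)).
Proof.
move=> Xz wO; have [Xs _ _ _] := swap_automorphism Xz.
have := @orbit_vec_u (mpmap swap_tuple z) w Xs; rewrite mpmap_swap susp_pt_y susp_pt_u => /(_ wO) H.
have := conj_action swap_automorphism Xz; rewrite mpmap_swap => /(_ _ H).
by rewrite mul_jac_swap susp_vec_u susp_vec_v yvec_susp_vec.
Qed.

Lemma orbit_vec_nonzero y (l : {mpoly K[n]}) : Y y -> flexible_point Y y ->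
  (exists2 w, tangent_vec Y y w & dderiv l y w != 0) ->
  exists2 w, orbit_vec Y y w & dderiv l y w != 0.
Proof.
move=> Yy /(flexible_pointP Yy) fl [w /fl[m [W [WO /submxP[c ->]]]]].
rewrite dderiv_mul => nz; apply: NNPP => H; case/eqP: nz; rewrite big1 // => i _.
case: (eqVneq (dderiv l y (row i W)) 0) => [->|ni]; first by rewrite mulr0.
by case: H; exists (row i W).
Qed.

(** A multiple of the swapped lift of [w0] removes the [u]-component. The rest is [(0, b, w')] with
    [df(w') = u b], and the lifts of orbit vectors spanning [w' / u] produce it. *)
Lemma flexible_susp_u z : X z -> z iu != 0 -> flexible_point Y (susp_y z) ->
  (exists2 w, tangent_vec Y (susp_y z) w & dderiv f (susp_y z) w != 0) ->
  flexible_point X z.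
Proof.
move=> Xz u0 fl ex; have [Yz Ez] := Xz; have [w0 w0O dw0] := orbit_vec_nonzero Yz fl ex.
apply/(flexible_pointP Xz) => v /(susp_tangentE Yirr f0 v Xz)[wT Ev].
pose c := v 0 iu / dderiv f (susp_y z) w0; pose w' := yvec v - c * z iv *: w0.
have w0T := orbit_vec_tangent Yz w0O.
have w'T : tangent_vec Y (susp_y z) w'.
  by move=> p pY; rewrite /w' -scaleNr dderiv_vecD dderiv_vecZ wT // w0T // mulr0 addr0.
have dw' : dderiv f (susp_y z) w' = z iu * v 0 iv.
  rewrite /w' -scaleNr dderiv_vecD dderiv_vecZ -Ev /c; by field.
have [m [W [WO /submxP[C CE]]]] : exists m (W : 'M[K]_(m, n)),
    (forall i, orbit_vec Y (susp_y z) (row i W)) /\ ((z iu)^-1 *: w' <= W)%MS.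
  apply: (proj1 (flexible_pointP Yz) fl) => p pY.
  by rewrite dderiv_vecZ w'T // mulr0.
pose vv := susp_vec (dderiv f (susp_y z) w0) 0 (z iv *: w0).
pose N : 'M[K]_(m, n.+2) :=
  \matrix_(i, j) susp_vec 0 (dderiv f (susp_y z) (row i W)) (z iu *: row i W) 0 j.
have EN : susp_vec 0 (v 0 iv) w' = C *m N.
  apply/rowP=> i; rewrite [RHS]mxE; have [->|->|[j ->]] := susp_index i.
  - by rewrite susp_vec_u big1 // => l _; rewrite [N _ _]mxE susp_vec_u mulr0.
  - rewrite susp_vec_v; transitivity (dderiv f (susp_y z) ((z iu)^-1 *: w')).
      by rewrite dderiv_vecZ dw' mulKf.
    rewrite CE dderiv_mul; apply: eq_bigr => l _.
    by rewrite [N _ _]mxE susp_vec_v.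
  transitivity (z iu * ((z iu)^-1 *: w') 0 j).
    by rewrite mxE /susp_pt !ext_lift [in RHS]mxE mulrA divff // mul1r.
  rewrite CE mxE big_distrr; apply: eq_bigr => l _ /=.
  by rewrite [N _ _]mxE mxE /susp_pt !ext_lift !mxE; ring.
have Ev' : v = c *: vv + susp_vec 0 (v 0 iv) w'.
  apply/rowP=> i; rewrite !mxE; have [->|->|[j ->]] := susp_index i.
  - by rewrite !susp_pt_u addr0 /c divfK.
  - by rewrite !susp_pt_v mulr0 add0r.
  by rewrite /susp_pt !ext_lift !mxE; ring.
exists (1 + m)%N, (col_mx vv N); split=> [i|].
  case: (split_ordP i) => a ->; rewrite ?rowKu ?rowKd.
    by rewrite ord1 row_id; apply: orbit_vec_v.
  have -> : row a N = susp_vec 0 (dderiv f (susp_y z) (row a W)) (z iu *: row a W).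
    by apply/rowP=> j; rewrite !mxE.
  exact: orbit_vec_u.
rewrite Ev' -addsmxE addmx_sub_adds ?scalemx_sub // EN; exact: submxMl.
Qed.

Lemma flexible_susp_smooth z : X z -> (z iu != 0) || (z iv != 0) -> flexible_point Y (susp_y z) ->
  (exists2 w, tangent_vec Y (susp_y z) w & dderiv f (susp_y z) w != 0) ->
  flexible_point X z.
Proof.
move=> Xz; case: (eqVneq (z iu) 0) => [_ /= v0|u0 _]; last exact: flexible_susp_u.
move=> fl ex; have [Xs _ _ _] := swap_automorphism Xz.
apply: (flexible_point_transport swap_automorphism Xz); apply: flexible_susp_u => //.
all: by rewrite mpmap_swap ?susp_pt_u ?susp_pt_y.
Qed.

Lemma susp_reach z y : X z -> z iu != 0 -> reach Y (susp_y z) y ->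
  exists v, reach X z (susp_pt (z iu) v y).
Proof.
move=> Xz u0; elim=> [|Phi t y' PhiG _ [v IH]].
  by exists (z iv); rewrite -susp_ptE; apply: reach_refl.
have [Psi [q [PsiG actE _ _]]] := susp_lift PhiG.
have := reach_act (t / z iu) PsiG IH.
rewrite actE susp_pt_u susp_pt_y divfK // => H; eexists; exact: H.
Qed.

Lemma susp_flexible :
  (forall y, Y y -> flexible_point Y y) ->
  (forall y, Y y -> f.@[y] = 0 -> exists2 w, tangent_vec Y y w & dderiv f y w != 0) ->
  (forall y, Y y -> exists2 y1, reach Y y y1 & exists2 w, tangent_vec Y y1 w & dderiv f y1 w != 0) ->
  forall z, X z -> flexible_point X z.
Proof.
move=> fl dfZ dense z Xz; have [Yz Ez] := Xz.
case: (eqVneq (z iu) 0) => [u0|u0].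
  have fz : f.@[susp_y z] = 0 by rewrite -Ez u0 mul0r.
  have ex := dfZ _ Yz fz.
  case: (eqVneq (z iv) 0) => [v0|v0]; last by apply: flexible_susp_smooth; rewrite ?v0 ?orbT //; apply: fl.
  (* At [u = v = 0] the lift of an action transverse to [f = 0] fixes [y] and moves [v] at speed
     [df(w)], so time 1 leads to a point with [v != 0]. *)
  have [_ [Phi PhiG ->] dw] := orbit_vec_nonzero Yz (fl _ Yz) ex.
  have [Psi [q [PsiG actE q0 _]]] := susp_lift PhiG.
  have zr : reach X z (act Psi 1 z) by apply: reach_act => //; apply: reach_refl.
  apply: (flexible_point_reach Xz zr); have Xr := reachX Xz zr.
  have yE : susp_y (act Psi 1 z) = susp_y z by rewrite actE u0 mulr0 (act0 PhiG) // susp_pt_y.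
  apply: flexible_susp_smooth => //; rewrite ?yE //; last exact: fl.
  by rewrite actE susp_pt_v u0 v0 mulr0 q0 // add0r mul1r dw orbT.
have [y1 yr ex] := dense _ Yz; have [v zr] := susp_reach Xz u0 yr.
apply: (flexible_point_reach Xz zr); apply: flexible_susp_smooth; rewrite ?susp_pt_y ?susp_pt_u ?u0 //.
  exact: reachX zr.
by apply: fl; apply: reachX yr.
Qed.

Lemma susp_slice p u : exists q, forall y, q.@[y] = p.@[susp_pt u (f.@[y] / u) y].
Proof.
exists (p \mPo susp_tuple u%:MP (u^-1 *: f) [tuple 'X_i | i < n]) => y.
rewrite meval_comp mpmap_susp_tuple mevalC mevalZ mulrC; congr (_.@[susp_pt _ _ _]).
by apply: functional_extensionality => i; rewrite /mpmap tnth_mktuple mevalXU.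
Qed.

Lemma mpoly_has_root r (F : {mpoly K[r]}) : (forall c, F <> c%:MP) -> exists t, F.@[t] = 0.
Proof.
move=> Fnc; have F0 : F != 0 by apply/eqP; rewrite -mpolyC0; apply: Fnc.
have [u [[|G s] [Uu sP E]]] := prime_factorization_mpoly F0.
  case/andP: Uu => /eqP Uu _; case: (Fnc F@_0%MM).
  by rewrite {1}E big_nil mulr1 Uu E big_nil mulr1 Uu mcoeffC eqxx mulr1.
have GP := sP G (mem_head _ _).
have [|t tG _] := prime_nullstellensatz (rprime_ideal GP) (rdvd0 G) (g := 1).
  exact: prime_ideal1 (rprime_ideal GP).
exists t; rewrite E big_cons mulrCA mevalM tG ?mul0r //; exact: rdvd_refl.
Qed.

(* The map [(u, w) |-> (u, F (t0 + u w) / u, phi (t0 + u w))], with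
   [F = f o phi] and [F t0 = 0]. *)
Lemma susp_dominant r (phi : n.-tuple {mpoly K[r]}) :
  (forall t, Y (mpmap phi t)) -> (forall p, p \mPo phi = 0 -> eqX Y p 0) ->
  (forall c, f \mPo phi <> c%:MP) ->
  exists psi : n.+2.-tuple {mpoly K[r.+1]}, forall p, p \mPo psi = 0 -> eqX X p 0.
Proof.
move=> phiY dom Fnc; have [t0 Ft0] := mpoly_has_root Fnc.
pose line : r.-tuple {mpoly K[r.+1]} := [tuple (t0 i)%:MP + 'X_ord0 * 'X_(lift ord0 i) | i < r].
have lineE u w : mpmap line (ext u w) = fun i => t0 i + u * w i.
  apply: functional_extensionality => i.
  by rewrite /mpmap tnth_mktuple mevalD mevalM mevalC !mevalXU ext_ord0 ext_lift.
(* As [F] vanishes at [t0], its value at [t0 + u w] is divisible by [u]; the quotient serves as the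
   [v]-coordinate. *)
have [Q [QE _]] := divide_first_var ((f \mPo phi) \mPo line).
have FE u w : f.@[mpmap phi (fun i => t0 i + u * w i)] = u * Q.@[ext u w].
  have := QE u w; rewrite !meval_comp !lineE => ->.
  rewrite (_ : (fun i => t0 i + 0 * w i) = t0); first by rewrite -meval_comp Ft0 add0r.
  by apply: functional_extensionality => i; rewrite mul0r addr0.
exists (susp_tuple 'X_ord0 Q (pmcomp phi line)) => p pE.
apply: (susp_eqX0 Yirr f0) => y u Yy u0; have [q qE] := susp_slice p u.
rewrite -qE; have : eqX Y q 0; last by move/(_ y Yy); rewrite meval0.
apply: dom; apply: mpoly_eval_eq0 => t; rewrite meval_comp qE.
(* For fixed [u != 0] every [t] has the form [t0 + u w], so each slice of the map inherits dominance
   from [phi]. *)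
pose w i := (t i - t0 i) / u.
have tE : (fun i => t0 i + u * w i) = t.
  by apply: functional_extensionality => i; rewrite /w mulrCA divff // mulr1 addrC subrK.
transitivity ((p \mPo susp_tuple 'X_ord0 Q (pmcomp phi line)).@[ext u w]); last by rewrite pE meval0.
rewrite meval_comp mpmap_susp_tuple mevalXU ext_ord0 mpmap_pmcompE lineE tE.
by have := FE u w; rewrite tE => ->; rewrite mulrAC divff // mul1r.
Qed.

(** The added function is [u], which takes all nonzero values above each point of [Y]. *)
Lemma susp_algindep e : algindep Y e -> algindep X e.+1.
Proof.
move=> [g gP]; exists [tuple of rcons (pmcomp g (ytuple K n)) 'X_iu] => P.
rewrite -[P]muniK; move: (muni P) => Q {P} QX.
suff -> : Q = 0 by rewrite rmorph0.
apply/polyP=> i; rewrite coef0; apply: gP => y Yy; rewrite meval0.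
have E : map_poly (meval y \o comp_mpoly g) Q = 0.
  apply: poly_eq0_nonzero => u u0.
  have Xz : X (susp_pt u (f.@[y] / u) y) by apply/SuspE; split=> //; rewrite mulrC divfK.
  have := QX _ Xz; rewrite mjoin_comp meval0 => <-.
  elim/poly_ind: {QX}Q => [|Q c IH]; first by rewrite !rmorph0 !horner0 meval0.
  rewrite !rmorphD !rmorphM /= !hornerD !hornerM mevalD mevalM IH.
  rewrite !map_polyX !map_polyC !hornerX !hornerC mevalXU susp_pt_u /=.
  by rewrite -comp_mpoly_comp meval_ypoly susp_pt_y.
by have := congr1 (fun p : {poly K} => p`_i) E; rewrite coef_map coef0.
Qed.
End SuspensionLifts.

(** * Coordinate rings as integral domains *)

(** Units are decided and inverses chosen classically, on the same carrier. *)
Lemma comring_idomain (Q : comNzRingType) : (forall x y : Q, x * y = 0 -> (x == 0) || (y == 0)) ->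
  exists (A : idomainType) (phi : {rmorphism Q -> A}), bijective phi.
Proof.
move=> dom.
pose un (x : Q) : bool := if excluded_middle_informative (exists y, y * x = 1) then true else false.
have unP x : reflect (exists y, y * x = 1) (un x).
  by rewrite /un; case: excluded_middle_informative => H; constructor.
pose inv (x : Q) : Q := if excluded_middle_informative (exists y, y * x = 1) is left H
  then proj1_sig (constructive_indefinite_description _ H) else x.
have mulV : {in un, left_inverse 1 inv *%R}.
  move=> x /unP ex; rewrite /inv; case: excluded_middle_informative => // H.
  by case: constructive_indefinite_description.
have introU x y : y * x = 1 -> un x by move=> E; apply/unP; exists y.
have invout : {in [predC un], inv =1 id}.
  move=> x /unP nex; rewrite /inv; case: excluded_middle_informative => //.
pose CU : comUnitRingType := HB.pack (GRing.ComNzRing.sort Q)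
  (GRing.ComNzRing_hasMulInverse.Build (GRing.ComNzRing.sort Q) mulV introU invout).
pose A : idomainType := HB.pack (GRing.ComUnitRing.sort CU)
  (GRing.ComUnitRing_isIntegral.Build (GRing.ComUnitRing.sort CU) dom).
by exists A, (idfun : {rmorphism Q -> Q}), id.
Qed.

Lemma coordinate_ring (K : closedFieldType) n (X : point K n -> Prop) : domainX X ->
  exists (A : idomainType) (pi : {rmorphism {mpoly K[n]} -> A}),
    (forall a, exists p, a = pi p) /\ forall p, pi p = 0 <-> eqX X p 0.
Proof.
move=> [X1 Xdom].
pose I (p : {mpoly K[n]}) : bool := if excluded_middle_informative (eqX X p 0) then true else false.
have IP p : reflect (eqX X p 0) (I p).
  by rewrite /I; case: excluded_middle_informative => H; constructor.
have Icl : idealr_closed I.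
  split; first by apply/IP.
    by apply/negP => /IP.
  move=> a u v /IP Hu /IP Hv; apply/IP => x Xx.
  by rewrite mevalD mevalM Hu // Hv // meval0 mulr0 addr0.
pose J : idealr {mpoly K[n]} := HB.pack I (isIdealr.Build _ I Icl).
pose Q := {ideal_quot J}.
have piE (p : {mpoly K[n]}) : (\pi_Q p)%qT = 0 :> Q <-> eqX X p 0.
  have EJ : (p \in J) = ((\pi_Q p)%qT == 0 :> Q).
    by rewrite -[p in LHS]subr0 (Quotient.idealrBE J p 0) -(rmorph0 (\pi_Q)%qT).
  split=> [E|/IP H]; last by apply/eqP; rewrite -EJ.
  by apply/IP; rewrite -[I p]/(p \in J) EJ E.
have [|A [phi [psi phiK psiK]]] := @comring_idomain Q.
  move=> x y; rewrite -[x]reprK -[y]reprK -rmorphM => /piE/Xdom.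
  by case=> /piE ->; rewrite eqxx ?orbT.
exists A, (phi \o (\pi_Q)%qT); split=> [a|p].
  by exists (repr (psi a)); rewrite /= reprK psiK.
rewrite /= -piE; split=> [E|->]; last exact: rmorph0.
by apply: (can_inj phiK); rewrite E rmorph0.
Qed.

Lemma factor_rmorphism (R A B : comNzRingType) (pi : {rmorphism R -> A}) (phi : {rmorphism R -> B}) :
  (forall a, exists p, a = pi p) -> (forall p, pi p = 0 -> phi p = 0) ->
  exists psi : {rmorphism A -> B}, forall p, psi (pi p) = phi p.
Proof.
move=> sur ker; pose s a := proj1_sig (constructive_indefinite_description _ (sur a)).
have sE a : pi (s a) = a by rewrite /s; case: constructive_indefinite_description.
pose f a := phi (s a).
have fE p : f (pi p) = phi p.
  by apply/eqP; rewrite -subr_eq0 -rmorphB; apply/eqP/ker; rewrite rmorphB sE subrr.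
have fB : additive f.
  by move=> a b; rewrite -[a]sE -[b]sE -rmorphB !fE rmorphB.
have fM : multiplicative f.
  split=> [a b|]; first by rewrite -[a]sE -[b]sE -rmorphM !fE rmorphM.
  by rewrite -(rmorph1 pi) fE rmorph1.
pose psi : {rmorphism A -> B} := HB.pack f (GRing.isAdditive.Build A B f fB)
  (GRing.isMultiplicative.Build A B f fM).
by exists psi.
Qed.

Section CoordinateRing.
Variables (K : closedFieldType) (n : nat) (X : point K n -> Prop).
Variables (A : idomainType) (pi : {rmorphism {mpoly K[n]} -> A}).
Hypothesis piS : forall a, exists p, a = pi p.
Hypothesis piE : forall p, pi p = 0 <-> eqX X p 0.

Lemma coord_eq p q : pi p = pi q <-> eqX X p q.
Proof.
have E : eqX X p q <-> eqX X (p - q) 0.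
  split=> H x Xx; first by rewrite mevalB H // subrr meval0.
  by apply/eqP; rewrite -subr_eq0 -mevalB H ?meval0.
rewrite E -piE rmorphB; split=> [->|/eqP]; first by rewrite subrr.
by rewrite subr_eq0 => /eqP.
Qed.

Lemma coord_unit p : pi p \is a GRing.unit <-> unitX X p.
Proof.
split=> [/unitrP[a [_]]|[q /coord_eq]].
  have [q ->] := piS a; rewrite -rmorphM -(rmorph1 pi) => /coord_eq ?; by exists q.
by rewrite rmorphM rmorph1 => /unitr_mul_eq1.
Qed.

Lemma coord_irreducible p : rirreducible (pi p) <-> irreducibleX X p.
Proof.
split=> [[p0 pU pI]|[p0 [pU pI]]].
  split; first by move/piE => E; rewrite E eqxx in p0.
  split; first by move/coord_unit; apply/negP.
  move=> a b /coord_eq; rewrite rmorphM => /pI[]/coord_unit; by [left|right].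
split; first by apply/eqP => /piE.
  by apply/negP => /coord_unit.
move=> a b; have [c ->] := piS a; have [d ->] := piS b; rewrite -rmorphM => /coord_eq/pI.
by case=> /coord_unit; [left|right].
Qed.

Lemma coord_dvd p q : rdvd (pi p) (pi q) <-> dvdX X p q.
Proof.
split=> [[a]|[r /coord_eq]].
  by have [r ->] := piS a; rewrite -rmorphM => /coord_eq; rewrite mulrC; exists r.
by rewrite mulrC rmorphM; exists (pi r).
Qed.

Lemma coord_prime p : rprime (pi p) <-> primeX X p.
Proof.
split=> [[p0 pU pP]|[p0 [pU pP]]].
  split; first by move/piE => E; rewrite E eqxx in p0.
  split; first by move/coord_unit; apply/negP.
  by move=> a b /coord_dvd; rewrite rmorphM => /pP[]/coord_dvd; [left|right].
split; first by apply/eqP => /piE.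
  by apply/negP => /coord_unit.
move=> a b; have [c ->] := piS a; have [d ->] := piS b; rewrite -rmorphM => /coord_dvd/pP.
by case=> /coord_dvd; [left|right].
Qed.

Lemma coord_lift_seq (s : seq A) : exists s', s = map pi s'.
Proof.
elim: s => [|a s [s' ->]]; first by exists [::].
by have [p ->] := piS a; exists (p :: s').
Qed.

Lemma coord_prod s : pi (\prod_(q <- s) q) = \prod_(a <- map pi s) a.
Proof. by rewrite rmorph_prod big_map. Qed.

Lemma coord_irreducibles s : rirreducibles (map pi s) <-> forall q, q \in s -> irreducibleX X q.
Proof.
split=> [H q qs|H _ /mapP[q qs ->]]; last exact/coord_irreducible/H.
by apply/coord_irreducible/H/map_f.
Qed.

Lemma coord_factorial : factorial_var X <-> domainX X /\ prime_factorization A.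
Proof.
rewrite -unique_factorizationP; split=> [[dom [ex un]]|[dom [ex un]]]; split=> //.
  split=> [a a0 aU|s t].
    have [p Ep] := piS a; rewrite {}Ep in a0 aU *.
    have [||s [sP E]] := ex p; [by move/piE/eqP; apply/negP | by move/coord_unit; apply/negP |].
    by exists (map pi s); [apply/coord_irreducibles | rewrite -coord_prod; apply/coord_eq].
  have [s' ->] := coord_lift_seq s; have [t' ->] := coord_lift_seq t.
  move=> /coord_irreducibles sP /coord_irreducibles tP; rewrite -!coord_prod => /coord_eq E.
  have [r [tr [sr H]]] := un s' t' sP tP E.
  exists (map pi r); rewrite !size_map; split=> // [|i lt]; first exact: perm_map.
  have [u [/coord_unit Uu /coord_eq]] := H i lt; rewrite rmorphM => Eu.
  by exists (pi u) => //; rewrite !(nth_map 0) // -sr.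
split=> [p p0 pU|s t /coord_irreducibles sP /coord_irreducibles tP /coord_eq].
  have [||s sP E] := ex (pi p); first by apply/eqP=> /piE.
    by apply/negP => /coord_unit.
  have [s' Es] := coord_lift_seq s; rewrite {s}Es in sP E.
  exists s'; split; first exact/coord_irreducibles.
  by apply/coord_eq; rewrite coord_prod.
rewrite !coord_prod => E; have [r [tr sr H]] := un _ _ sP tP E.
(* The permutation is lifted through indices, since different polynomials in [t] may have the same
   class. *)
have [Is IsP Er] : exists2 Is, perm_eq Is (iota 0 (size (map pi t))) & r = map (nth 0 (map pi t)) Is.
  by apply/perm_iotaP; rewrite perm_sym.
exists (map (nth 0 t) Is); rewrite size_map in IsP.
have sI : size Is = size r by rewrite Er size_map.
rewrite !size_map in sr H *; split.
  by rewrite perm_sym; apply/(perm_iotaP 0); exists Is.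
split=> [|i lt]; first by rewrite sI.
have [u Uu Eu] := H i lt; have [p Ep] := piS u; exists p; split; first by apply/coord_unit; rewrite -Ep.
apply/coord_eq; rewrite rmorphM -Ep -(nth_map 0 0) // Eu Er; congr (_ * _).
have lt' : (i < size Is)%N by rewrite sI -sr.
rewrite !(nth_map 0%N) // (nth_map 0) //.
by have := mem_nth 0%N lt'; rewrite (perm_mem IsP) mem_iota add0n.
Qed.
End CoordinateRing.

(** * The coordinate ring of the suspension as [A[u] + v A[v]] *)

Section SuspensionRing.
Variables (K : closedFieldType) (n : nat) (Y : point K n -> Prop) (f : {mpoly K[n]}).
Hypothesis Yirr : irreducible_var Y.
Hypothesis f0 : ~ eqX Y f 0.
Local Notation X := (Susp Y f).
Variables (A : idomainType) (piA : {rmorphism {mpoly K[n]} -> A}).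
Hypothesis piAS : forall a, exists p, a = piA p.
Hypothesis piAE : forall p, piA p = 0 <-> eqX Y p 0.
Variables (B : idomainType) (piB : {rmorphism {mpoly K[n.+2]} -> B}).
Hypothesis piBS : forall a, exists p, a = piB p.
Hypothesis piBE : forall p, piB p = 0 <-> eqX X p 0.

Lemma coord_lift_poly (P : {poly A}) : exists P', P = map_poly piA P'.
Proof.
elim/poly_ind: P => [|P c [P' ->]]; first by exists 0; rewrite rmorph0.
have [p ->] := piAS c; exists (P' * 'X + p%:P).
by rewrite rmorphD rmorphM /= map_polyX map_polyC.
Qed.

Lemma susp_ring : exists ju jv : {rmorphism {poly A} -> B},
  [/\ forall c, jv c%:P = ju c%:P, ju 'X * jv 'X = ju (piA f)%:P,
      forall b, exists P Q, b = ju P + jv 'X * jv Q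
    & forall P Q, ju P + jv 'X * jv Q = 0 -> P = 0 /\ Q = 0].
Proof.
have [jA jAE] : exists jA : {rmorphism A -> B}, forall p, jA (piA p) = piB (ypoly p).
  apply: (@factor_rmorphism _ _ _ piA (piB \o @ypoly K n)) => // p /piAE pY.
  by apply/piBE => z [Yz _]; rewrite meval_ypoly pY // !meval0.
pose pu : {mpoly K[n.+2]} := 'X_ord0; pose pv : {mpoly K[n.+2]} := 'X_(lift ord0 ord0).
pose ju : {rmorphism {poly A} -> B} := horner_eval (piB pu) \o map_poly jA.
pose jv : {rmorphism {poly A} -> B} := horner_eval (piB pv) \o map_poly jA.
have juX : ju 'X = piB pu by rewrite /ju /= map_polyX /horner_eval hornerX.
have jvX : jv 'X = piB pv by rewrite /jv /= map_polyX /horner_eval hornerX.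
have juC c : ju c%:P = jA c by rewrite /ju /= map_polyC /horner_eval hornerC.
have jvC c : jv c%:P = jA c by rewrite /jv /= map_polyC /horner_eval hornerC.
clearbody ju jv.
have juE P : ju (map_poly piA P) = piB (upoly P).
  elim/poly_ind: P => [|P c IH]; first by rewrite /upoly !rmorph0 horner0 rmorph0.
  rewrite /upoly !rmorphD !rmorphM /= hornerD hornerM !map_polyX !map_polyC hornerX hornerC.
  by rewrite !rmorphD !rmorphM IH juX juC jAE.
have jvE P : jv (map_poly piA P) = piB (vpoly P).
  elim/poly_ind: P => [|P c IH]; first by rewrite /vpoly !rmorph0 horner0 rmorph0.
  rewrite /vpoly !rmorphD !rmorphM /= hornerD hornerM !map_polyX !map_polyC hornerX hornerC.
  by rewrite !rmorphD !rmorphM IH jvX jvC jAE.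
have rel0 : eqX X (pu * pv - ypoly f) 0.
  by move=> z [_ Ez]; rewrite mevalB mevalM !mevalXU meval_ypoly Ez subrr meval0.
exists ju, jv; split.
- by move=> c; rewrite juC jvC.
- rewrite juX jvX juC jAE -rmorphM; apply/eqP; rewrite -subr_eq0 -rmorphB; apply/eqP/piBE.
  exact: rel0.
- move=> b; have [p ->] := piBS b; have [h [P [Q ->]]] := susp_decomposition f p.
  exists (map_poly piA P), (map_poly piA Q); rewrite juE jvE jvX !rmorphD !rmorphM.
  by rewrite (proj2 (piBE _) rel0) mul0r add0r.
move=> P Q; have [P' ->] := coord_lift_poly P; have [Q' ->] := coord_lift_poly Q.
rewrite juE jvE jvX -rmorphM -rmorphD => /piBE PQ.
have [|HP HQ] := @susp_decomposition_unique K n Y f Yirr f0 P' Q'.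
  by move=> y u Yy u0; rewrite PQ ?meval0 //; apply/SuspE; split=> //; rewrite mulrC divfK.
by split; apply/polyP=> i; rewrite coef_map coef0; apply/piAE.
Qed.

Lemma susp_ring_factorization : prime_factorization A -> rprime (piA f) -> prime_factorization B.
Proof. by have [ju [jv [H1 H2 H3 H4]]] := susp_ring; apply: (susp_factorization H1 H2 H3 H4). Qed.

Lemma susp_ring_descent : piA f \isn't a GRing.unit -> prime_factorization B ->
  prime_factorization A /\ rprime (piA f).
Proof.
have [ju [jv [H1 H2 H3 H4]]] := susp_ring => fU BF; split.
  exact: (susp_descent H1 H2 H3 H4).
by apply: (susp_prime H1 H2 H3 H4) => //; apply/eqP => /piAE.
Qed.
End SuspensionRing.

(** * Smoothness and flexibility of a suspension *)

Section SmoothFlexible.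
Variable K : closedFieldType.
Hypothesis char0 : [pchar K] =i pred0.

Lemma smooth_local_dim n (X : point K n -> Prop) x d (M : 'M[K]_(d, n)) :
  smooth_point X x -> tangent_basis X x M -> local_dim X x d.
Proof.
move=> [e [loc /tangent_dimP[N [NF NT]]]] [MF MT].
by rewrite (basis_dim_uniq MF NF MT NT).
Qed.

Lemma smooth_pointI n (X : point K n -> Prop) x d (M : 'M[K]_(d, n)) :
  local_dim X x d -> tangent_basis X x M -> smooth_point X x.
Proof. by move=> loc MB; exists d; split=> //; apply/tangent_dimP; exists M. Qed.

Lemma flexible_dominant n (X : point K n -> Prop) x d (M : 'M[K]_(d, n)) :
  irreducible_var X -> X x -> smooth_point X x -> flexible_point X x -> tangent_basis X x M ->
  exists phi : n.-tuple {mpoly K[d]},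
    [/\ parametrization X x phi, jac phi (fun _ => 0) = M, forall t, reach X x (mpmap phi t)
      & forall p, p \mPo phi = 0 -> eqX X p 0].
Proof.
move=> Xirr Xx sm fl MB; have [phi phiP [phiJ phiR]] := flexible_param Xx fl MB.
exists phi; split=> //.
exact: (param_dominant char0 Xirr (smooth_local_dim sm MB) phiP).
Qed.

(** Each parametrization provides as many independent functions as it has parameters, and dominance
    of the other one bounds that number. *)
Lemma smooth_flexible_dim n (X : point K n -> Prop) x y d e (M : 'M[K]_(d, n)) (N : 'M[K]_(e, n)) :
  irreducible_var X -> smooth X -> flexible X -> X x -> X y ->
  tangent_basis X x M -> tangent_basis X y N -> d = e.
Proof.
move=> Xirr sm fl Xx Xy MB NB.
have [phi [phiP _ _ phiD]] := flexible_dominant Xirr Xx (sm x Xx) (fl x Xx (sm x Xx)) MB.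
have [psi [psiP _ _ psiD]] := flexible_dominant Xirr Xy (sm y Xy) (fl y Xy (sm y Xy)) NB.
apply/eqP; rewrite eqn_leq.
by rewrite (algindep_dominant psiD (param_algindep char0 phiP)) (algindep_dominant phiD (param_algindep char0 psiP)).
Qed.

Lemma prime_zero_locus n (Y : point K n -> Prop) f p : irreducible_var Y -> primeX Y f ->
  eqX (zero_locus Y f) p 0 -> exists h, eqX Y p (f * h).
Proof.
move=> Yirr [f0 [fU fP]] pZ; have [Ycl _] := Yirr.
pose J := dvdX Y f.
have JP : prime_ideal J.
  split.
  - by move=> a b [r ra] [s sb]; exists (r + s) => x Yx; rewrite mevalD ra // sb // -mevalD mulrDr.
  - by move=> a b [r rb]; exists (a * r) => x Yx; rewrite mevalM rb // -mevalM mulrCA.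
  - by move=> [r r1]; apply: fU; exists r => x Yx; rewrite r1.
  - exact: fP.
have J0 : J 0 by exists 0; rewrite mulr0.
apply: NNPP => np; have [x xJ /eqP[]] := prime_nullstellensatz JP J0 (g := p) np.
rewrite pZ ?meval0 //; split; last by apply: xJ; exists 1; rewrite mulr1.
by apply: zclosed_eqX0 Ycl _ => q qY; apply: xJ; exists 0; rewrite mulr0.
Qed.

Lemma comp_nonconst n (Y : point K n -> Prop) f r (phi : n.-tuple {mpoly K[r]}) :
  ~ (exists c, forall y, Y y -> f.@[y] = c) -> (forall p, p \mPo phi = 0 -> eqX Y p 0) ->
  forall c, f \mPo phi <> c%:MP.
Proof.
move=> fnc dom c E; apply: fnc; exists c => y Yy.
have := dom (f - c%:MP) _ y Yy; rewrite comp_mpolyB comp_mpolyC E subrr => /(_ erefl).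
by rewrite mevalB mevalC meval0 => /eqP; rewrite subr_eq0 => /eqP.
Qed.

Lemma nonconst_derivative n (Y : point K n -> Prop) f r (phi : n.-tuple {mpoly K[r]}) :
  (forall t, Y (mpmap phi t)) -> (forall c, f \mPo phi <> c%:MP) ->
  exists t, exists2 w, tangent_vec Y (mpmap phi t) w & dderiv f (mpmap phi t) w != 0.
Proof.
move=> phiY Fnc; apply: NNPP => H; case: (Fnc (f \mPo phi)@_0%MM).
apply: (mderiv_eq0_const char0) => l; apply: mpoly_eval_eq0 => t.
have -> : ((f \mPo phi)^`M(l)).@[t] = dderiv (f \mPo phi) t (delta_mx 0 l).
  rewrite /dderiv (bigD1 l) //= big1 ?addr0 => [|i il]; rewrite mxE eqxx /=.
    by rewrite eqxx mul1r.
  by rewrite (negbTE il) mul0r.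
rewrite dderiv_comp; apply/eqP; apply: contraT => nz; case: H; exists t.
by exists (delta_mx 0 l *m jac phi t) => //; apply: tangent_vec_jac.
Qed.

Variables (n : nat) (Y : point K n -> Prop) (f : {mpoly K[n]}).
Hypothesis Yirr : irreducible_var Y.
Hypothesis fnc : ~ (exists c, forall y, Y y -> f.@[y] = c).
Local Notation X := (Susp Y f).
Local Notation Z := (zero_locus Y f).

Lemma nonconst_neq0 : ~ eqX Y f 0.
Proof. by move=> E; apply: fnc; exists 0 => y Yy; rewrite E // meval0. Qed.
Local Notation f0 := nonconst_neq0.

Lemma susp_irreducible : irreducible_var X.
Proof. apply: domain_irreducible; [exact: susp_zclosed | exact: susp_domain f0]. Qed.

Lemma zero_locus_chain_extend y e C : chain_at Z y e C -> exists C', chain_at Y y e.+1 C'.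
Proof.
apply: chain_extend => //; first by move=> x [].
apply: NNPP => H; apply: f0 => x Yx; rewrite meval0; apply: NNPP => fx.
by apply: H; exists x; split=> // [[]].
Qed.

Lemma susp_smooth_flexible : smooth Y -> flexible Y -> primeX Y f -> smooth Z ->
  smooth X /\ flexible X.
Proof.
move=> Ysm Yfl fP Zsm; have Yfl' y : Y y -> flexible_point Y y by move=> Yy; apply: Yfl (Ysm y Yy).
(* If [df] vanished on the tangent space, [Z] would have the tangent dimension of [Y] at [y]; a
   chain in [Z] of that length, extended by [Y], would be too long. *)
have dfZ y : Y y -> f.@[y] = 0 -> exists2 w, tangent_vec Y y w & dderiv f y w != 0.
  move=> Yy fy; have [d [M MB]] := tangent_basis_exists Y y.
  have Zy : Z y by split.
  have [e [N [b [NB E bE]]]] := zero_locus_tangent_basis (fun p => prime_zero_locus (p := p) Yirr fP) Zy MB.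
  apply/bE; apply: contraT => /negbTE b0; move: E; rewrite b0 addn0 => E.
  have [[C CZ] _] := smooth_local_dim (Zsm y Zy) NB.
  have [_ Ymax] := smooth_local_dim (Ysm y Yy) MB.
  have [C' CY] := zero_locus_chain_extend CZ.
  by have := Ymax _ _ CY; rewrite E ltnn.
have dense y : Y y -> exists2 y1, reach Y y y1 & exists2 w, tangent_vec Y y1 w & dderiv f y1 w != 0.
  move=> Yy; have [d [M MB]] := tangent_basis_exists Y y.
  have [phi [[phiY _ _] _ phiR phiD]] := flexible_dominant Yirr Yy (Ysm y Yy) (Yfl' y Yy) MB.
  have [t ex] := nonconst_derivative phiY (comp_nonconst fnc phiD).
  by exists (mpmap phi t).
have Xfl z : X z -> flexible_point X z by apply: (susp_flexible Yirr f0 Yfl' dfZ dense).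
split=> z Xz; last by move=> _; apply: Xfl.
have [Yz Ez] := Xz; have [d [M MB]] := tangent_basis_exists Y (susp_y z).
have [e [N [b [NB E bE]]]] := susp_tangent_basis Yirr f0 Xz MB.
have b1 : b.
  apply/bE; case: (eqVneq (z ord0) 0) => [u0|]; last by constructor 1.
  by constructor 3; apply: dfZ => //; rewrite -Ez u0 mul0r.
have {E} Ee : e = d.+1 by move: E; rewrite b1; lia.
(* The chain comes from the flexibility of [X] just proved, the bound [d + 1] from the dominant map
   built over a parametrization of [Y]. *)
apply: smooth_pointI (NB); split.
  have [phi phiP _] := flexible_param Xz (Xfl z Xz) NB.
  have [C CX _] := param_chain char0 (susp_zclosed f Yirr) phiP; by exists C.
move=> e' C CX; have [phi [[phiY _ _] _ _ phiD]] := flexible_dominant Yirr Yz (Ysm _ Yz) (Yfl' _ Yz) MB.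
have [psi psiD] := susp_dominant Yirr f0 phiY phiD (comp_nonconst fnc phiD).
by rewrite Ee; apply: algindep_dominant psiD (chain_algindep susp_irreducible CX).
Qed.

(** * From the suspension back to the base *)

Hypothesis Xsm : smooth X.
Hypothesis Xfl : flexible X.

Lemma susp_slice_pt y : Y y -> X (susp_pt 1 f.@[y] y).
Proof. by move=> Yy; apply/SuspE; rewrite mul1r. Qed.

(** At [u = 1] the tangent dimension of [X] exceeds that of [Y] by one, and it is constant on
    [X]. *)
Lemma susp_base_dim y d (M : 'M[K]_(d, n)) : Y y -> tangent_basis Y y M ->
  forall z e (N : 'M[K]_(e, n.+2)), X z -> tangent_basis X z N -> e = d.+1.
Proof.
move=> Yy MB z e N Xz NB; have Xy := susp_slice_pt Yy.
have MB' : tangent_basis Y (susp_y (susp_pt 1 f.@[y] y)) M by rewrite susp_pt_y.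
have [e' [N' [b [NB' E bE]]]] := susp_tangent_basis Yirr f0 Xy MB'.
rewrite (smooth_flexible_dim susp_irreducible Xsm Xfl Xz Xy NB NB').
have b1 : b by apply/bE; constructor 1; rewrite susp_pt_u oner_neq0.
by move: E; rewrite b1; lia.
Qed.

Lemma susp_base_smooth : smooth Y.
Proof.
move=> y Yy; have [d [M MB]] := tangent_basis_exists Y y; apply: smooth_pointI (MB).
have [MF MT] := MB; have Xy := susp_slice_pt Yy.
have [e [N NB]] := tangent_basis_exists X (susp_pt 1 f.@[y] y).
have Ee := susp_base_dim Yy MB Xy NB.
have [phi [[phiX phi0 _] phiJ _ phiD]] := flexible_dominant susp_irreducible Xy (Xsm Xy) (Xfl Xy (Xsm Xy)) NB.
split; last first.
  move=> e' C CY; rewrite -ltnS -Ee; apply: algindep_dominant phiD _.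
  exact: susp_algindep (chain_algindep Yirr CY).
(* [C] selects the tangent vectors [(0, df(w), w)] lifting a basis of the tangent space of [Y]; on
   these the projection to [Y] is injective. *)
have [C MC] : exists C, M = C *m (N *m jac (ytuple K n) (susp_pt 1 f.@[y] y)).
  apply/submxP/row_subP => i; pose w := row i M.
  have wT : tangent_vec Y y w by apply/MT/row_sub.
  have : tangent_vec X (susp_pt 1 f.@[y] y) (susp_vec 0 (dderiv f y w) w).
    apply/(susp_tangentE Yirr f0 _ Xy); rewrite susp_pt_y susp_pt_u susp_pt_v susp_vec_u susp_vec_v yvec_susp_vec.
    by split=> //; rewrite mulr0 add0r mul1r.
  have [_ NT] := NB; move/NT/submxP=> [c Ec]; apply/submxP; exists c.
  rewrite mulmxA -Ec mul_jac_ytuple; apply/rowP=> j.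
  by rewrite [RHS]mxE [RHS]mxE /susp_pt !ext_lift.
have phiP : parametrization Y y (pmcomp (pmcomp (ytuple K n) phi) (lin C)).
  split.
  - by move=> t; rewrite !mpmap_pmcompE mpmap_ytuple; have [] := phiX (mpmap (lin C) t).
  - by rewrite !mpmap_pmcompE mpmap_origin_lin phi0 mpmap_ytuple susp_pt_y.
  by rewrite !jac_pmcomp jac_lin mpmap_origin_lin phi0 phiJ -MC.
have [Ycl _] := Yirr; have [Ch ChY _] := param_chain char0 Ycl phiP; by exists Ch.
Qed.

(** At [(0, 0, y)] the equation of the tangent space reduces to [df(w) = 0], and it must be
    nontrivial for the dimension to be [d + 1]. *)
Lemma susp_zero_locus_tangent y : Z y -> exists2 w, tangent_vec Y y w & dderiv f y w != 0.
Proof.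
move=> [Yy fy]; have [d [M MB]] := tangent_basis_exists Y y.
have Xy : X (susp_pt 0 0 y) by apply/SuspE; rewrite mul0r fy.
have MB' : tangent_basis Y (susp_y (susp_pt 0 0 y)) M by rewrite susp_pt_y.
have [e [N [b [NB E bE]]]] := susp_tangent_basis Yirr f0 Xy MB'.
have b1 : b by have := susp_base_dim Yy MB Xy NB; case: (b) E => //; lia.
have := proj1 bE b1; rewrite susp_pt_u susp_pt_v susp_pt_y eqxx.
by case.
Qed.

Lemma susp_zero_locus_smooth : flexible Y -> primeX Y f -> smooth Z.
Proof.
move=> Yfl fP y Zy; have [Yy fy] := Zy; have Ysm := susp_base_smooth.
have [d [M MB]] := tangent_basis_exists Y y.
have [e [N [b [NB E bE]]]] := zero_locus_tangent_basis (fun p => prime_zero_locus (p := p) Yirr fP) Zy MB.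
have ex := susp_zero_locus_tangent Zy.
have b1 : b by apply/bE.
rewrite b1 addn1 in E; move: M MB; rewrite E => M MB.
have [_ Ymax] := smooth_local_dim (Ysm y Yy) MB.
apply: smooth_pointI (NB); split; last first.
  by move=> e' C /zero_locus_chain_extend[C' CY]; apply: Ymax CY.
have [phi [phiP phiJ _ _]] := flexible_dominant Yirr Yy (Ysm y Yy) (Yfl y Yy (Ysm y Yy)) MB.
have [Ycl _] := Yirr; apply: (hypersurface_chain char0 Ycl phiP fy).
have [w wT dw] := ex; have [_ MT] := MB; have /MT/submxP[c Ec] := wT.
apply: NNPP => H; case/eqP: dw; have [_ phi0 _] := phiP.
rewrite Ec -phiJ -phi0 -dderiv_comp /dderiv big1 // => l _.
case: (eqVneq ((f \mPo phi)^`M(l)).@[fun=> 0] 0) => [->|nz]; first by rewrite mulr0.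
by case: H; exists l.
Qed.

(** A dominant map from affine space pulls [f] back to a nonconstant polynomial, which has a zero
    over an algebraically closed field. *)
Lemma nonconst_nonunit : flexible Y -> ~ unitX Y f.
Proof.
move=> Yfl [g fg]; have Ysm := susp_base_smooth; have [_ [[y Yy] _]] := Yirr.
have [d [M MB]] := tangent_basis_exists Y y.
have [phi [[phiY _ _] _ _ phiD]] := flexible_dominant Yirr Yy (Ysm y Yy) (Yfl y Yy (Ysm y Yy)) MB.
have Fnc := comp_nonconst fnc phiD.
have [t Ft] := mpoly_has_root Fnc.
have := fg _ (phiY t); rewrite mevalM -meval_comp Ft mul0r meval1 => /eqP.
by rewrite eq_sym oner_eq0.
Qed.
End SmoothFlexible.

Theorem theorem3p1 (K : closedFieldType) (n : nat)
  (Y : point K n -> Prop) (f : {mpoly K[n]}) :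
  [pchar K] =i pred0 ->
  affine_variety Y -> irreducible_var Y -> flexible Y ->
  ~ (exists c : K, forall y, Y y -> f.@[y] = c) ->
  (smooth (Susp Y f) /\ flexible (Susp Y f) /\ factorial_var (Susp Y f)) <->
  (factorial_var Y /\ smooth Y /\ primeX Y f /\ smooth (zero_locus Y f)).
Proof.
move=> char0 _ Yirr Yfl fnc; have f0 := nonconst_neq0 fnc.
have Ydom : domainX Y.
  split=> [|a b]; last exact: irreducible_domain.
  by have := prime_ideal1 (irreducible_ideal Yirr).
have Xdom := susp_domain Yirr f0.
have [A [piA [piAS piAE]]] := coordinate_ring Ydom.
have [B [piB [piBS piBE]]] := coordinate_ring Xdom.
split=> [[Xsm [Xfl /(coord_factorial piBS piBE)[_ BF]]]|[/(coord_factorial piAS piAE)[_ AF] [Ysm [fP Zsm]]]].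
  have fU : piA f \isn't a GRing.unit.
    by apply/negP => /(coord_unit piAS piAE); apply: nonconst_nonunit fnc Xsm Xfl Yfl.
  have [AF fp] := susp_ring_descent Yirr f0 piAS piAE piBS piBE fU BF.
  have fP : primeX Y f by apply/(coord_prime piAS piAE).
  split; first by apply/(coord_factorial piAS piAE).
  split; first exact: susp_base_smooth fnc Xsm Xfl.
  by split=> //; apply: susp_zero_locus_smooth fnc Xsm Xfl Yfl fP.
have [Xsm Xfl] := susp_smooth_flexible char0 Yirr fnc Ysm Yfl fP Zsm.
split=> //; split=> //; apply/(coord_factorial piBS piBE); split=> //.
apply: (susp_ring_factorization Yirr f0 piAS piAE piBS piBE AF).
exact/(coord_prime piAS piAE).
Qed.
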